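(* Consider the D1Q2 boundary-value scheme of the context, and assume either ($s_2\in(0,2)$ and $0<|\mathscr{C}|\leq1$) or ($s_2=2$ and $0<|\mathscr{C}|<1$). Then, with the classification labels of the context: (A) For $\mathscr{C}<0$ and $s_2\in(0,2)$: bounce-back MU-L; anti-bounce-back MU-L; two-steps anti-bounce-back SS; extrapolation with $\sigma=1$ SS; extrapolation with $2\leq\sigma\leq4$ SS; kinetic Dirichlet SS. For $\mathscr{C}<0$ and $s_2=2$: bounce-back MU-E; anti-bounce-back MU-E; two-steps anti-bounce-back SSOO; extrapolation $\sigma=1$ SSOO; extrapolation $2\leq\sigma\leq4$ MU-E; kinetic Dirichlet SS. For $\mathscr{C}>0$ and $s_2\in(0,2]$: bounce-back SS; anti-bounce-back SS; two-steps anti-bounce-back SS; extrapolation $\sigma=1$ MU-E; extrapolation $2\leq\sigma\leq4$ MU-E; kinetic Dirichlet SS. (B) For the specific parameters: with $\mathscr{C}=-\tfrac12$, $s_2=\tfrac32$: extrapolated equilibrium $\sigma=1$ SS, extrapolated equilibrium $\sigma=3$ SS, future SS, invented GR-L. With $\mathscr{C}=-\tfrac12$, $s_2=2$: extrapolated equilibrium $\sigma=1$ SS, extrapolated equilibrium $\sigma=3$ GR-L, future SS, invented GR-L. With $\mathscr{C}=\tfrac12$ and $s_2\in\{\tfrac32,2\}$: extrapolated equilibrium $\sigma=1$ MU-E, extrapolated equilibrium $\sigma=3$ GR-L, future MU-E, invented GR-L.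
   Context: Grid: $x_j=j\Delta x$, $j\in\mathbb{N}$ (ghost point $j=-1$), $t^n=n\Delta t$ with $\Delta t=\Delta x/\lambda$, $\lambda>0$; Courant number $\mathscr{C}=V/\lambda\neq0$ (the transport velocity is $V$; $\mathscr{C}<0$: outflow boundary, $\mathscr{C}>0$: inflow boundary). Unknowns $f_{1,j}^n,f_{2,j}^n$ (velocities $c_1=1$, $c_2=-1$), moments $m_1=f_1+f_2$, $m_2=f_1-f_2$. Relaxation at every $j\in\mathbb{N}$: $m_1^\star=m_1$, $m_2^\star=(1-s_2)m_2+s_2\mathscr{C}m_1$, and $f_1^\star=(m_1+m_2^\star)/2$, $f_2^\star=(m_1-m_2^\star)/2$. Transport: $f^{n+1}_{1,j}=f^{n\star}_{1,j-1}$, $f^{n+1}_{2,j}=f^{n\star}_{2,j+1}$ for $j\in\mathbb{N}$. Zero initial data. The ghost value $f^{n\star}_{1,-1}$ is given by one of the boundary conditions ($g^n_{1,-1}\in\mathbb{R}$ is a source): bounce-back: $f^{n\star}_{1,-1}=f^{n\star}_{2,0}+g^n_{1,-1}$; anti-bounce-back: $f^{n\star}_{1,-1}=-f^{n\star}_{2,0}+g^n_{1,-1}$; two-steps anti-bounce-back: $f^{n\star}_{1,-1}=-f^{n\star}_{2,1}+g^n_{1,-1}$; extrapolation of order $\sigma\geq1$: $f^{n\star}_{1,-1}=\sum_{j=0}^{\sigma-1}(-1)^j\binom{\sigma}{j+1}f^{n\star}_{1,j}+g^n_{1,-1}$; kinetic Dirichlet: $f^{n\star}_{1,-1}=g^n_{1,-1}$;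 extrapolated equilibrium of order $\sigma\geq1$: $f^{n\star}_{1,-1}=\tfrac12(1+\mathscr{C})\sum_{j=0}^{\sigma-1}(-1)^j\binom{\sigma}{j+1}(f^{n\star}_{1,j}+f^{n\star}_{2,j})+g^n_{1,-1}$; future: $f^{n\star}_{1,-1}=\tfrac12(1+\mathscr{C})(f^{n\star}_{1,0}+f^{n\star}_{2,2})+g^n_{1,-1}$; invented: $f^{n\star}_{1,-1}=f^{n\star}_{1,0}+2f^{n\star}_{2,0}+g^n_{1,-1}$. Strong stability (SS estimate): there is $C>0$ such that for all $\alpha>0$, all sources $(g^n_{1,-1})_n$ and all $\Delta x>0$: $\frac{\alpha}{1+\alpha\Delta t}\sum_{n,j\in\mathbb{N}}\Delta t\Delta x\,e^{-2\alpha n\Delta t}|m^n_j|^2\leq C\sum_{n\in\mathbb{N}}\Delta t\,e^{-2\alpha n\Delta t}(g^n_{1,-1})^2$, with $m^n_j=(m^n_{1,j},m^n_{2,j})$. Strong stability on the observed output (SSOO estimate): the same with $|m^n_j|^2$ replaced by $(m^n_{1,j})^2$. Classification labels: SS = the SS estimate holds (hence also SSOO). SSOO = the SSOO estimate holds but the SS estimate does not. MU-L / MU-E / GR-L = neither estimate holds; ''MU'' (mildly unstable) means the instability is produced by a critical mode $(z,\kappa)$ (time factor $z$, space factor $\kappa$, i.e. a pair solving both $\det(zI-\hat E(\kappa))=0$ for the bulk and the corresponding determinant for the boundary scheme, with $\kappa$ the limit of the stable spatial root) with $|z|=1$, and ''GR'' (Godunov–Ryabenkii) means $|z|>1$; suffix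 ''L'' means $|\kappa|<1$ (instability localized at the boundary), ''E'' means $|\kappa|=1$ (instability extended in space). *)

(* Defs.v *)
From HB Require Import structures.
From mathcomp Require Import all_boot all_order all_algebra.
From mathcomp Require Import all_classical all_reals all_analysis.
From mathcomp Require Import complex.

Set Implicit Arguments.
Unset Strict Implicit.
Unset Printing Implicit Defensive.

Import Order.TTheory GRing.Theory Num.Theory.
Local Open Scope ring_scope.

Section D1Q2.
Variable R : realType.

(* Boundary conditions.  Every boundary condition of the paper has the *)
(* form  f*_{1,-1} = sum_{j < K} (p_j f*_{1,j} + q_j f*_{2,j}) + g ;   *)
(* we encode it by the finite list of coefficient pairs (p_j, q_j).    *)
Definition bcond := seq (R * R).

Definition bc_coef (b : bcond) (j : nat) : R * R := nth (0, 0) b j.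

Definition ghost (b : bcond) (f1s f2s : nat -> R) : R :=
  \sum_(j < size b) ((bc_coef b j).1 * f1s j + (bc_coef b j).2 * f2s j).

Definition bc_BB : bcond := [:: (0, 1)].
Definition bc_ABB : bcond := [:: (0, -1)].
Definition bc_ABB2 : bcond := [:: (0, 0); (0, -1)].
Definition bc_extr (sigma : nat) : bcond :=
  [seq ((-1) ^+ j * ('C(sigma, j.+1))%:R, 0) | j <- iota 0 sigma].
Definition bc_KD : bcond := [::].
Definition bc_extreq (C : R) (sigma : nat) : bcond :=
  [seq ((1 + C) / 2 * ((-1) ^+ j * ('C(sigma, j.+1))%:R),
        (1 + C) / 2 * ((-1) ^+ j * ('C(sigma, j.+1))%:R)) | j <- iota 0 sigma].
Definition bc_future (C : R) : bcond :=
  [:: ((1 + C) / 2, 0); (0, 0); (0, (1 + C) / 2)].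
Definition bc_invented : bcond := [:: (1, 2)].

(* The scheme (in lattice units; it does not depend on Delta x).      *)
Definition state := ((nat -> R) * (nat -> R))%type.

Definition collide (C s : R) (st : state) : state :=
  let m1 := fun j => st.1 j + st.2 j in
  let m2 := fun j => st.1 j - st.2 j in
  let m2s := fun j => (1 - s) * m2 j + s * C * m1 j in
  (fun j => (m1 j + m2s j) / 2, fun j => (m1 j - m2s j) / 2).

Definition step (C s : R) (b : bcond) (gn : R) (st : state) : state :=
  let sts := collide C s st in
  (fun j => match j with
            | 0 => ghost b sts.1 sts.2 + gn
            | j'.+1 => sts.1 j'
            end,
   fun j => sts.2 j.+1).

Fixpoint sol (C s : R) (b : bcond) (g : nat -> R) (n : nat) : state :=
  match n with
  | 0 => (fun _ => 0, fun _ => 0)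
  | n'.+1 => step C s b (g n') (sol C s b g n')
  end.

Definition mom1 C s b g n j : R := (sol C s b g n).1 j + (sol C s b g n).2 j.
Definition mom2 C s b g n j : R := (sol C s b g n).1 j - (sol C s b g n).2 j.

Local Open Scope ereal_scope.

Definition estimate (lam : R) (C s : R) (b : bcond)
  (q : (nat -> R) -> nat -> nat -> R) : Prop :=
  exists K : R, (0 < K)%R /\
  forall (alpha : R), (0 < alpha)%R ->
  forall (g : nat -> R) (dx : R), (0 < dx)%R ->
  let dt := (dx / lam)%R in
  (alpha / (1 + alpha * dt))%:E *
    (\sum_(n <oo) \sum_(j <oo)
       (dt * dx * expR (- (2 * alpha * n%:R * dt)) * q g n j)%:E)
  <= K%:E * (\sum_(n <oo) (dt * expR (- (2 * alpha * n%:R * dt)) * g n ^+ 2)%:E).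

Definition SS_est (lam C s : R) (b : bcond) : Prop :=
  estimate lam C s b
    (fun g n j => mom1 C s b g n j ^+ 2 + mom2 C s b g n j ^+ 2)%R.

Definition SSOO_est (lam C s : R) (b : bcond) : Prop :=
  estimate lam C s b (fun g n j => mom1 C s b g n j ^+ 2)%R.

Local Close Scope ereal_scope.

Local Open Scope complex_scope.

(* the relaxation matrix acting on (f1, f2) (complexified) *)
Definition relaxM (C s : R) : 'M[R[i]]_2 :=
  \matrix_(i < 2, k < 2)
    (if i == 0 then (if k == 0 then ((2 - s + s * C) / 2)%R%:C
                               else ((s + s * C) / 2)%R%:C)
               else (if k == 0 then ((s - s * C) / 2)%R%:C
                               else ((2 - s - s * C) / 2)%R%:C)).

(* Bulk symbol multiplied by diag(kappa,1) to clear the kappa^{-1}: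
   bulkN z kappa = diag(kappa,1) (z I - Ehat(kappa)),
   with Ehat(kappa) = diag(kappa^{-1}, kappa) relaxM. *)
Definition bulkN (C s : R) (z kappa : R[i]) : 'M[R[i]]_2 :=
  z *: (\matrix_(i < 2, k < 2) (if i == k then (if i == 0 then kappa else 1) else 0))
  - (\matrix_(i < 2, k < 2) (if i == k then (if i == 0 then 1 else kappa) else 0))
    *m relaxM C s.

Definition bulk_char (C s : R) (z kappa : R[i]) : R[i] := \det (bulkN C s z kappa).

Definition stable_root (C s : R) (z kappa : R[i]) : Prop :=
  1 < `|z| /\ `|kappa| < 1 /\ bulk_char C s z kappa = 0.

Definition limit_stable_root (C s : R) (z kappa : R[i]) : Prop :=
  `|z| = 1 /\ bulk_char C s z kappa = 0 /\
  forall eps : R, (0 < eps)%R ->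
    exists zeta kappa', stable_root C s zeta kappa' /\
      `|zeta - z| < eps%:C /\ `|kappa' - kappa| < eps%:C.

(* the boundary scheme admits the mode z^n kappa^j phi: nonzero phi in the
   bulk kernel satisfying the boundary equation
   z phi_1 = sum_j kappa^j (p_j (M phi)_1 + q_j (M phi)_2) *)
Definition boundary_mode (C s : R) (b : bcond) (z kappa : R[i]) : Prop :=
  exists phi : 'cV[R[i]]_2, phi != 0 /\
    bulkN C s z kappa *m phi = 0 /\
    z * phi 0 0 =
      \sum_(j < size b)
        kappa ^+ j * ((bc_coef b j).1%:C * (relaxM C s *m phi) 0 0
                      + (bc_coef b j).2%:C * (relaxM C s *m phi) 1 0).

Definition GR_mode (C s : R) (b : bcond) : Prop :=
  exists z kappa, stable_root C s z kappa /\ boundary_mode C s b z kappa.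

Definition GR_L_mode (C s : R) (b : bcond) : Prop :=
  exists z kappa, stable_root C s z kappa /\ `|kappa| < 1 /\
                  boundary_mode C s b z kappa.

Definition MU_L_mode (C s : R) (b : bcond) : Prop :=
  exists z kappa, limit_stable_root C s z kappa /\ `|kappa| < 1 /\
                  boundary_mode C s b z kappa.

Definition MU_E_mode (C s : R) (b : bcond) : Prop :=
  exists z kappa, limit_stable_root C s z kappa /\ `|kappa| = 1 /\
                  boundary_mode C s b z kappa.

Local Close Scope complex_scope.

Definition lab_SS lam C s b : Prop := SS_est lam C s b.
Definition lab_SSOO lam C s b : Prop := SSOO_est lam C s b /\ ~ SS_est lam C s b.
Definition lab_MU_L lam C s b : Prop :=
  ~ SS_est lam C s b /\ ~ SSOO_est lam C s b /\ ~ GR_mode C s b /\ MU_L_mode C s b.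
Definition lab_MU_E lam C s b : Prop :=
  ~ SS_est lam C s b /\ ~ SSOO_est lam C s b /\ ~ GR_mode C s b /\ MU_E_mode C s b.
Definition lab_GR_L lam C s b : Prop :=
  ~ SS_est lam C s b /\ ~ SSOO_est lam C s b /\ GR_L_mode C s b.

End D1Q2.

(* Main.v *)
(* Write h for the ghost values of a solution. Driven by h, every scheme becomes the kinetic Dirichlet
   scheme, whose energy estimate makes the generating functions in time converge for |w| < 1, w = 1/z;
   they are multiples of kap(w)^j (1 - cd kap w, cc w), where kap is the stable spatial root. The boundary
   condition becomes the scalar equation (1 - T(w)) h = g with
   (1 - cd kap w) (1 - T(w)) = N(w, kap), N the Kreiss-Lopatinskii determinant.
   Parseval over N-th roots of unity turns pointwise bounds on symbols into weighted l^2 bounds, so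
   stability follows when N can be multiplied by a bounded symbol into 1 - X with |X| <= q < 1.
   Conversely, at a critical w = +-1 the sources g_n = (+-1)^n give (1 -+ w) h = 1 / (1 - T), and
   N = O((1 - |w|) |m|), m the symbol of the observed quantity, contradicts the estimate; for a zero
   of N inside the disc the source is an impulse.
   For s = 2, C < 0, the critical mode of the two-steps anti-bounce-back condition and of extrapolation
   with sigma = 1 satisfies m1 = 0 but m2 <> 0, which separates the two estimates. *)

Require Import Defs.
From HB Require Import structures.
From mathcomp Require Import all_boot all_order all_algebra.
From mathcomp Require Import all_classical all_reals all_analysis.
From mathcomp Require Import complex cyclic separable cyclotomic ring lra.
Import Order.TTheory GRing.Theory Num.Theory numFieldNormedType.Exports.
Local Open Scope ring_scope.

(** The energy [(1 - C) f1^2 + (1 + C) f2^2] serves twice: summed over space it bounds the Dirichlet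
    scheme, and evaluated on an eigenvector of the symbol it locates the spatial roots and bounds
    the reflection coefficient. The bound [|kap| <= |w|], rather than mere [|kap| < 1], makes cell j
    contribute [r^(2 j)]; the sum over j then costs [1 / (1 - r^2)], which is what the factor
    [alpha / (1 + alpha dt)] pays for. The obstacle is uniformity up to [|w| = 1] when s = 2: both
    roots can then reach modulus 1, and near w = 1 and w = -1 they are told apart only by the sign
    of [C Re kap Re w], so the delicate conservative cases rest on [kap_sign]. The ghost values of
    an arbitrary boundary condition are not known in advance to have a generating function in the
    whole disc. Upper bounds avoid the question by truncating causal operators at a finite time;
    lower bounds extract it from the very estimate to be refuted, which controls m1 and, through the
    bulk recursion, f2. *)

Section D1Q2Boundary.

Set Implicit Arguments.
Unset Strict Implicit.
Unset Printing Implicit Defensive.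
Local Open Scope complex_scope.
Local Open Scope classical_set_scope.
Local Notation Re := complex.Re.
Local Notation Im := complex.Im.

(** * Real-valued modulus on [R[i]] and roots of unity *)

Section Modulus.
Variable R : realType.
Implicit Types (x y : R) (z w : R[i]).

(** The norm of [R[i]] takes its values in [R[i]]; a modulus in [R] lets the order lemmas and [lra]
    apply. *)
Definition cn (z : R[i]) : R := ComplexField.Normc.normc z.

Lemma normE z : `|z| = (cn z)%:C.
Proof. by case: z => a b; rewrite normc_def. Qed.

Lemma cn_ge0 z : 0 <= cn z.
Proof. by case: z => a b; exact: sqrtr_ge0. Qed.

Lemma cnM z w : cn (z * w) = cn z * cn w.
Proof. exact: ComplexField.Normc.normcM. Qed.

Lemma cnD z w : cn (z + w) <= cn z + cn w.
Proof. by rewrite -lecR rmorphD/= -!normE ler_normD. Qed.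

Lemma cnN z : cn (- z) = cn z.
Proof. by apply: (@complexI R); rewrite -!normE normrN. Qed.

Lemma cnB z w : cn (z - w) <= cn z + cn w.
Proof. by rewrite -(cnN w) cnD. Qed.

Lemma cnC z w : cn (z - w) = cn (w - z).
Proof. by rewrite -cnN opprB. Qed.

Lemma cn0 : cn 0 = 0.
Proof. exact: ComplexField.Normc.normc0. Qed.

Lemma cn1 : cn 1 = 1.
Proof. exact: ComplexField.Normc.normc1. Qed.

Lemma cn_eq0 z : (cn z == 0) = (z == 0).
Proof.
apply/eqP/eqP => [/ComplexField.Normc.eq0_normc //|->]; exact: cn0.
Qed.

Lemma cn_gt0 z : (0 < cn z) = (z != 0).
Proof. by rewrite lt_def cn_ge0 andbT cn_eq0. Qed.

Lemma cnV z : cn z^-1 = (cn z)^-1.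
Proof. exact: ComplexField.Normc.normcV. Qed.

Lemma cnX z n : cn (z ^+ n) = cn z ^+ n.
Proof.
by elim: n => [|n ih]; rewrite ?expr0 ?cn1 // !exprS cnM ih.
Qed.

Lemma cn_real x : cn x%:C = `|x|.
Proof. by rewrite /cn/= expr0n /= addr0 sqrtr_sqr. Qed.

Lemma cn_sqr z : cn z ^+ 2 = Re z ^+ 2 + Im z ^+ 2.
Proof. by case: z => a b; rewrite sqr_sqrtr// addr_ge0 ?sqr_ge0. Qed.

Lemma cn_Re z : `|Re z| <= cn z.
Proof.
by rewrite -ler_sqr ?nnegrE ?cn_ge0// cn_sqr real_normK ?num_real// lerDl sqr_ge0.
Qed.

Lemma cn_Im z : `|Im z| <= cn z.
Proof.
by rewrite -ler_sqr ?nnegrE ?cn_ge0// cn_sqr real_normK ?num_real// lerDr sqr_ge0.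
Qed.

Lemma cn_sum (I : Type) (s : seq I) (P : pred I) (F : I -> R[i]) :
  cn (\sum_(i <- s | P i) F i) <= \sum_(i <- s | P i) cn (F i).
Proof.
elim/big_rec2 : _ => [|i y1 y2 _ h]; first by rewrite cn0.
by rewrite (le_trans (cnD _ _))// lerD2l.
Qed.

Lemma cn_le_sub z w : cn z - cn w <= cn (z + w).
Proof. by rewrite lerBlDr -[X in cn X <= _](addrK w) cnB. Qed.

Lemma ReD z w : Re (z + w) = Re z + Re w. Proof. by case: z w => [? ?] [? ?]. Qed.
Lemma ImD z w : Im (z + w) = Im z + Im w. Proof. by case: z w => [? ?] [? ?]. Qed.

Lemma Re_sum (I : Type) (s : seq I) (P : pred I) (F : I -> R[i]) :
  Re (\sum_(i <- s | P i) F i) = \sum_(i <- s | P i) Re (F i).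
Proof. exact: (big_morph _ ReD (erefl : Re (0 : R[i]) = 0)). Qed.

Lemma Im_sum (I : Type) (s : seq I) (P : pred I) (F : I -> R[i]) :
  Im (\sum_(i <- s | P i) F i) = \sum_(i <- s | P i) Im (F i).
Proof. exact: (big_morph _ ImD (erefl : Im (0 : R[i]) = 0)). Qed.

Lemma cn_le_ReIm z : cn z <= `|Re z| + `|Im z|.
Proof.
rewrite -ler_sqr ?nnegrE ?cn_ge0 ?addr_ge0// cn_sqr sqrrD !real_normK ?num_real//.
by rewrite addrAC lerDl mulrn_wge0// mulr_ge0.
Qed.

(** [X^n - 1] splits over the closed field and is separable, so its n distinct roots contain a
    primitive one. These roots are the sample points of [discrete_parseval]. *)
Lemma prim_root_exists (n : nat) : (n > 0)%N -> exists z : R[i], n.-primitive_root z.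
Proof.
move=> n_gt0; pose p : {poly R[i]} := 'X^n - 1.
have [r Dp] := closed_field_poly_normal p.
rewrite (monicP _) ?monicXnsubC // scale1r in Dp.
have rn1 : all n.-unity_root r by apply/allP=> z; rewrite -root_prod_XsubC -Dp.
have sz_r : (n < (size r).+1)%N.
  by rewrite -(size_prod_XsubC r id) -Dp size_XnsubC.
have [|z] := hasP (has_prim_root n_gt0 rn1 _ sz_r); last by exists z.
by rewrite -separable_prod_XsubC -Dp separable_Xn_sub_1 // pnatr_eq0 -lt0n.
Qed.

End Modulus.

(** * Generating functions in time *)

Section Transform.
Variable R : realType.
Implicit Types (u v h : nat -> R) (w l : R[i]) (r : R).

Lemma geo_sum (x : R) k : (\sum_(i < k) x ^+ i) * (1 - x) = 1 - x ^+ k.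
Proof. by rewrite -(opprB (x ^+ k)) subrX1 mulrC -mulNr opprB. Qed.

Lemma cvg0_mull (a : R) (f : nat -> R) :
  f @ \oo --> (0 : R) -> (fun n => a * f n) @ \oo --> (0 : R).
Proof. by move=> h; have := cvgMl_tmp (a := a) h; rewrite mulr0; apply. Qed.

(* Sequences whose generating function converges on the open unit disc. *)
Definition tame u := forall y : R, 1 < y -> exists B, forall n, `|u n| <= B * y ^+ n.

Definition psum u w N : R[i] := \sum_(n < N) (u n)%:C * w ^+ n.

(** Convergence is expressed by real distances, so that only limits in [R] occur. *)
Definition is_hat u w l := (fun N => cn (l - psum u w N)) @ \oo --> (0 : R).

Lemma cn_psumB u w (B rho : R) N k : 0 <= rho < 1 ->
  (forall n, cn ((u n)%:C * w ^+ n) <= B * rho ^+ n) ->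
  cn (psum u w (N + k) - psum u w N) <= B / (1 - rho) * rho ^+ N.
Proof.
move=> /andP[r0 r1] hB.
have B0 : 0 <= B by move: (hB 0%N); rewrite [rho ^+ _]expr0 mulr1 => h; exact: le_trans (cn_ge0 _) h.
have -> : psum u w (N + k) - psum u w N = \sum_(i < k) (u (N + i)%N)%:C * w ^+ (N + i).
  by rewrite /psum big_split_ord/= addrAC subrr add0r.
apply: le_trans (cn_sum _ _ _) _.
have -> : B / (1 - rho) * rho ^+ N = B * rho ^+ N / (1 - rho) by ring.
rewrite ler_pdivlMr ?subr_gt0//.
apply: (@le_trans _ _ ((\sum_(i < k) B * rho ^+ N * rho ^+ i) * (1 - rho))).
  rewrite ler_wpM2r ?subr_ge0 ?(ltW r1)//; apply: ler_sum => i _.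
  by rewrite -mulrA -exprD hB.
rewrite -mulr_sumr -mulrA ler_piMr ?mulr_ge0 ?exprn_ge0//.
by rewrite geo_sum gerBl exprn_ge0.
Qed.

Lemma is_hat_err u w l (B rho : R) : 0 <= rho < 1 ->
  (forall n, cn ((u n)%:C * w ^+ n) <= B * rho ^+ n) -> is_hat u w l ->
  forall N, cn (l - psum u w N) <= B / (1 - rho) * rho ^+ N.
Proof.
move=> r01 hB hl N; apply/ler_addgt0Pr => e e0.
move/cvgrPdist_lt : hl => /(_ e e0)[M _ hM].
have := hM (N + M)%N (leq_addl _ _); rewrite /= sub0r normrN ger0_norm ?cn_ge0// => h.
have -> : l - psum u w N = (l - psum u w (N + M)) + (psum u w (N + M) - psum u w N).
  by rewrite addrA subrK.
by rewrite (le_trans (cnD _ _))// addrC lerD ?(ltW h)// cn_psumB.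
Qed.


Lemma is_hatP u w l :
  is_hat u w l <-> forall e, 0 < e -> \forall N \near \oo, cn (l - psum u w N) < e.
Proof.
split=> [/cvgrPdist_lt h e /h|h]; last apply/cvgrPdist_lt => e /h.
  by apply: filterS => N; rewrite sub0r normrN ger0_norm ?cn_ge0.
by apply: filterS => N; rewrite sub0r normrN ger0_norm ?cn_ge0.
Qed.

Lemma is_hat_unique u w l l' : is_hat u w l -> is_hat u w l' -> l = l'.
Proof.
move=> /is_hatP h /is_hatP h'; apply/eqP; rewrite -subr_eq0 -cn_eq0 eq_le cn_ge0 andbT.
apply/ler_addgt0Pr => e e0; rewrite add0r.
have e20 : 0 < e / 2 by rewrite divr_gt0.
near \oo => N.
rewrite -(subrKA (psum u w N)) (le_trans (cnD _ _))// (splitr e) lerD// ltW//.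
  by near: N; exact: h.
by rewrite cnC; near: N; exact: h'.
Unshelve. all: by end_near. Qed.

Lemma eq_is_hat u v w l : u =1 v -> is_hat u w l -> is_hat v w l.
Proof.
move=> uv; apply: cvg_trans; apply: near_eq_cvg; near=> N.
by congr (cn (_ - _)); apply: eq_bigr => i _; rewrite uv.
Unshelve. all: by end_near. Qed.

Lemma psumD u v w N : psum (fun n => u n + v n) w N = psum u w N + psum v w N.
Proof.
by rewrite /psum -big_split; apply: eq_bigr => i _; rewrite /= rmorphD mulrDl.
Qed.

Lemma psumZ x u w N : psum (fun n => x * u n) w N = x%:C * psum u w N.
Proof.
by rewrite /psum mulr_sumr; apply: eq_bigr => i _; rewrite /= rmorphM mulrA.
Qed.

Lemma psumS u w N : psum u w N.+1 = (u 0%N)%:C + w * psum (fun n => u n.+1) w N.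
Proof.
rewrite /psum big_ord_recl expr0 mulr1 mulr_sumr; congr (_ + _).
by apply: eq_bigr => i _; rewrite mulrCA -exprS.
Qed.

Lemma is_hatD u v w l l' : is_hat u w l -> is_hat v w l' ->
  is_hat (fun n => u n + v n) w (l + l').
Proof.
move=> /is_hatP h /is_hatP h'; apply/is_hatP => e e0.
have e20 : 0 < e / 2 by rewrite divr_gt0.
near=> N; rewrite psumD opprD addrACA (splitr e) (le_lt_trans (cnD _ _))// ltrD//.
  by near: N; exact: h.
by near: N; exact: h'.
Unshelve. all: by end_near. Qed.

Lemma is_hatZ x u w l : is_hat u w l -> is_hat (fun n => x * u n) w (x%:C * l).
Proof.
move=> h; rewrite /is_hat; have -> : (fun N => cn (x%:C * l - psum (fun n => x * u n) w N)) =
  (fun N => `|x| * cn (l - psum u w N)).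
  by apply/funext => N; rewrite psumZ -mulrBr cnM cn_real.
exact: cvg0_mull.
Qed.

Lemma is_hat_delay u w l : is_hat u w l ->
  is_hat (fun n => if n is m.+1 then u m else 0) w (w * l).
Proof.
move=> h; rewrite /is_hat -cvg_shiftS.
have -> : (fun N => cn (w * l - psum (fun n => if n is m.+1 then u m else 0) w N.+1)) =
  (fun N => cn w * cn (l - psum u w N)).
  by apply/funext => N; rewrite psumS add0r -mulrBr cnM.
exact: cvg0_mull.
Qed.

Lemma is_hat_shift u w l : w != 0 -> u 0%N = 0 -> is_hat u w l ->
  is_hat (fun n => u n.+1) w (l / w).
Proof.
move=> w0 u0 h.
rewrite /is_hat; have -> : (fun N => cn (l / w - psum (fun n => u n.+1) w N)) =
  (fun N => (cn w)^-1 * cn (l - psum u w N.+1)).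
  apply/funext => N; rewrite psumS u0 add0r -cnV -cnM.
  by rewrite mulrBr mulKf// mulrC.
apply: cvg0_mull.
by rewrite (cvg_shiftS (fun N => cn (l - psum u w N))).
Qed.

Lemma is_hat_fin u w N : (forall n, (N <= n)%N -> u n = 0) -> is_hat u w (psum u w N).
Proof.
move=> h; apply/is_hatP => e e0; exists N => // M /= NM.
rewrite -(subnKC NM) /psum big_split_ord/= opprD addrA subrr sub0r cnN big1 ?cn0//.
by move=> i _; rewrite h ?leq_addr// mul0r.
Qed.

Lemma tame_is_hat u w : tame u -> cn w < 1 -> exists l, is_hat u w l.
Proof.
move=> tu w1.
(* [y = 2 / (1 + |w|)] lies above 1 and keeps [y |w| < 1], both because [|w| < 1]. *)
have [y y1 yw] : exists2 y : R, 1 < y & y * cn w < 1.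
  have p1 : 0 < 1 + cn w by have := cn_ge0 w; lra.
  exists (2 / (1 + cn w)); first by rewrite ltr_pdivlMr// mul1r; lra.
  by rewrite mulrAC ltr_pdivrMr// mul1r; lra.
have [B hB] := tu y y1.
have yw0 : 0 <= y * cn w by rewrite mulr_ge0 ?cn_ge0// ltW// (lt_trans ltr01).
have hb n : cn ((u n)%:C * w ^+ n) <= B * (y * cn w) ^+ n.
  by rewrite cnM cn_real cnX exprMn mulrA ler_wpM2r ?exprn_ge0 ?cn_ge0.
have geo : cvgn (series (fun n => B * (y * cn w) ^+ n)).
  by apply: is_cvg_geometric_series; rewrite ger0_norm.
have v0 n : 0 <= B * (y * cn w) ^+ n by exact: le_trans (cn_ge0 _) (hb n).
have cR : cvgn (series (fun n => Re ((u n)%:C * w ^+ n))).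
  apply: normed_cvg; apply: series_le_cvg geo => // n.
  exact: normr_ge0. exact: le_trans (cn_Re _) (hb n).
have cI : cvgn (series (fun n => Im ((u n)%:C * w ^+ n))).
  apply: normed_cvg; apply: series_le_cvg geo => // n.
  exact: normr_ge0. exact: le_trans (cn_Im _) (hb n).
exists (Complex (limn (series (fun n => Re ((u n)%:C * w ^+ n))))
                (limn (series (fun n => Im ((u n)%:C * w ^+ n))))).
set lR := limn _; set lI := limn _.
apply/is_hatP => e e0.
have e20 : 0 < e / 2 by rewrite divr_gt0.
near=> N; apply: le_lt_trans (cn_le_ReIm _) _.
have -> : Re (lR +i* lI - psum u w N) = lR - series (fun n => Re ((u n)%:C * w ^+ n)) N.
  by rewrite /series/= big_mkord -Re_sum -/(psum u w N); case: (psum u w N).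
have -> : Im (lR +i* lI - psum u w N) = lI - series (fun n => Im ((u n)%:C * w ^+ n)) N.
  by rewrite /series/= big_mkord -Im_sum -/(psum u w N); case: (psum u w N).
rewrite (splitr e) ltrD//; near: N.
  by move/cvgrPdist_lt : cR => /(_ _ e20).
by move/cvgrPdist_lt : cI => /(_ _ e20).
Unshelve. all: by end_near. Qed.

(** The constants do not depend on the point w of the disc: [symbol_bound] needs a truncation error
    that is uniform over the circle. *)
Lemma tame_geo u r : tame u -> 0 < r < 1 ->
  exists B rho, 0 <= rho < 1 /\ forall w, cn w <= r -> forall l, is_hat u w l ->
    forall N, cn (l - psum u w N) <= B * rho ^+ N.
Proof.
move=> tu /andP[r0 r1].
have [y y1 yw] : exists2 y : R, 1 < y & y * r < 1.
  have p1 : 0 < 1 + r by lra.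
  exists (2 / (1 + r)); first by rewrite ltr_pdivlMr// mul1r; lra.
  by rewrite mulrAC ltr_pdivrMr// mul1r; lra.
have [B hB] := tu y y1.
have y0 : 0 <= y by rewrite ltW// (lt_trans ltr01).
have B0 : 0 <= B by move: (hB 0%N); rewrite expr0 mulr1; apply: le_trans.
exists (B / (1 - y * r)), (y * r); split; first by rewrite yw mulr_ge0// ltW.
move=> w wr l hl; apply: (is_hat_err _ _ hl); first by rewrite yw mulr_ge0// ltW.
move=> n; rewrite cnM cn_real cnX exprMn mulrA ler_pM ?normr_ge0 ?exprn_ge0 ?cn_ge0//.
by rewrite lerXn2r// nnegrE ?cn_ge0// ltW.
Qed.

End Transform.

(** * Discrete Parseval identity and symbol bounds *)

Section Parseval.
Variable R : realType.
Implicit Types (u v h : nat -> R) (w l : R[i]) (r Q : R).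

Definition cj (z : R[i]) : R[i] := Complex (Re z) (- Im z).

Lemma cjD z w : cj (z + w) = cj z + cj w.
Proof. by case: z w => [a b] [c d]; rewrite /cj /= opprD. Qed.

Lemma cjM z w : cj (z * w) = cj z * cj w.
Proof.
by case: z w => [a b] [c d]; apply/eqP; rewrite eq_complex /= mulrNN mulrN mulNr -opprD !eqxx.
Qed.

Lemma cjX z n : cj (z ^+ n) = cj z ^+ n.
Proof.
elim: n => [|n ih]; first by rewrite !expr0 /cj /= oppr0.
by rewrite !exprS cjM ih.
Qed.

Lemma cj_real (x : R) : cj x%:C = x%:C.
Proof. by rewrite /cj /= oppr0. Qed.

Lemma sqr_cn w : ((cn w) ^+ 2)%:C = w * cj w.
Proof.
rewrite cn_sqr; case: w => a b; apply/eqP; rewrite eq_complex /=.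
by rewrite mulrN opprK -!expr2 mulrN mulrC addNr !eqxx.
Qed.

Lemma psum_conj u w N : cj (psum u w N) = psum u (cj w) N.
Proof.
rewrite /psum (big_morph _ cjD (_ : cj 0 = 0)); last by rewrite /cj /= oppr0.
by apply: eq_bigr => i _; rewrite cjM cjX cj_real.
Qed.

(** Expanding the squared moduli and exchanging sums leaves geometric sums in [om^(m - n)], which
    vanish unless m = n. A finite sample of the circle [|w| = r] thus replaces an integral. *)
Lemma discrete_parseval u r N (om : R[i]) : N.-primitive_root om ->
  \sum_(k < N) cn (psum u (r%:C * om ^+ k) N) ^+ 2 =
  N%:R * \sum_(n < N) (r ^+ n * u n) ^+ 2.
Proof.
move=> hom; have N0 := prim_order_gt0 hom; have om1 := prim_expr_order hom.
have cnom : cn om = 1.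
  apply/eqP; rewrite -(@pexpr_eq1 _ (cn om) N) ?cn_ge0//.
  by rewrite -cnX om1 cn1.
have om0 : om != 0 by rewrite -cn_eq0 cnom oner_eq0.
have omV : cj om = om^-1.
  by apply: (mulfI om0); rewrite mulfV// -sqr_cn cnom expr1n.
apply: (@complexI R); rewrite rmorph_sum rmorphM rmorph_sum rmorph_nat /=.
transitivity (\sum_(k < N) \sum_(m < N) \sum_(n < N)
   (r ^+ m * u m * (r ^+ n * u n))%:C * (om ^+ m / om ^+ n) ^+ k : R[i]).
  apply: eq_bigr => k _; rewrite sqr_cn psum_conj cjM cjX cj_real omV.
  rewrite /psum mulr_suml; apply: eq_bigr => m _; rewrite mulr_sumr.
  apply: eq_bigr => n _; rewrite !rmorphM !rmorphXn/= !exprMn !exprVn -!exprM.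
  rewrite [(k * m)%N]mulnC [(k * n)%N]mulnC; ring.
rewrite exchange_big mulr_sumr; apply: eq_bigr => m _ /=.
rewrite exchange_big (bigD1 m)//= [X in _ + X]big1 ?addr0; last first.
  move=> n nm; rewrite -mulr_sumr; set x := _ / _.
  have x1 : x != 1.
    rewrite /x; apply: contra nm => /eqP e.
    have : om ^+ m == om ^+ n.
      by rewrite -(divfK (expf_neq0 n om0) (om ^+ m)) e mul1r.
    by rewrite (eq_prim_root_expr hom) !modn_small// eq_sym.
  suff -> : \sum_(k < N) x ^+ k = 0 by rewrite mulr0.
  have := subrX1 x N; rewrite /x exprMn exprVn -!exprM ![(_ * N)%N]mulnC !exprM om1.
  rewrite !expr1n invr1 mulr1 subrr => /esym/eqP; rewrite mulf_eq0 subr_eq0.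
  by rewrite (negbTE x1)/= => /eqP.
rewrite (eq_bigr (fun=> (r ^+ m * u m * (r ^+ m * u m))%:C)); last first.
  by move=> k _; rewrite divff ?expf_neq0// expr1n mulr1.
by rewrite sumr_const card_ord -[LHS]mulr_natl.
Qed.

Definition nrm r N u := \sum_(n < N) (r ^+ n * u n) ^+ 2.

Lemma nrm_ge0 r N u : 0 <= nrm r N u.
Proof. by apply: sumr_ge0 => i _; rewrite sqr_ge0. Qed.

Lemma nrm_mono r N M u : (N <= M)%N -> nrm r N u <= nrm r M u.
Proof.
move=> NM; rewrite -(subnKC NM) /nrm big_split_ord/= lerDl.
by apply: sumr_ge0 => i _; rewrite sqr_ge0.
Qed.

Lemma eq_nrm r N u v : (forall n, (n < N)%N -> u n = v n) -> nrm r N u = nrm r N v.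
Proof. by move=> h; apply: eq_bigr => i _; rewrite h. Qed.

Lemma nrm_trunc r N M u : (N <= M)%N ->
  nrm r M (fun n => if (n < N)%N then u n else 0) = nrm r N u.
Proof.
move=> NM; rewrite -(subnKC NM) /nrm big_split_ord/= [X in _ + X]big1 ?addr0.
  by apply: eq_bigr => i _; rewrite ltn_ord.
by move=> i _; rewrite ltnNge leq_addr/= mulr0 expr0n.
Qed.

(** Sampling at M-th roots of unity turns the pointwise bound into one between norms, up to the
    truncation error of u, of order [rho^M]; then M tends to infinity. The finite support of v makes
    its partial sum exact. *)
Lemma symbol_bound u v r Q N : 0 < r < 1 -> 0 <= Q -> tame u ->
  (forall n, (N <= n)%N -> v n = 0) ->
  (forall w l, cn w = r -> is_hat u w l -> cn l <= Q * cn (psum v w N)) ->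
  nrm r N u <= Q ^+ 2 * nrm r N v.
Proof.
move=> /[dup] r01 /andP[r0 r1] Q0 tu v0 h.
have [B [rho [/andP[rho0 rho1] herr]]] := tame_geo tu r01.
pose V := \sum_(n < N) `|v n|.
have V0 : 0 <= V by apply: sumr_ge0.
have hV w : cn w = r -> cn (psum v w N) <= V.
  move=> wr; apply: le_trans (cn_sum _ _ _) _; apply: ler_sum => i _.
  by rewrite cnM cn_real cnX wr ler_piMr// exprn_ile1// ltW.
have key M : (N <= M)%N -> (0 < M)%N ->
  nrm r N u <= Q ^+ 2 * nrm r N v + B * (B + 2 * Q * V) * rho ^+ M.
  move=> NM M0; apply: le_trans (nrm_mono r u NM) _.
  have [om hom] := prim_root_exists R M0.
  have M0' : 0 < M%:R :> R by rewrite ltr0n.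
  rewrite -(ler_pM2l M0') /nrm -(discrete_parseval _ _ hom).
  have -> : M%:R * (Q ^+ 2 * (\sum_(n < N) (r ^+ n * v n) ^+ 2) +
    B * (B + 2 * Q * V) * rho ^+ M) =
    \sum_(k < M) (Q ^+ 2 * cn (psum v (r%:C * om ^+ k) M) ^+ 2 +
      B * (B + 2 * Q * V) * rho ^+ M).
    rewrite big_split/= -mulr_sumr (discrete_parseval _ _ hom) sumr_const card_ord.
    rewrite -/(nrm r N v) -(nrm_trunc r v NM) mulrDr mulrCA.
    congr (_ * (_ * _) + _); last by rewrite mulr_natl.
    by apply: eq_bigr => i _; case: ltnP => // /v0 ->.
  apply: ler_sum => k _; set w := _ * _ ^+ k.
  have wr : cn w = r.
    have cnom : cn om = 1.
      apply/eqP; rewrite -(@pexpr_eq1 _ (cn om) M) ?cn_ge0//.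
      by rewrite -cnX (prim_expr_order hom) cn1.
    by rewrite /w cnM cnX cnom expr1n mulr1 cn_real ger0_norm// ltW.
  have [l hl] : exists l, is_hat u w l by apply: tame_is_hat; rewrite ?wr.
  have e1 := herr w (eq_ind_r (fun x => x <= r) (lexx r) wr) l hl M.
  have e2 := h w l wr hl.
  have e3 : psum v w M = psum v w N.
    rewrite /psum -(subnKC NM) big_split_ord/= [X in _ + X]big1 ?addr0//.
    by move=> i _; rewrite v0 ?leq_addr// mul0r.
  rewrite e3; have e4 := hV w wr.
  set x := cn (psum u w M); set y := cn (psum v w N) in e2 e4 *.
  have x0 : 0 <= x by exact: cn_ge0.
  have y0 : 0 <= y by exact: cn_ge0.
  have hx : x <= Q * y + B * rho ^+ M.
    have -> : x = cn (l - (l - psum u w M)) by rewrite opprB addrC subrK.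
    by rewrite (le_trans (cnB _ _))// lerD.
  have rM : 0 <= rho ^+ M <= 1 by rewrite exprn_ge0// exprn_ile1// ltW.
  have B0 : 0 <= B.
    have := herr w (eq_ind_r (fun x => x <= r) (lexx r) wr) l hl 0%N.
    by rewrite expr0 mulr1; apply: le_trans; exact: cn_ge0.
  apply: (@le_trans _ _ ((Q * y + B * rho ^+ M) ^+ 2)); first by rewrite lerXn2r ?nnegrE// (le_trans x0).
  (* Squaring leaves an error linear in q because [q <= 1]; V bounds y uniformly over the sample
     points. *)
  set q := rho ^+ M in rM *; case/andP: rM => q0 q1.
  have -> : (Q * y + B * q) ^+ 2 = Q ^+ 2 * y ^+ 2 + B * (B * q + 2 * Q * y) * q by ring.
  rewrite lerD2l ler_wpM2r// ler_wpM2l// lerD ?ler_piMr// ler_wpM2l// mulr_ge0//.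
apply/ler_addgt0Pr => e e0.
have := cvg0_mull (B * (B + 2 * Q * V)) (cvg_expr (eq_ind_r (fun x => x < 1) rho1 (ger0_norm rho0))).
move/cvgrPdist_lt => /(_ e e0)[M _ hM].
have := hM (maxn M N.+1) (leq_maxl _ _); rewrite /= sub0r normrN => /ltW hh.
apply: le_trans (key (maxn M N.+1) _ _) _.
- by rewrite (leq_trans _ (leq_maxr _ _)).
- by rewrite (leq_trans _ (leq_maxr _ _)).
by rewrite lerD2l (le_trans (ler_norm _)).
Qed.

End Parseval.

(** * Causal operators and their symbols *)

Section Operators.
Variable R : realType.
Implicit Types (u v h : nat -> R) (w l : R[i]) (r Q x : R).
Implicit Types (A : (nat -> R) -> (nat -> R)) (T : R[i] -> R[i]).

Lemma tame_bounded u B : (forall n, `|u n| <= B) -> tame u.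
Proof.
move=> h y y1; exists B => n; rewrite (le_trans (h n))// ler_peMr//.
  exact: le_trans (h 0%N).
by rewrite exprn_ege1// ltW.
Qed.

Lemma tame_le u v : (forall n, `|v n| <= `|u n|) -> tame u -> tame v.
Proof. by move=> h hu y /hu[B hB]; exists B => n; exact: le_trans (hB n). Qed.

Lemma tameD u v : tame u -> tame v -> tame (fun n => u n + v n).
Proof.
move=> hu hv y y1; have [B hB] := hu y y1; have [B' hB'] := hv y y1.
by exists (B + B') => n; rewrite mulrDl (le_trans (ler_normD _ _))// lerD.
Qed.

Lemma tameZ x u : tame u -> tame (fun n => x * u n).
Proof.
move=> hu y /hu[B hB]; exists (`|x| * B) => n.
by rewrite normrM -mulrA ler_wpM2l.
Qed.

Lemma tame_delay u : tame u -> tame (fun n => if n is m.+1 then u m else 0).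
Proof.
move=> hu y y1; have [B hB] := hu y y1; exists B => n.
have y0 : 0 <= y by rewrite ltW// (lt_trans ltr01).
have B0 : 0 <= B by move: (hB 0%N); rewrite expr0 mulr1; exact: le_trans.
case: n => [|n]; first by rewrite normr0 mulr_ge0// exprn_ge0.
by rewrite (le_trans (hB n))// ler_wpM2l// exprS ler_peMl ?exprn_ge0// ltW.
Qed.

Lemma tame_shift u : tame u -> tame (fun n => u n.+1).
Proof.
move=> hu y y1; have [B hB] := hu y y1; exists (B * y) => n.
by rewrite -mulrA -exprS.
Qed.

Lemma tame_fin u N : (forall n, (N <= n)%N -> u n = 0) -> tame u.
Proof.
move=> h; apply: (@tame_bounded _ (\sum_(i < N) `|u i|)) => n.
case: (ltnP n N) => [nN|/h->]; last by rewrite normr0 sumr_ge0.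
by rewrite (bigD1 (Ordinal nN))//= lerDl sumr_ge0.
Qed.

Definition trunc N u := fun n => if (n < N)%N then u n else 0.

Lemma tame_trunc N u : tame (trunc N u).
Proof. by apply: (@tame_fin _ N) => n; rewrite /trunc ltnNge => ->. Qed.

(** A models a causal convolution operator with symbol T. Causality allows inputs to be cut to
    finite support, where generating functions are polynomials. The point w = 0 is excluded since
    symbols may contain [w^-1]. *)
Record is_op A T : Prop := IsOp {
  op_causal : forall h h' N, (forall n, (n < N)%N -> h n = h' n) ->
    forall n, (n < N)%N -> A h n = A h' n;
  op_tame : forall h, tame h -> tame (A h);
  op_hat : forall h w l, tame h -> 0 < cn w < 1 -> is_hat h w l -> is_hat (A h) w (T w * l) }.

Lemma op_eqT A T T' : (forall w, 0 < cn w < 1 -> T w = T' w) -> is_op A T -> is_op A T'.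
Proof. by move=> e [? ? h3]; split=> // h w l th w1 hl; rewrite -e//; exact: h3. Qed.

Lemma op_eqA A A' T : (forall h n, A h n = A' h n) -> is_op A T -> is_op A' T.
Proof.
move=> e [h1 h2 h3]; split.
- by move=> h h' N hh n nN; rewrite -!e; exact: h1 nN.
- by move=> h /h2; apply: tame_le => n; rewrite e.
- by move=> h w l th w1 hl; apply: eq_is_hat (h3 _ _ _ th w1 hl) => n.
Qed.

Lemma op_id : is_op id (fun=> 1).
Proof. by split=> // h w l th w1 hl; rewrite mul1r. Qed.

Lemma op_zero : is_op (fun _ _ => 0) (fun=> 0).
Proof.
split=> // [h _|h w l _ _ _]; first by apply: (@tame_bounded _ 0) => n; rewrite normr0.
have := @is_hat_fin R (fun=> 0) w 0 (fun _ _ => erefl).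
by rewrite /psum big_ord0 mul0r.
Qed.

Lemma op_comp A A' T T' : is_op A T -> is_op A' T' ->
  is_op (fun h => A (A' h)) (fun w => T w * T' w).
Proof.
move=> [a1 a2 a3] [b1 b2 b3]; split.
- by move=> h h' N hh; apply: a1; exact: b1.
- by move=> h /b2/a2.
- by move=> h w l th w1 hl; rewrite -mulrA; apply: a3 => //; [exact: b2|exact: b3].
Qed.

Lemma op_add A A' T T' : is_op A T -> is_op A' T' ->
  is_op (fun h n => A h n + A' h n) (fun w => T w + T' w).
Proof.
move=> [a1 a2 a3] [b1 b2 b3]; split.
- by move=> h h' N hh n nN; rewrite (a1 h h' N)// (b1 h h' N).
- by move=> h th; apply: tameD; [exact: a2|exact: b2].
- by move=> h w l th w1 hl; rewrite mulrDl; apply: is_hatD; [exact: a3|exact: b3].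
Qed.

Lemma op_scale x A T : is_op A T -> is_op (fun h n => x * A h n) (fun w => x%:C * T w).
Proof.
move=> [a1 a2 a3]; split.
- by move=> h h' N hh n nN; rewrite (a1 h h' N).
- by move=> h th; apply: tameZ; exact: a2.
- by move=> h w l th w1 hl; rewrite -mulrA; apply: is_hatZ; exact: a3.
Qed.

Lemma op_sub A A' T T' : is_op A T -> is_op A' T' ->
  is_op (fun h n => A h n - A' h n) (fun w => T w - T' w).
Proof.
move=> hA /(op_scale (-1))/(op_add hA) h; apply: op_eqT (op_eqA _ h).
  by move=> w _; rewrite rmorphN rmorph1 mulN1r.
by move=> u n; rewrite mulN1r.
Qed.

Definition delay h := fun n : nat => if n is m.+1 then h m else 0.

Lemma op_delay : is_op delay id.
Proof.
split.
- by move=> h h' N hh [|n] nN //=; apply: hh; exact: ltnW.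
- by move=> h; exact: tame_delay.
- by move=> h w l th w1 hl; exact: is_hat_delay.
Qed.

Lemma op_sum (I : Type) (s : seq I) (A : I -> (nat -> R) -> nat -> R) (T : I -> R[i] -> R[i]) :
  (forall i, is_op (A i) (T i)) ->
  is_op (fun h n => \sum_(i <- s) A i h n) (fun w => \sum_(i <- s) T i w).
Proof.
move=> hA; elim: s => [|i s ih].
  by apply: op_eqT (op_eqA _ op_zero) => [w _|h n]; rewrite big_nil.
by apply: op_eqT (op_eqA _ (op_add (hA i) ih)) => [w _|h n]; rewrite big_cons.
Qed.

(** By causality only the first N inputs matter, so h can be arbitrary: its truncation has finite
    support and [symbol_bound] applies. *)
Lemma op_bound A T r Q N h : is_op A T -> 0 < r < 1 -> 0 <= Q ->
  (forall w, cn w = r -> cn (T w) <= Q) -> nrm r N (A h) <= Q ^+ 2 * nrm r N h.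
Proof.
move=> [a1 a2 a3] r01 Q0 hT.
have -> : nrm r N (A h) = nrm r N (A (trunc N h)).
  by apply: eq_nrm => n nN; apply: a1 nN => k kN; rewrite /trunc kN.
rewrite -(nrm_trunc r h (leqnn N)) -/(trunc N h).
have th := @tame_trunc N h.
have hz n : (N <= n)%N -> trunc N h n = 0 by rewrite /trunc ltnNge => ->.
apply: symbol_bound => //; first exact: a2.
move=> w l wr hl.
have w1 : 0 < cn w < 1 by rewrite wr.
rewrite (is_hat_unique hl (a3 _ _ _ th w1 (@is_hat_fin _ _ w _ hz))) cnM.
by rewrite ler_wpM2r ?cn_ge0// hT.
Qed.

(** The difference has symbol 0, hence norm 0 by [op_bound] with Q = 0. Algebra on symbols thereby
    becomes identities between sequences. *)
Lemma op_ext A A' T : is_op A T -> is_op A' T -> forall h n, A h n = A' h n.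
Proof.
move=> hA hA' h n; apply/eqP; rewrite -subr_eq0.
have r01 : 0 < (2^-1 : R) < 1 by lra.
have := @op_bound _ _ (2^-1) 0 n.+1 h (op_sub hA hA') r01 (lexx 0).
rewrite expr0n mul0r => b.
have {b} : nrm 2^-1 n.+1 (fun n => A h n - A' h n) <= 0.
  by apply: b => w _; rewrite subrr cn0.
rewrite /nrm big_ord_recr/= => b.
have : (2^-1 ^+ n * (A h n - A' h n)) ^+ 2 <= 0.
  by apply: le_trans b; rewrite lerDr sumr_ge0// => i _; rewrite sqr_ge0.
rewrite le_eqVlt ltNge sqr_ge0 orbF expf_eq0/= mulf_eq0 expf_eq0 invr_eq0.
by rewrite pnatr_eq0 andbF.
Qed.

(** Termwise [(x + y)^2 <= x^2 / q + y^2 / (1 - q)], whose defect is a square. The weight q is tuned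
    to [contraction_bound], where [q^2 / q = q] can be absorbed. *)
Lemma nrm_convex r N u v q : 0 < q < 1 ->
  nrm r N (fun n => u n + v n) <= nrm r N u / q + nrm r N v / (1 - q).
Proof.
move=> /andP[q0 q1]; rewrite /nrm !mulr_suml -big_split; apply: ler_sum => i _ /=.
rewrite mulrDr; set x := _ * u i; set y := _ * v i.
have q1' : 0 < 1 - q by rewrite subr_gt0.
rewrite -subr_ge0; have -> : x ^+ 2 / q + y ^+ 2 / (1 - q) - (x + y) ^+ 2 =
  ((1 - q) * x - q * y) ^+ 2 / (q * (1 - q)).
  by field; rewrite !gt_eqF.
by rewrite divr_ge0 ?sqr_ge0// mulr_ge0// ltW.
Qed.

Lemma nrmD r N u v : nrm r N (fun n => u n + v n) <= 2 * (nrm r N u + nrm r N v).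
Proof.
have h : 0 < (2^-1 : R) < 1 by lra.
apply: le_trans (nrm_convex r N u v h) _.
have -> : 1 - 2^-1 = 2^-1 :> R by lra.
by rewrite invrK -mulrDl mulrC.
Qed.

(** Truncated norms are finite, so the term [q * nrm r N h] can be moved to the left for any h, tame
    or not. *)
Lemma contraction_bound A T r q N h v : is_op A T -> 0 < r < 1 -> 0 < q < 1 ->
  (forall w, cn w = r -> cn (T w) <= q) ->
  (forall n, h n = A h n + v n) -> nrm r N h <= nrm r N v / (1 - q) ^+ 2.
Proof.
move=> hA r01 /[dup] q01 /andP[q0 q1] hT e.
have b := op_bound N h hA r01 (ltW q0) hT.
have : nrm r N h <= q * nrm r N h + nrm r N v / (1 - q).
  have e1 : nrm r N h = nrm r N (fun n => A h n + v n) by apply: eq_nrm.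
  rewrite {1}e1.
  apply: le_trans (nrm_convex _ _ _ _ q01) _; rewrite lerD2r ler_pdivrMr//.
  by rewrite mulrAC -expr2.
have q1' : 0 < 1 - q by rewrite subr_gt0.
rewrite -lerBlDl -{1}[nrm r N h]mul1r -mulrBl => h1.
by rewrite expr2 invfM mulrA ler_pdivlMr// mulrC.
Qed.

End Operators.

(** * The stable spatial root of the bulk scheme *)

Section StableRoot.
Variable R : realType.
Implicit Types (C s r x y : R) (w k z : R[i]).

Definition admissible C s :=
  (0 < s < 2 /\ 0 < `|C| <= 1) \/ (s = 2 /\ 0 < `|C| < 1).

(* One relaxation reads f1* = ca f1 + cb f2 and f2* = cc f1 + cd f2. *)
Definition ca C s := (2 - s + s * C) / 2.
Definition cb C s := (s + s * C) / 2.
Definition cc C s := (s - s * C) / 2.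
Definition cd C s := (2 - s - s * C) / 2.

Lemma admissible_s C s : admissible C s -> 0 < s <= 2.
Proof. by move=> [[/andP[? ?] _]|[-> _]]; lra. Qed.

Lemma admissible_C C s : admissible C s -> C != 0 /\ -1 <= C <= 1.
Proof.
move=> [[_ /andP[h1 h2]]|[_ /andP[h1 h2]]]; split; rewrite -?normr_gt0//;
  by rewrite -ler_norml// ltW.
Qed.

Lemma admissibleN C s : admissible C s -> admissible (- C) s.
Proof. by rewrite /admissible normrN. Qed.

Lemma admissible_lt C s : admissible C s -> s < 2 \/ -1 < C < 1.
Proof.
by move=> [[/andP[_ h] _]|[_ /andP[_ h]]]; [left|right; rewrite -ltr_norml].
Qed.

(** Reversing the sign of C exchanges the two diagonal coefficients, that is, reflects space;
    [stable_exists] reduces inflow to outflow in this way. *)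
Lemma caN C s : ca (- C) s = cd C s. Proof. by rewrite /ca /cd mulrN. Qed.
Lemma cdN C s : cd (- C) s = ca C s. Proof. by rewrite /ca /cd mulrN opprK. Qed.

Lemma ca_cc C s : ca C s + cc C s = 1. Proof. rewrite /ca /cc; lra. Qed.
Lemma det_relax C s : ca C s * cd C s - cb C s * cc C s = 1 - s.
Proof. by rewrite /ca /cb /cc /cd; field. Qed.

Lemma ca_lt1 C s : admissible C s -> C < 0 -> `|ca C s| < 1.
Proof.
move=> h C0; have /andP[s0 s2] := admissible_s h.
have [_ /andP[C1 C2]] := admissible_C h.
have sC : s * C < 0 by rewrite pmulr_rlt0.
have sC4 : s * C > s - 4.
  have [s2'|/andP[C1' _]] := admissible_lt h.
    have : 0 <= s * (C + 1) by rewrite mulr_ge0; lra.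
    by move=> ?; lra.
  have : 0 < s * (C + 1) by rewrite mulr_gt0//; lra.
  by move=> ?; lra.
by rewrite ltr_norml /ca; lra.
Qed.

Lemma coef_neg C s : admissible C s -> C < 0 ->
  [/\ 0 < cd C s, `|ca C s| <= cd C s & 0 < cc C s].
Proof.
move=> h C0; have /andP[s0 s2] := admissible_s h.
have sC : s * C < 0 by rewrite pmulr_rlt0.
by rewrite /cd /ca /cc ler_norml; split; lra.
Qed.

(** The defect is a multiple of the square of [m2 - C m1], the distance to equilibrium, with factor
    [s (2 - s) / 2]. *)
Lemma energy_real C s x y : 0 <= s <= 2 ->
  (1 - C) * (ca C s * x + cb C s * y) ^+ 2 + (1 + C) * (cc C s * x + cd C s * y) ^+ 2 <=
  (1 - C) * x ^+ 2 + (1 + C) * y ^+ 2.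
Proof.
move=> /andP[s0 s2]; rewrite -subr_ge0.
have -> : (1 - C) * x ^+ 2 + (1 + C) * y ^+ 2 - ((1 - C) * (ca C s * x + cb C s * y) ^+ 2
  + (1 + C) * (cc C s * x + cd C s * y) ^+ 2) =
  s * (2 - s) / 2 * ((1 - C) * x - (1 + C) * y) ^+ 2.
  by rewrite /ca /cb /cc /cd; field.
by rewrite mulr_ge0 ?sqr_ge0// divr_ge0// mulr_ge0// subr_ge0.
Qed.

Lemma energy_complex C s z w : 0 <= s <= 2 ->
  (1 - C) * cn ((ca C s)%:C * z + (cb C s)%:C * w) ^+ 2 +
  (1 + C) * cn ((cc C s)%:C * z + (cd C s)%:C * w) ^+ 2 <=
  (1 - C) * cn z ^+ 2 + (1 + C) * cn w ^+ 2.
Proof.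
move=> hs; have := lerD (energy_real C (Re z) (Re w) hs) (energy_real C (Im z) (Im w) hs).
case: z w => [zr zi] [wr wi]; rewrite !cn_sqr /= !mul0r !subr0 !addr0 => h.
by apply: le_trans (le_trans _ h) _; rewrite !mulrDr; lra.
Qed.

(* Throughout w = 1/z: the bulk dispersion relation is cd k^2 - (z + (1 - s)/z) k + ca = 0. *)
Definition cZ s w : R[i] := w^-1 + (1 - s)%:C * w.

Definition kchar C s w k := (cd C s)%:C * k ^+ 2 - cZ s w * k + (ca C s)%:C = 0.

Lemma det_relaxC C s : (ca C s)%:C * (cd C s)%:C - (cb C s)%:C * (cc C s)%:C =
  (1 - s)%:C :> R[i].
Proof. by rewrite -!rmorphM -rmorphB det_relax. Qed.

(** With z = 1/w and phi = (z - cd k, cc k), this is the first row of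
    [M phi = diag (z k, z / k) phi]; the second row is an identity. *)
Lemma kernel_row1 C s w k : w != 0 -> kchar C s w k ->
  (ca C s)%:C * (w^-1 - (cd C s)%:C * k) + (cb C s)%:C * ((cc C s)%:C * k) =
  w^-1 * k * (w^-1 - (cd C s)%:C * k).
Proof.
move=> w0 hk; have e : w^-1 * w = 1 by rewrite mulVf.
apply/eqP; rewrite -subr_eq0; apply/eqP.
transitivity (w^-1 * ((cd C s)%:C * k ^+ 2 - cZ s w * k + (ca C s)%:C) +
  (w^-1 * w - 1) * ((1 - s)%:C * k) +
  ((1 - s)%:C - ((ca C s)%:C * (cd C s)%:C - (cb C s)%:C * (cc C s)%:C)) * k : R[i]).
  by rewrite /cZ; ring.
by rewrite hk e det_relaxC !subrr !mul0r mulr0 !addr0.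
Qed.

(** Relaxation multiplies the components of the eigenvector by [z k] and [z / k]. For
    [|w| < |k| < 1/|w|] both factors exceed 1 in modulus, against the dissipation of energy. *)
Lemma root_dichotomy C s w k : admissible C s -> C < 0 -> 0 < cn w < 1 ->
  kchar C s w k -> cn k <= cn w \/ (cn w)^-1 <= cn k.
Proof.
move=> h C0 /andP[w0 w1] hk.
have [_ _ c0] := coef_neg h C0; have [_ /andP[C1 _]] := admissible_C h.
have hs : 0 <= s <= 2 by have /andP[? ?] := admissible_s h; lra.
case: (lerP (cn k) (cn w)) => [|kw]; first by left.
right; rewrite leNgt; apply/negP => kz.
have wn0 : w != 0 by rewrite -cn_gt0.
pose z := w^-1; pose f1 : R[i] := z - (cd C s)%:C * k; pose f2 : R[i] := (cc C s)%:C * k.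
have := energy_complex C f1 f2 hs.
rewrite /f1 /f2 (kernel_row1 wn0 hk) -/z -/f1.
have -> : (cc C s)%:C * f1 + (cd C s)%:C * ((cc C s)%:C * k) = (cc C s)%:C * z.
  by rewrite /f1; ring.
have z1 : cn z = (cn w)^-1 by rewrite /z cnV.
rewrite !cnM !cn_real (gtr0_norm c0) z1.
set t := (cn w)^-1 in kz z1 *; set y := cn k in kw kz *.
have y0 : 0 < y by exact: lt_trans kw.
have ty : 1 < t * y by rewrite /t mulrC ltr_pdivlMr// mul1r.
have ty2 : 1 < t ^+ 2 * y ^+ 2 by rewrite -exprMn exprn_egt1.
have t0 : 0 < t by rewrite invr_gt0.
have yt2 : y ^+ 2 < t ^+ 2 by rewrite ltr_pXn2r ?nnegrE ?ltW.
have c2 : 0 < cc C s ^+ 2 by rewrite exprn_gt0.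
set F := cn f1 ^+ 2; have F0 : 0 <= F by rewrite sqr_ge0.
case: (ltrgtP C (-1)) => [|C1'|C1']; first by rewrite ltNge C1.
- have p1 : 0 < (1 + C) * (cc C s ^+ 2 * (t ^+ 2 - y ^+ 2)).
    by apply: mulr_gt0; [lra|apply: mulr_gt0 => //; rewrite subr_gt0].
  have p2 : 0 <= (1 - C) * ((t ^+ 2 * y ^+ 2 - 1) * F).
    by apply: mulr_ge0; [lra|apply: mulr_ge0 => //; rewrite subr_ge0 ltW].
  move=> hh; have : (1 + C) * (cc C s ^+ 2 * (t ^+ 2 - y ^+ 2)) +
    (1 - C) * ((t ^+ 2 * y ^+ 2 - 1) * F) <= 0 by rewrite /F in hh *; lra.
  by lra.
(* At C = -1 the second component has weight 0: the inequality only gives [f1 = 0], and then cd = 1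
   forces [z = k]. *)
- rewrite C1' => hh.
  have p2 : (t ^+ 2 * y ^+ 2 - 1) * F <= 0 by rewrite /F in hh *; lra.
  have F1 : F <= 0 by rewrite -(@ler_pM2l _ (t ^+ 2 * y ^+ 2 - 1)) ?subr_gt0// mulr0.
  have : F == 0 by rewrite eq_le F1 F0.
  rewrite /F expf_eq0/= cn_eq0 subr_eq0 => /eqP zk.
  have d1 : cd C s = 1 by rewrite /cd C1'; field.
  by move: z1 kz; rewrite zk d1 mul1r -/y => ->; rewrite ltxx.
Qed.

(* Necessary half of the Schur-Cohn criterion. *)
Lemma schur_bound (k1 k2 : R[i]) : cn k1 < 1 -> cn k2 < 1 ->
  cn (k1 + k2 - k1 * k2 * cj (k1 + k2)) < 1 - cn (k1 * k2) ^+ 2.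
Proof.
move=> h1 h2.
have -> : k1 + k2 - k1 * k2 * cj (k1 + k2) =
  k1 * (1 - (cn k2 ^+ 2)%:C) + k2 * (1 - (cn k1 ^+ 2)%:C).
  by rewrite !sqr_cn cjD; ring.
have p1 : 0 <= cn k1 by exact: cn_ge0.
have p2 : 0 <= cn k2 by exact: cn_ge0.
apply: le_lt_trans (cnD _ _) _; rewrite !cnM -!(rmorph1 (real_complex R)) -!rmorphB !cn_real.
have n1 : `|1 - cn k1 ^+ 2| = 1 - cn k1 ^+ 2 by rewrite ger0_norm// subr_ge0 expr_le1// ltW.
have n2 : `|1 - cn k2 ^+ 2| = 1 - cn k2 ^+ 2 by rewrite ger0_norm// subr_ge0 expr_le1// ltW.
rewrite n1 n2.
set x := cn k1 in h1 p1 *; set y := cn k2 in h2 p2 *.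
rewrite -subr_gt0.
have -> : 1 - (x * y) ^+ 2 - (x * (1 - y ^+ 2) + y * (1 - x ^+ 2)) =
  (1 - x * y) * ((1 - x) * (1 - y)) by ring.
have xy : x * y < 1 by rewrite mulr_ilt1.
by apply: mulr_gt0; [|apply: mulr_gt0]; rewrite subr_gt0.
Qed.

Lemma cZ_cj C s w (A B : R) : A%:C * cZ s w - B%:C * cj (cZ s w) =
  Complex ((A - B) * Re (cZ s w)) ((A + B) * Im (cZ s w)).
Proof.
case: (cZ s w) => X Y; apply/eqP; rewrite eq_complex /= !mul0r; apply/andP.
by split; apply/eqP; ring.
Qed.

(** As [cd - ca = - s C] and [cd + ca = 2 - s], this says [|cd Z - ca conj Z| >= |cd^2 - ca^2|] with
    Z = [cZ s w], which contradicts what [schur_bound] gives for two roots inside the disc. *)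
Lemma cZ_lower C s w : admissible C s -> 0 < cn w < 1 ->
  (s * C) ^+ 2 * (2 - s) ^+ 2 <=
  (s * C) ^+ 2 * Re (cZ s w) ^+ 2 + (2 - s) ^+ 2 * Im (cZ s w) ^+ 2.
Proof.
move=> h /andP[w0 w1].
have /andP[s0 s2] := admissible_s h; have [_ /andP[C1 C2]] := admissible_C h.
have : 0 < cn w ^+ 2 < 1 by rewrite exprn_gt0//= expr_lt1// ltW.
rewrite cn_sqr; case: w {w0 w1} => u v /=; set rho := u ^+ 2 + v ^+ 2 => /andP[r0 r1].
rewrite !mul0r addr0 subr0.
pose q := rho^-1; have q1 : 1 < q by rewrite invf_gt1.
have qr : q * rho = 1 by rewrite mulVf// gt_eqF.
have -> : u / rho + (1 - s) * u = u * (q + (1 - s)) by rewrite -/q; ring.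
have -> : - (v / rho) + (1 - s) * v = v * ((1 - s) - q) by rewrite -/q; ring.
have s1 : (1 - s) ^+ 2 <= 1.
  by have : 0 <= s * (2 - s); [apply: mulr_ge0; lra|lra].
(* Both bounds reduce to [(q - 1) (q - (1 - s)^2) >= 0], where [q = |w|^-2 > 1]. *)
have h1 : q * (2 - s) ^+ 2 <= (q + (1 - s)) ^+ 2.
  rewrite -subr_ge0; have -> : (q + (1 - s)) ^+ 2 - q * (2 - s) ^+ 2 =
    (q - 1) * (q - (1 - s) ^+ 2) by ring.
  by rewrite mulr_ge0//; lra.
have h2 : q * s ^+ 2 <= ((1 - s) - q) ^+ 2.
  rewrite -subr_ge0; have -> : ((1 - s) - q) ^+ 2 - q * s ^+ 2 =
    (q - 1) * (q - (1 - s) ^+ 2) by ring.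
  by rewrite mulr_ge0//; lra.
have C21 : C ^+ 2 <= 1.
  by have : 0 <= (1 - C) * (1 + C); [apply: mulr_ge0; lra|lra].
have e : (s * C) ^+ 2 * (2 - s) ^+ 2 =
  (s * C) ^+ 2 * (u ^+ 2 * (q * (2 - s) ^+ 2)) + (2 - s) ^+ 2 * (v ^+ 2 * (q * s ^+ 2) * C ^+ 2).
  transitivity ((s * C) ^+ 2 * (2 - s) ^+ 2 * (q * rho)); first by rewrite qr mulr1.
  by rewrite /rho; ring.
rewrite e (exprMn _ u) (exprMn _ v); apply: lerD.
  by rewrite ler_wpM2l ?sqr_ge0// ler_wpM2l ?sqr_ge0.
rewrite ler_wpM2l ?sqr_ge0//; apply: (@le_trans _ _ (v ^+ 2 * (q * s ^+ 2))).
  rewrite ler_piMr//; apply: mulr_ge0; rewrite ?sqr_ge0//; apply: mulr_ge0; rewrite ?sqr_ge0//; lra.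
by rewrite ler_wpM2l ?sqr_ge0.
Qed.

(** Each root obeys [root_dichotomy]; Schur-Cohn excludes two inner roots, and the product
    [ca / cd], of modulus at most 1, excludes two outer ones. *)
Lemma two_roots C s w : admissible C s -> C < 0 -> 0 < cn w < 1 ->
  exists k1 k2, [/\ cZ s w = (cd C s)%:C * (k1 + k2), (ca C s)%:C = (cd C s)%:C * (k1 * k2),
    cn k1 <= cn w & (cn w)^-1 <= cn k2].
Proof.
move=> h C0 /[dup] w01 /andP[w0 w1].
have [d0 ad c0] := coef_neg h C0.
have dn0 : (cd C s)%:C != 0 :> R[i] by rewrite -cn_gt0 cn_real normr_gt0 gt_eqF.
pose D := sqrtc (cZ s w ^+ 2 - 4%:R * (ca C s)%:C * (cd C s)%:C).
have hD : D ^+ 2 = cZ s w ^+ 2 - 4%:R * (ca C s)%:C * (cd C s)%:C by rewrite sqr_sqrtc.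
pose k1 := (cZ s w - D) / (2%:R * (cd C s)%:C); pose k2 := (cZ s w + D) / (2%:R * (cd C s)%:C).
have n2 : (2%:R : R[i]) != 0 by rewrite pnatr_eq0.
have sum12 : cZ s w = (cd C s)%:C * (k1 + k2) by rewrite /k1 /k2; field; rewrite dn0.
have prod12 : (ca C s)%:C = (cd C s)%:C * (k1 * k2).
  have -> : (cd C s)%:C * (k1 * k2) = (cZ s w ^+ 2 - D ^+ 2) / (4%:R * (cd C s)%:C).
    by rewrite /k1 /k2; field; rewrite dn0.
  by rewrite hD; field; rewrite dn0.
have r1 : kchar C s w k1 by rewrite /kchar sum12 prod12; ring.
have r2 : kchar C s w k2 by rewrite /kchar sum12 prod12; ring.
have bothin : ~ (cn k1 <= cn w /\ cn k2 <= cn w).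
  move=> [i1 i2].
  have := schur_bound (le_lt_trans i1 w1) (le_lt_trans i2 w1).
  have cP : cn (k1 * k2) = `|ca C s| / cd C s.
    have := congr1 (@cn R) prod12; rewrite [RHS]cnM !cn_real (gtr0_norm d0) => ->.
    by rewrite [RHS]mulrC mulKf// gt_eqF.
  have cPr : k1 * k2 = (ca C s / cd C s)%:C.
    by rewrite fmorph_div/= prod12 [RHS]mulrC mulKf.
  rewrite cP; set S := _ - _ => hS.
  have hS2 : cd C s ^+ 2 * cn S = cn ((cd C s)%:C * cZ s w - (ca C s)%:C * cj (cZ s w)).
    have -> : (cd C s)%:C * cZ s w - (ca C s)%:C * cj (cZ s w) = (cd C s)%:C ^+ 2 * S.
      rewrite {1}sum12 prod12 sum12 cjM cj_real /S; ring.
    by rewrite cnM cnX cn_real gtr0_norm.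
  have : cd C s ^+ 2 * cn S < cd C s ^+ 2 - ca C s ^+ 2.
    have -> : cd C s ^+ 2 - ca C s ^+ 2 = cd C s ^+ 2 * (1 - (`|ca C s| / cd C s) ^+ 2).
      rewrite -(real_normK (num_real (ca C s))); field; by rewrite gt_eqF.
    by rewrite ltr_pM2l// exprn_gt0.
  rewrite hS2 (cZ_cj C); set T := Complex _ _ => hT.
  have lower : (cd C s ^+ 2 - ca C s ^+ 2) ^+ 2 <= cn T ^+ 2.
    rewrite cn_sqr /T /= !exprMn.
    have := cZ_lower h w01.
    have -> : cd C s - ca C s = - (s * C) by rewrite /cd /ca; field.
    have -> : cd C s + ca C s = 2 - s by rewrite /cd /ca; field.
    rewrite sqrrN => hh; apply: le_trans hh; rewrite le_eqVlt; apply/orP; left; apply/eqP.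
    by rewrite /cd /ca; field.
  have p0 : 0 <= cd C s ^+ 2 - ca C s ^+ 2.
    by rewrite subr_ge0 -(real_normK (num_real (ca C s))) lerXn2r ?nnegrE// ltW.
  by move: lower; rewrite ler_pXn2r ?nnegrE ?cn_ge0// leNgt hT.
have bothout : ~ ((cn w)^-1 <= cn k1 /\ (cn w)^-1 <= cn k2).
  move=> [i1 i2]; have z1 : 1 < (cn w)^-1 by rewrite invf_gt1.
  have : 1 < cn k1 * cn k2.
    by rewrite mulr_egt1//; exact: lt_le_trans z1 _.
  have := congr1 (@cn R) prod12; rewrite [RHS]cnM cnM !cn_real (gtr0_norm d0) => e hp.
  by move: ad; rewrite e ger_pMr// leNgt hp.
have [i1|o1] := root_dichotomy h C0 w01 r1; have [i2|o2] := root_dichotomy h C0 w01 r2.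
- by case: bothin.
- by exists k1, k2.
- by exists k2, k1; split=> //; [rewrite addrC|rewrite [k2 * _]mulrC].
- by case: bothout.
Qed.

(** [spec_gap] places the other root outside the closed disc, in a form that keeps its meaning when
    cd = 0, which can happen for C > 0. [spec_out] combines the product [ca / cd] of the roots with
    the other root being at least [1/|w|] in modulus. *)
Record stable_spec C s w k : Prop := StableSpec {
  spec_char : kchar C s w k;
  spec_le : cn k <= cn w;
  spec_gap : `|cd C s| < cn (cZ s w - (cd C s)%:C * k);
  spec_out : C < 0 -> `|cd C s| * cn k <= `|ca C s| * cn w }.

Lemma stable_exists C s w : admissible C s -> 0 < cn w < 1 -> exists k, stable_spec C s w k.
Proof.
move=> h /[dup] w01 /andP[w0 w1]; have [Cn0 _] := admissible_C h.
have z1 : 1 < (cn w)^-1 by rewrite invf_gt1.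
case: (ltrgtP C 0) => [C0|C0|C0]; last by rewrite C0 eqxx in Cn0.
  have [k1 [k2 [e1 e2 h1 h2]]] := two_roots h C0 w01; exists k1.
  have [d0 ad _] := coef_neg h C0.
  have k2p : 0 < cn k2 by apply: lt_le_trans h2; rewrite invr_gt0.
  split=> //; first by rewrite /kchar e1 e2; ring.
    have -> : cZ s w - (cd C s)%:C * k1 = (cd C s)%:C * k2 by rewrite e1; ring.
    by rewrite cnM cn_real ltr_pMr ?normr_gt0 ?gt_eqF// (lt_le_trans z1).
  move=> _; have := congr1 (@cn R) e2; rewrite !cnM !cn_real => ->.
  rewrite mulrA -(mulrA (_ * cn k1)) ler_peMr ?mulr_ge0 ?cn_ge0//.
  by rewrite mulrC -ler_pdivrMl// mulr1.
(* For C > 0 the mirrored problem has roots 1/k: the stable root is the inverse of its outer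
   root. *)
have hN := admissibleN h; have CN : - C < 0 by rewrite oppr_lt0.
have [k1 [k2 [e1 e2 h1 h2]]] := two_roots hN CN w01.
rewrite cdN in e1 e2; rewrite caN in e2.
have k2p : 0 < cn k2 by apply: lt_le_trans h2; rewrite invr_gt0.
have k20 : k2 != 0 by rewrite -cn_gt0.
have [d0 _ _] := coef_neg hN CN; rewrite cdN in d0.
exists k2^-1; split.
- by rewrite /kchar e1 e2; field.
- by rewrite cnV -(invrK (cn w)) lef_pV2 ?posrE ?invr_gt0.
- have -> : cZ s w - (cd C s)%:C * k2^-1 = (ca C s)%:C * k2 by rewrite e1 e2; field.
  have := congr1 (@cn R) e2; rewrite !cnM !cn_real => ->.
  rewrite ltr_pM2l ?normr_gt0 ?gt_eqF// -[ltRHS]mul1r ltr_pM2r//.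
  exact: le_lt_trans h1 w1.
- by move=> C0'; have := lt_trans C0 C0'; rewrite ltxx.
Qed.

(* Root of [kchar] inside the unit disc; 0 outside 0 < |w| < 1. *)
Definition kap C s w : R[i] := xget 0 [set k | stable_spec C s w k].

Lemma kapP C s w : admissible C s -> 0 < cn w < 1 -> stable_spec C s w (kap C s w).
Proof.
move=> h w01; have [k hk] := stable_exists h w01.
by rewrite /kap; case: xgetP => [y _ hy //|/(_ k)/(_ hk)].
Qed.

(** Subtracting the two equations leaves the factor [cd k - (cZ - cd kap)], nonzero by [spec_gap]
    and [|k| < 1]. *)
Lemma kap_unique C s w k : admissible C s -> 0 < cn w < 1 -> kchar C s w k -> cn k < 1 ->
  k = kap C s w.
Proof.
move=> h w01 hk k1; have [h1 h2 h3 _] := kapP h w01.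
set k' := kap C s w in h1 h2 h3 *.
apply/eqP; rewrite -subr_eq0; apply/negP => /negP nk.
have : (k - k') * ((cd C s)%:C * k - (cZ s w - (cd C s)%:C * k')) = 0.
  transitivity (((cd C s)%:C * k ^+ 2 - cZ s w * k + (ca C s)%:C) -
    ((cd C s)%:C * k' ^+ 2 - cZ s w * k' + (ca C s)%:C)); first by ring.
  by rewrite hk h1 subrr.
move/eqP; rewrite mulf_eq0 (negbTE nk)/= subr_eq0 => /eqP e.
move: h3; rewrite -e cnM cn_real; apply/negP; rewrite -leNgt ler_piMr//.
exact: ltW.
Qed.

(** Multiplying the bulk equation by the conjugate of k and taking real parts gives [C Re k (1 -
    |k|^2) = Re w (|w|^-2 - 1) |k|^2]. At w = 1 and w = -1 the two roots are 1 and -1, both of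
    modulus 1; this sign tells which of them is the limit of [kap]. *)
Lemma kap_sign C s w : admissible C s -> s = 2 -> 0 < cn w < 1 ->
  0 <= C * Re (kap C s w) * Re w.
Proof.
move=> h s2 /[dup] w01 /andP[w0 w1]; have [h1 h2 _ _] := kapP h w01.
set k := kap C s w in h1 h2 *.
have wn0 : w != 0 by rewrite -cn_gt0.
have a2 : ca C s = C by rewrite /ca s2; field.
have d2 : cd C s = - C by rewrite /cd s2; field.
have k1 : cn k < 1 by exact: le_lt_trans w1.
have e : C%:C * (cj k - k * (cn k ^+ 2)%:C) = (w^-1 - w) * (cn k ^+ 2)%:C.
  have : cj k * ((cd C s)%:C * k ^+ 2 - cZ s w * k + (ca C s)%:C) = 0 by rewrite h1 mulr0.
  rewrite a2 d2 /cZ s2 rmorphN rmorphB rmorph_nat rmorph1 sqr_cn => e.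
  by apply/eqP; rewrite -subr_eq0 -e; apply/eqP; ring.
have k21 : cn k ^+ 2 < 1 by rewrite expr_lt1 ?cn_ge0.
have w21 : cn w ^+ 2 < 1 by rewrite expr_lt1 ?cn_ge0.
have w20 : 0 < cn w ^+ 2 by rewrite exprn_gt0.
have k20 : 0 <= cn k ^+ 2 by rewrite sqr_ge0.
have := congr1 (@complex.Re R) e; rewrite cn_sqr in w20 w21.
move: w20 w21; set kk := cn k ^+ 2 in k21 k20 *.
case: (k) => x y; case: (w) => u v /=; set rho := u ^+ 2 + v ^+ 2 => r0 r1.
rewrite !mulr0 !mul0r !subr0 => er.
have q1 : 1 < rho^-1 by rewrite invf_gt1.
have : C * x * u * (1 - kk) = u ^+ 2 * (rho^-1 - 1) * kk.
  transitivity (u * (C * (x - x * kk))); first by ring.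
  by rewrite er; ring.
have : 0 <= u ^+ 2 * (rho^-1 - 1) * kk.
  by apply: mulr_ge0 => //; apply: mulr_ge0; rewrite ?sqr_ge0// subr_ge0 ltW.
by move=> hh e'; rewrite -(@pmulr_lge0 _ (1 - kk)) ?subr_gt0// e'.
Qed.

(* Uniform bound keeping |cd kap w| away from 1, i.e. the eigenvector (1 - cd kap w, cc w) does not
   degenerate. *)
Definition gap C s : R := Num.max (2^-1) (if C < 0 then `|ca C s| else `|cd C s|).

(** The floor [2^-1] in [gap] keeps it positive when the coefficient vanishes, as
    [contraction_bound] requires. *)
Lemma gap01 C s : admissible C s -> 0 < gap C s < 1.
Proof.
move=> h; rewrite /gap lt_max gt_max; apply/andP; split; first by apply/orP; left; lra.
apply/andP; split; first by lra.
case: ifPn => [C0|]; first exact: ca_lt1.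
rewrite -leNgt le_eqVlt => /orP[/eqP C0|C0].
  by have [] := admissible_C h; rewrite -C0 eqxx.
by rewrite -caN; apply: ca_lt1 (admissibleN h) _; rewrite oppr_lt0.
Qed.

Lemma kap_gap C s w : admissible C s -> 0 < cn w < 1 ->
  cn ((cd C s)%:C * kap C s w * w) <= gap C s.
Proof.
move=> h /[dup] w01 /andP[w0 w1]; have [_ h2 _ h4] := kapP h w01.
rewrite !cnM cn_real /gap le_max; apply/orP; right.
case: ifPn => [/h4 h5|_].
  rewrite (le_trans (ler_wpM2r (cn_ge0 w) h5))// -mulrA ler_piMr//.
  by rewrite mulr_ile1 ?cn_ge0// ltW.
by rewrite -mulrA ler_piMr// mulr_ile1 ?cn_ge0 ?(le_trans h2) ?ltW.
Qed.

End StableRoot.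

(** * The kinetic Dirichlet scheme and its transforms *)

Section Dirichlet.
Variable R : realType.
Implicit Types (C s r x y : R) (w l : R[i]) (h g : nat -> R) (b : bcond R).

Lemma collide1 C s (st : state R) j :
  (collide C s st).1 j = ca C s * st.1 j + cb C s * st.2 j.
Proof. by rewrite /collide /ca /cb /=; field. Qed.

Lemma collide2 C s (st : state R) j :
  (collide C s st).2 j = cc C s * st.1 j + cd C s * st.2 j.
Proof. by rewrite /collide /cc /cd /=; field. Qed.

Lemma sol1S C s b g n j : (sol C s b g n.+1).1 j.+1 =
  ca C s * (sol C s b g n).1 j + cb C s * (sol C s b g n).2 j.
Proof. by rewrite -collide1. Qed.

Lemma sol2S C s b g n j : (sol C s b g n.+1).2 j =
  cc C s * (sol C s b g n).1 j.+1 + cd C s * (sol C s b g n).2 j.+1.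
Proof. by rewrite -collide2. Qed.

(** The cell j comes before h, so that [F1 C s j] is an operator on ghost sequences in the sense of
    [is_op]. *)
Definition F1 C s j h n := (sol C s (bc_KD R) h n).1 j.
Definition F2 C s j h n := (sol C s (bc_KD R) h n).2 j.

Lemma F1_0 C s h n : F1 C s 0 h n = delay h n.
Proof. by case: n => [|n] //=; rewrite /F1 /= /ghost big_ord0 add0r. Qed.

Lemma F1S C s h j n : F1 C s j.+1 h n = delay (fun n => ca C s * F1 C s j h n + cb C s * F2 C s j h n) n.
Proof. by case: n => [//|n]; rewrite /F1 sol1S. Qed.

Lemma F2S C s h j n :
  F2 C s j h n = delay (fun n => cc C s * F1 C s j.+1 h n + cd C s * F2 C s j.+1 h n) n.
Proof. by case: n => [//|n]; rewrite {1}/F2 sol2S. Qed.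

(** The bound [n <= N], one better than causality, is what allows [op_shift] to advance the output
    by one step. *)
Lemma F_causal C s h h' N : (forall n, (n < N)%N -> h n = h' n) ->
  forall n, (n <= N)%N -> forall j, F1 C s j h n = F1 C s j h' n /\ F2 C s j h n = F2 C s j h' n.
Proof.
move=> hh; elim=> [//|n ih] nN j; have {}ih := ih (ltnW nN); split; last first.
  by rewrite !F2S /=; have [-> ->] := ih j.+1.
case: j => [|j]; first by rewrite !F1_0 /= hh.
by rewrite !F1S /=; have [-> ->] := ih j.
Qed.

(** Transport only moves the relaxed energies: the first J cells receive at most those of the first
    J + 1 cells, since f2 arrives from the right, and the ghost value brings in
    [(1 - C) h n ^+ 2]. *)
Lemma kd_energy C s h n J : 0 <= s <= 2 -> -1 <= C <= 1 ->
  \sum_(j < J) ((1 - C) * F1 C s j h n ^+ 2 + (1 + C) * F2 C s j h n ^+ 2) <=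
  (1 - C) * \sum_(k < n) h k ^+ 2.
Proof.
move=> hs /andP[C1 C2]; elim: n J => [|n ih] J.
  rewrite big_ord0 mulr0 big1// => j _.
  by rewrite /F1 /F2 /= expr0n !mulr0 addr0.
have hn : 0 <= (1 - C) * h n ^+ 2 by rewrite mulr_ge0 ?sqr_ge0// subr_ge0.
rewrite big_ord_recr/= mulrDr.
pose e j := (1 - C) * (ca C s * F1 C s j h n + cb C s * F2 C s j h n) ^+ 2.
pose e' j := (1 + C) * (cc C s * F1 C s j h n + cd C s * F2 C s j h n) ^+ 2.
have e0 j : 0 <= e j by rewrite mulr_ge0 ?sqr_ge0// subr_ge0.
have e'0 j : 0 <= e' j by rewrite mulr_ge0 ?sqr_ge0//; lra.
have hA : \sum_(j < J) (1 - C) * F1 C s j h n.+1 ^+ 2 <= \sum_(j < J.+1) e j + (1 - C) * h n ^+ 2.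
  case: J => [|J]; first by rewrite big_ord0 addr_ge0// sumr_ge0.
  rewrite big_ord_recl F1_0/= addrC lerD2r 2!big_ord_recr/= -addrA.
  rewrite ler_wpDr ?addr_ge0//; apply: ler_sum => j _; by rewrite F1S.
have hB : \sum_(j < J) (1 + C) * F2 C s j h n.+1 ^+ 2 <= \sum_(j < J.+1) e' j.
  by rewrite big_ord_recl ler_wpDl//; apply: ler_sum => j _; rewrite F2S.
rewrite big_split/= (le_trans (lerD hA hB))// addrAC lerD2r -big_split/=.
apply: le_trans (ih J.+1); apply: ler_sum => j _; exact: energy_real.
Qed.

(** Uniformity in j makes the transforms bounded in j, which rules out the spatially growing
    mode. *)
Definition utame (f : nat -> nat -> R) :=
  forall y, 1 < y -> exists B, forall j n, `|f j n| <= B * y ^+ n.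

Lemma utame_tame f j : utame f -> tame (f j).
Proof. by move=> hf y /hf[B hB]; exists B => n. Qed.

Lemma norm_sqr_bound x K : 0 <= K -> x ^+ 2 <= K -> `|x| <= 1 + K.
Proof.
move=> K0 h; rewrite -ler_sqr ?nnegrE ?addr_ge0// real_normK ?num_real//.
apply: le_trans h _; rewrite sqrrD expr1n mul1r; have := sqr_ge0 K; lra.
Qed.

(** Strict bounds on C make both energy weights positive, so the energy controls each component. *)
Lemma kd_utame_int C s h : 0 <= s <= 2 -> -1 < C < 1 -> tame h ->
  utame (fun j => F1 C s j h) /\ utame (fun j => F2 C s j h).
Proof.
move=> hs /andP[C1 C2] th.
have hC : -1 <= C <= 1 by rewrite !ltW.
have key y : 1 < y -> exists2 K, 0 <= K & forall j n,
    (1 - C) * F1 C s j h n ^+ 2 + (1 + C) * F2 C s j h n ^+ 2 <= K * y ^+ n ^+ 2.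
  move=> y1; have [B hB] := th y y1.
  have y0 : 0 < y by exact: lt_trans y1.
  have y21 : 0 < y ^+ 2 - 1 by rewrite subr_gt0 exprn_egt1.
  exists ((1 - C) * (B ^+ 2 / (y ^+ 2 - 1))).
    by rewrite mulr_ge0 ?divr_ge0 ?sqr_ge0 ?ltW// subr_gt0.
  move=> j n; apply: le_trans (le_trans (kd_energy h n j.+1 hs hC) _).
    rewrite big_ord_recr/= lerDr sumr_ge0// => i _.
    by rewrite addr_ge0// mulr_ge0 ?sqr_ge0//; lra.
  rewrite -mulrA; apply: ler_wpM2l; first by lra.
  apply: (@le_trans _ _ (\sum_(k < n) B ^+ 2 * (y ^+ 2) ^+ k)).
    apply: ler_sum => k _; rewrite -exprM mulnC exprM -exprMn -(real_normK (num_real (h k))).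
    by rewrite lerXn2r ?nnegrE ?(le_trans _ (hB k)).
  rewrite -mulr_sumr [leRHS]mulrAC ler_pdivlMr// -mulrA ler_wpM2l ?sqr_ge0//.
  by rewrite mulrC -subrX1 -exprM mulnC exprM gerBl.
split=> y y1; have [K K0 hK] := key y y1.
  exists (1 + K / (1 - C)) => j n.
  have yn : 0 < y ^+ n by rewrite exprn_gt0// (lt_trans _ y1).
  rewrite -ler_pdivrMr// -[y ^+ n in leLHS](gtr0_norm yn) -normf_div.
  apply: norm_sqr_bound; first by apply: divr_ge0 => //; lra.
  have yn2 : 0 < y ^+ n ^+ 2 by rewrite exprn_gt0.
  rewrite expr_div_n ler_pdivrMr// [leRHS]mulrAC ler_pdivlMr ?subr_gt0//.
  apply: le_trans (hK j n); rewrite mulrC lerDl mulr_ge0 ?sqr_ge0//; lra.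
exists (1 + K / (1 + C)) => j n.
have yn : 0 < y ^+ n by rewrite exprn_gt0// (lt_trans _ y1).
have C10 : 0 < 1 + C by lra.
rewrite -ler_pdivrMr// -[y ^+ n in leLHS](gtr0_norm yn) -normf_div.
apply: norm_sqr_bound; first by apply: divr_ge0 => //; lra.
have yn2 : 0 < y ^+ n ^+ 2 by rewrite exprn_gt0.
rewrite expr_div_n ler_pdivrMr// [leRHS]mulrAC ler_pdivlMr//.
apply: le_trans (hK j n); rewrite mulrC lerDr mulr_ge0 ?sqr_ge0//; lra.
Qed.

Lemma tame_bound_ge0 h y B : (forall n, `|h n| <= B * y ^+ n) -> 0 <= B.
Proof. by move=> hB; move: (hB 0%N); rewrite expr0 mulr1; exact: le_trans. Qed.

(** At C = 1 the weight of f1 vanishes, but f2 stays 0 and f1 is merely translated. *)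
Lemma kd_utame_one s h : tame h ->
  utame (fun j => F1 1 s j h) /\ utame (fun j => F2 1 s j h).
Proof.
move=> th.
have c0 : cc 1 s = 0 by rewrite /cc; lra.
have a1 : ca 1 s = 1 by rewrite /ca; lra.
have e2 n : forall j, F2 1 s j h n = 0.
  elim: n => [//|n ih] j; rewrite F2S /= c0 mul0r add0r.
  by rewrite (_ : F2 1 s j.+1 h n = 0) ?mulr0//; exact: ih.
split=> y y1; last by exists 0 => j n; rewrite e2 normr0 mul0r.
have [B hB] := th y y1; exists B => j n; have B0 := tame_bound_ge0 hB.
have y0 : 0 <= y by rewrite ltW// (lt_trans _ y1).
have mono n' : B * y ^+ n' <= B * y ^+ n'.+1.
  by rewrite ler_wpM2l// exprS ler_peMl ?exprn_ge0// ltW.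
elim: n j => [|n ih] j; first by rewrite /F1 /= normr0 expr0 mulr1.
case: j => [|j]; first by rewrite F1_0 /=; exact: le_trans (mono n).
by rewrite F1S /= a1 mul1r e2 mulr0 addr0; exact: le_trans (mono n).
Qed.

(** At C = -1 the weight of f2 vanishes, but f1 evolves alone with factor [1 - s], and f2 only
    accumulates it. *)
Lemma kd_utame_mone s h : 0 <= s <= 2 -> tame h ->
  utame (fun j => F1 (-1) s j h) /\ utame (fun j => F2 (-1) s j h).
Proof.
move=> /andP[s0 s2] th.
have c0 : cc (-1) s = s by rewrite /cc; lra.
have a1 : ca (-1) s = 1 - s by rewrite /ca; lra.
have d1 : cd (-1) s = 1 by rewrite /cd; lra.
have b0 : cb (-1) s = 0 by rewrite /cb; lra.
have u1 y : 1 < y -> exists2 B, 0 <= B & forall j n, `|F1 (-1) s j h n| <= B * y ^+ n.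
  move=> y1; have [B hB] := th y y1; have B0 := tame_bound_ge0 hB.
  have y0 : 0 <= y by rewrite ltW// (lt_trans _ y1).
  exists B => // j n.
  have mono n' : B * y ^+ n' <= B * y ^+ n'.+1.
    by rewrite ler_wpM2l// exprS ler_peMl ?exprn_ge0// ltW.
  elim: n j => [|n ih] j; first by rewrite /F1 /= normr0 expr0 mulr1.
  case: j => [|j]; first by rewrite F1_0 /=; exact: le_trans (mono n).
  rewrite F1S /= a1 b0 mul0r addr0 normrM; apply: le_trans (mono n).
  apply: le_trans (ih j); rewrite ler_piMl//; rewrite ler_norml; lra.
split=> y y1; have [B B0 hB] := u1 y y1; first by exists B.
have y0 : 0 <= y by rewrite ltW// (lt_trans _ y1).
(* K solves [s B + K = K y], which closes the induction on the accumulated sum. *)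
pose K := s * B / (y - 1).
have y10 : 0 < y - 1 by rewrite subr_gt0.
have K0 : 0 <= K by rewrite divr_ge0 ?mulr_ge0// ltW.
exists K => j n; elim: n j => [|n ih] j; first by rewrite /F2 /= normr0 expr0 mulr1.
rewrite F2S /= c0 d1 mul1r (le_trans (ler_normD _ _))//.
apply: (@le_trans _ _ (s * (B * y ^+ n) + K * y ^+ n)).
  by rewrite lerD// normrM (ger0_norm s0) ler_wpM2l.
have -> : s * (B * y ^+ n) + K * y ^+ n = K * y ^+ n.+1; last by [].
by rewrite exprS /K; field; rewrite gt_eqF.
Qed.

Lemma kd_utame C s h : admissible C s -> tame h ->
  utame (fun j => F1 C s j h) /\ utame (fun j => F2 C s j h).
Proof.
move=> hCs th; have [_ /andP[C1 C2]] := admissible_C hCs.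
have /andP[s0 s2] := admissible_s hCs.
have hs : 0 <= s <= 2 by rewrite ltW.
move: C1 C2; rewrite le_eqVlt => /orP[/eqP <- _|C1]; first exact: kd_utame_mone.
rewrite le_eqVlt => /orP[/eqP ->|C2]; first exact: kd_utame_one.
by apply: kd_utame_int; rewrite ?C1.
Qed.

(** Ratio of f2 to f1 on the stable eigenvector. *)
Definition beta C s w := (cc C s)%:C * kap C s w * w / (1 - (cd C s)%:C * kap C s w * w).

Lemma dkw_neq1 C s w : admissible C s -> 0 < cn w < 1 ->
  1 - (cd C s)%:C * kap C s w * w != 0.
Proof.
move=> hCs w01; rewrite subr_eq0; apply/eqP => e.
have := kap_gap hCs w01; rewrite -e cn1.
by have /andP[_] := gap01 hCs; rewrite ltNge => /negP h /h.
Qed.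

Lemma utame_hats (f : nat -> nat -> R) w : utame f -> 0 < cn w < 1 ->
  exists l : nat -> R[i], (forall j, is_hat (f j) w (l j)) /\
    exists B, forall j, cn (l j) <= B.
Proof.
move=> hf /andP[w0 w1].
have /choice[l hl] : forall j, exists l, is_hat (f j) w l.
  by move=> j; apply: tame_is_hat => //; exact: utame_tame.
exists l; split=> //.
have p1 : 0 < 1 + cn w by lra.
pose y := 2 / (1 + cn w).
have y1 : 1 < y by rewrite ltr_pdivlMr// mul1r; lra.
have yw : y * cn w < 1 by rewrite mulrAC ltr_pdivrMr// mul1r; lra.
have y0 : 0 <= y by rewrite ltW// (lt_trans ltr01).
have yw01 : 0 <= y * cn w < 1 by rewrite yw mulr_ge0// ltW.
have [B hB] := hf y y1.
exists (B / (1 - y * cn w)) => j.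
have hb n : cn ((f j n)%:C * w ^+ n) <= B * (y * cn w) ^+ n.
  by rewrite cnM cn_real cnX exprMn mulrA ler_wpM2r ?exprn_ge0 ?cn_ge0.
have := is_hat_err yw01 hb (hl j) 0%N.
by rewrite /psum big_ord0 subr0 expr0 mulr1.
Qed.

(** The transforms solve the bulk recursion in j. Boundedness in j removes the mode that does not
    decay, leaving the stable one, normalized by the ghost value at j = 0. *)
Lemma kd_hats C s h w l : admissible C s -> tame h -> 0 < cn w < 1 -> is_hat h w l ->
  forall j, is_hat (F1 C s j h) w (w * kap C s w ^+ j * l) /\
            is_hat (F2 C s j h) w (w * kap C s w ^+ j * beta C s w * l).
Proof.
move=> hCs th /[dup] w01 /andP[w0 w1] hl.
have wn0 : w != 0 by rewrite -cn_gt0.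
have [ut1 ut2] := kd_utame hCs th.
have [l1 [hl1 [B1 hB1]]] := utame_hats ut1 w01.
have [l2 [hl2 [B2 hB2]]] := utame_hats ut2 w01.
set a := (ca C s)%:C; set b' := (cb C s)%:C; set c := (cc C s)%:C; set d := (cd C s)%:C.
have r0 : l1 0%N = w * l.
  apply: is_hat_unique (hl1 0%N) _; apply: eq_is_hat (is_hat_delay hl) => n.
  by rewrite F1_0.
have r1 j : l1 j.+1 = w * (a * l1 j + b' * l2 j).
  apply: is_hat_unique (hl1 j.+1) _.
  apply: eq_is_hat (is_hat_delay (is_hatD (is_hatZ _ (hl1 j)) (is_hatZ _ (hl2 j)))) => n.
  by rewrite F1S.
have r2 j : l2 j = w * (c * l1 j.+1 + d * l2 j.+1).
  apply: is_hat_unique (hl2 j) _.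
  apply: eq_is_hat (is_hat_delay (is_hatD (is_hatZ _ (hl1 j.+1)) (is_hatZ _ (hl2 j.+1)))) => n.
  by rewrite F2S.
have [hk k1 gp _] := kapP hCs w01; set k := kap C s w in hk k1 gp *.
set E := cZ s w - d * k in gp *.
(* [el] is the component along the other mode. Its recursion is [cd el(j+1) = E el(j)], not divided
   by cd, which may be 0; since [|E| > |cd|], a nonzero [el] would be unbounded in j. *)
pose el j := (1 - d * k * w) * l2 j - c * k * w * l1 j.
have det := det_relaxC C s; rewrite -/a -/b' -/c -/d in det.
have hk' : a = (cZ s w - d * k) * k.
  by apply/eqP; rewrite -subr_eq0 -hk -/a -/d; apply/eqP; ring.
have step j : d * el j.+1 = E * el j.
  have e2 : d * l2 j.+1 = w^-1 * l2 j - c * l1 j.+1.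
    by rewrite [l2 j]r2 mulKf// addrAC subrr add0r.
  transitivity ((1 - d * k * w) * (d * l2 j.+1) - d * c * k * w * l1 j.+1).
    by rewrite /el; ring.
  rewrite e2 r1; apply/eqP; rewrite -subr_eq0; apply/eqP.
  transitivity (((a * d - b' * c) - (1 - s)%:C) * w * l2 j - (a - E * k) * w * (c * l1 j + d * l2 j)
     - (w^-1 * w - 1) * (d * k * l2 j)).
    by rewrite /el /E /cZ; ring.
  by rewrite det -hk' mulVf// !subrr; ring.
have dn : 0 <= `|cd C s| / cn E < 1.
  by rewrite divr_ge0 ?cn_ge0//= ltr_pdivrMr ?mul1r// (le_lt_trans _ gp).
have [B hB] : exists B, forall j, cn (el j) <= B.
  exists (cn (1 - d * k * w) * B2 + cn (c * k * w) * B1) => j.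
  by rewrite (le_trans (cnB _ _))// !cnM lerD// ler_wpM2l// -?cnM ?cn_ge0.
have el0 j : el j = 0.
  have it n : cn (el j) <= (`|cd C s| / cn E) ^+ n * cn (el (j + n)%N).
    elim: n => [|n ih]; first by rewrite expr0 mul1r addn0.
    apply: le_trans ih _; rewrite exprSr -mulrA ler_wpM2l ?exprn_ge0//; first by case/andP: dn.
    have Ep : 0 < cn E by exact: le_lt_trans gp.
    have := congr1 (@cn R) (step (j + n)%N); rewrite !cnM cn_real -addnS => e.
    by rewrite mulrAC ler_pdivlMr// e mulrC.
  apply/eqP; rewrite -cn_eq0 eq_le cn_ge0 andbT; apply/ler_addgt0Pr => e e0; rewrite add0r.
  have dn1 : `| `|cd C s| / cn E| < 1 by rewrite ger0_norm; case/andP: dn.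
  have /cvgrPdist_lt/(_ e e0)[N _ hN] := cvg0_mull B (cvg_expr dn1).
  have := hN N (leqnn N); rewrite /= sub0r normrN => h1.
  apply: le_trans (it N) (le_trans _ (ltW h1)); rewrite mulrC (le_trans _ (ler_norm _))//.
  by rewrite ler_wpM2r// exprn_ge0//; case/andP: dn.
have hl2' j : l2 j = beta C s w * l1 j.
  have := el0 j; rewrite /el => /eqP; rewrite subr_eq0 => /eqP e.
  have := dkw_neq1 hCs w01; rewrite /beta -/k -/c -/d => nz.
  by rewrite mulrAC -e mulrAC divff// mul1r.
have nz := dkw_neq1 hCs w01; rewrite -/k -/d in nz.
have hl1' j : l1 j.+1 = k * l1 j.
  rewrite r1 hl2' /beta -/k -/c -/d.
  apply: (mulfI nz); apply/eqP; rewrite -subr_eq0; apply/eqP.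
  transitivity (l1 j * (w * (a * (1 - d * k * w) + b' * c * k * w) - k * (1 - d * k * w))).
    by field.
  have -> : w * (a * (1 - d * k * w) + b' * c * k * w) - k * (1 - d * k * w) =
    w * (a - E * k) - (w^-1 * w - 1) * k * 0 + w * E * k - w * k * w * (a * d - b' * c) - k + d * k ^+ 2 * w.
    by ring.
  by rewrite det -hk' subrr /E /cZ; field.
have hlj j : l1 j = w * k ^+ j * l.
  elim: j => [|j ih]; first by rewrite r0 expr0 mulr1.
  by rewrite hl1' ih exprS; ring.
move=> j; split; first by rewrite -hlj.
by have -> : w * k ^+ j * beta C s w * l = l2 j by rewrite hl2' hlj; ring.
Qed.

Lemma op_F1 C s j : admissible C s -> is_op (F1 C s j) (fun w => w * kap C s w ^+ j).
Proof.
move=> hCs; split.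
- by move=> h h' N hh n nN; have [-> _] := F_causal C s hh (ltnW nN) j.
- by move=> h th; have [/(utame_tame j)] := kd_utame hCs th.
- by move=> h w l th w01 hl; have [] := kd_hats hCs th w01 hl j.
Qed.

Lemma op_F2 C s j : admissible C s ->
  is_op (F2 C s j) (fun w => w * kap C s w ^+ j * beta C s w).
Proof.
move=> hCs; split.
- by move=> h h' N hh n nN; have [_ ->] := F_causal C s hh (ltnW nN) j.
- by move=> h th; have [_ /(utame_tame j)] := kd_utame hCs th.
- by move=> h w l th w01 hl; have [] := kd_hats hCs th w01 hl j.
Qed.

Lemma op_shift (A : (nat -> R) -> nat -> R) (T : R[i] -> R[i]) :
  (forall h h' N, (forall n, (n < N)%N -> h n = h' n) ->
     forall n, (n <= N)%N -> A h n = A h' n) ->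
  (forall h, A h 0%N = 0) -> is_op A T -> is_op (fun h n => A h n.+1) (fun w => T w / w).
Proof.
move=> hc h0 [a1 a2 a3]; split.
- by move=> h h' N hh n nN; exact: hc hh _ nN.
- by move=> h /a2; exact: tame_shift.
- move=> h w l th /[dup] w01 /andP[w0 _] hl; rewrite mulrAC.
  by apply: is_hat_shift; [rewrite -cn_gt0|exact: h0|exact: a3].
Qed.

(** The f1 component at cell 1 has symbol [w * kap]; advancing it one step divides by w. *)
Definition kapop C s h n := F1 C s 1 h n.+1.

Lemma op_kapop C s : admissible C s -> is_op (kapop C s) (kap C s).
Proof.
move=> hCs; apply: op_eqT (op_shift _ _ (op_F1 1 hCs)).
- by move=> w /andP[w0 _]; rewrite expr1 mulrAC divff ?mul1r// -cn_gt0.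
- by move=> h h' N hh n nN; have [] := F_causal C s hh nN 1.
- by [].
Qed.

End Dirichlet.

(** * Weighted norms and the strong stability estimate *)

Section Estimates.
Variable R : realType.
Implicit Types (C s lam r x y : R) (w : R[i]) (h g : nat -> R) (b : bcond R).

(** With x = alpha dt, the quotient is dt times the prefactor of the estimate, and [1 - r^2] is the
    inverse of the sum of [r^(2 j)]. The inequality comes from [exp (2 x) >= 1 + 2 x]. *)
Lemma decay_rate x : 0 < x ->
  [/\ 0 < expR (- x) < 1 & x / (1 + x) <= 1 - expR (- x) ^+ 2].
Proof.
move=> x0; have r0 : 0 < expR (- x) by exact: expR_gt0.
split; first by rewrite r0 /= -expR0 ltr_expR oppr_lt0.
have p1 : 0 < 1 + 2 * x by lra.
have e : expR (- x) ^+ 2 <= (1 + 2 * x)^-1.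
  rewrite -expRM_natl mulrN expRN lef_pV2 ?posrE ?expR_gt0//.
  exact: expR_ge1Dx.
apply: (@le_trans _ _ (1 - (1 + 2 * x)^-1)); last by rewrite lerD2l lerN2.
rewrite ler_pdivrMr; last by lra.
have -> : (1 - (1 + 2 * x)^-1) * (1 + x) = x + x / (1 + 2 * x).
  by field; rewrite gt_eqF.
by rewrite lerDl divr_ge0 ?ltW.
Qed.

Lemma weight_exp (alpha dt : R) (n : nat) :
  expR (- (2 * alpha * n%:R * dt)) = (expR (- (alpha * dt)) ^+ n) ^+ 2.
Proof. by rewrite -!expRM_natl; congr expR; ring. Qed.

(** Bounding each cell separately with decay [r^(2 j)] suffices: summing over j costs
    [1 / (1 - r^2)], which [decay_rate] compensates. *)
Lemma estimate_intro lam C s b (q : (nat -> R) -> nat -> nat -> R) : 0 < lam ->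
  (forall g n j, 0 <= q g n j) ->
  (exists B, forall r g N j, 0 < r < 1 ->
     \sum_(n < N) (r ^+ n) ^+ 2 * q g n j <= B * (r ^+ j) ^+ 2 * nrm r N g) ->
  estimate lam C s b q.
Proof.
move=> lam0 q0 [B0 hB0].
have [B [B00 hB]] : exists B, 0 < B /\ (forall r g N j, 0 < r < 1 ->
     \sum_(n < N) (r ^+ n) ^+ 2 * q g n j <= B * (r ^+ j) ^+ 2 * nrm r N g).
  exists (`|B0| + 1); split; first by rewrite ltr_wpDl.
  move=> r g N j r01; apply: le_trans (hB0 _ _ _ _ r01) _.
  rewrite ler_wpM2r ?nrm_ge0// ler_wpM2r ?sqr_ge0// (le_trans (ler_norm _))//.
  by rewrite lerDl.
(* The factor lam is the ratio dx / dt. *)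
exists (lam * B); split; first by rewrite mulr_gt0.
move=> alpha a0 g dx dx0 /=; set dt := (dx / lam)%R; have dt0 : 0 < dt by rewrite divr_gt0.
pose x := alpha * dt; have x0 : 0 < x by rewrite mulr_gt0.
have [r01 hr] := decay_rate x0; set r := expR (- x) in r01 hr.
have /andP[r0 r1] := r01.
pose G := (\sum_(n <oo) (dt * expR (- (2 * alpha * n%:R * dt)) * g n ^+ 2)%:E)%E.
have w0 n : 0 <= dt * expR (- (2 * alpha * n%:R * dt)) * g n ^+ 2.
  apply: mulr_ge0; last exact: sqr_ge0.
  by apply: mulr_ge0; [exact: ltW|exact: expR_ge0].
have G0 : (0 <= G)%E by apply: nneseries_ge0 => n _ _; rewrite lee_fin.
have a_ge0 n j : 0 <= dt * dx * expR (- (2 * alpha * n%:R * dt)) * q g n j.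
  apply: mulr_ge0 => //; apply: mulr_ge0; last exact: expR_ge0.
  by apply: mulr_ge0; exact: ltW.
have c_ge0 j : 0 <= dx * B * (r ^+ j) ^+ 2.
  apply: mulr_ge0; last exact: sqr_ge0.
  by apply: mulr_ge0; exact: ltW.
have inner j : (\sum_(n <oo) (dt * dx * expR (- (2 * alpha * n%:R * dt)) * q g n j)%:E <=
    (dx * B * (r ^+ j) ^+ 2)%:E * G)%E.
  apply: lime_le; first by apply: is_cvg_nneseries => n _ _; rewrite lee_fin.
  apply: nearW => N; rewrite sumEFin.
  apply: (@le_trans _ _ ((dx * B * (r ^+ j) ^+ 2)%:E *
     \sum_(0 <= n < N) (dt * expR (- (2 * alpha * n%:R * dt)) * g n ^+ 2)%:E)%E); last first.
    apply: lee_wpmul2l; first by rewrite lee_fin.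
    by apply: nneseries_lim_ge => n _ _; rewrite lee_fin.
  rewrite sumEFin -EFinM lee_fin !big_mkord.
  have -> : \sum_(i < N) dt * dx * expR (- (2 * alpha * i%:R * dt)) * q g i j =
    dt * dx * \sum_(i < N) (r ^+ i) ^+ 2 * q g i j.
    by rewrite mulr_sumr; apply: eq_bigr => i _; rewrite weight_exp mulrA.
  have -> : \sum_(i < N) dt * expR (- (2 * alpha * i%:R * dt)) * g i ^+ 2 = dt * nrm r N g.
    by rewrite mulr_sumr; apply: eq_bigr => i _; rewrite weight_exp exprMn -mulrA.
  have -> : dx * B * r ^+ j ^+ 2 * (dt * nrm r N g) = dt * dx * (B * r ^+ j ^+ 2 * nrm r N g).
    by ring.
  by rewrite ler_wpM2l ?hB// mulr_ge0// ltW.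
have r21 : 0 < 1 - r ^+ 2 by rewrite subr_gt0 expr_lt1// ltW.
have outer : (\sum_(n <oo) \sum_(j <oo)
   (dt * dx * expR (- (2 * alpha * n%:R * dt)) * q g n j)%:E <=
   (dx * B / (1 - r ^+ 2))%:E * G)%E.
  rewrite nneseries_interchange; last by move=> n j; rewrite lee_fin.
  apply: lime_le.
    by apply: is_cvg_nneseries => j _ _; apply: nneseries_ge0 => n _ _; rewrite lee_fin.
  apply: nearW => J; apply: (@le_trans _ _ (\sum_(0 <= j < J) (dx * B * (r ^+ j) ^+ 2)%:E * G)%E).
    by apply: lee_sum => j _.
  rewrite -ge0_sume_distrl; last by move=> j _; rewrite lee_fin.
  apply: lee_wpmul2r => //; rewrite sumEFin lee_fin -mulr_sumr ler_wpM2l//.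
    by rewrite mulr_ge0// ltW.
  rewrite -[leRHS]mul1r ler_pdivlMr// big_mkord.
  rewrite (eq_bigr (fun i : 'I_J => (r ^+ 2) ^+ i)); last by move=> i _; rewrite -!exprM mulnC.
  rewrite geo_sum.
  by rewrite gerBl exprn_ge0 ?sqr_ge0.
have c0 : 0 < 1 + alpha * dt by rewrite addr_gt0.
apply: (@le_trans _ _ ((alpha / (1 + alpha * dt))%:E * ((dx * B / (1 - r ^+ 2))%:E * G))%E).
  by apply: lee_wpmul2l => //; rewrite lee_fin divr_ge0// ltW.
rewrite muleA -EFinM; apply: lee_wpmul2r => //; rewrite lee_fin.
have -> : alpha / (1 + alpha * dt) * (dx * B / (1 - r ^+ 2)) =
  (x / (1 + x)) / (1 - r ^+ 2) * (lam * B).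
  rewrite /x /dt; field; rewrite (gt_eqF r21) (gt_eqF lam0)/= -/r.
  by have -> : lam + alpha * dx = lam * (1 + x);
    [rewrite /x /dt; field; rewrite gt_eqF|rewrite mulf_neq0// gt_eqF].
by apply: ler_piMl; [apply: mulr_ge0; exact: ltW|rewrite ler_pdivrMr// mul1r].
Qed.

End Estimates.

(** * Reduction of stability to ghost values *)

Section Stability.
Variable R : realType.
Implicit Types (C s lam r q x y : R) (w : R[i]) (h g : nat -> R) (b : bcond R).

(* Ghost values of the scheme, so that the boundary scheme becomes the kinetic Dirichlet scheme
   driven by them. *)
Definition hsrc C s b g n :=
  ghost b (collide C s (sol C s b g n)).1 (collide C s (sol C s b g n)).2 + g n.

(** With it the boundary condition is the fixed-point equation [h = bop h + g] of [hsrc_eq]. *)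
Definition bop C s b h n :=
  ghost b (collide C s (sol C s (bc_KD R) h n)).1 (collide C s (sol C s (bc_KD R) h n)).2.

Lemma sol_kd C s b g n : sol C s b g n = sol C s (bc_KD R) (hsrc C s b g) n.
Proof.
elim: n => [//|n ih] /=; rewrite /step -ih; congr pair; apply/funext => -[|j] //.
by rewrite [in RHS]/ghost big_ord0 add0r.
Qed.

Lemma hsrc_eq C s b g n : hsrc C s b g n = bop C s b (hsrc C s b g) n + g n.
Proof. by rewrite {1}/hsrc /bop -sol_kd. Qed.

Definition Tsym C s b w := \sum_(j < size b)
  ((bc_coef b j).1%:C * kap C s w ^+ j.+1 +
   (bc_coef b j).2%:C * ((cc C s)%:C * w * kap C s w ^+ j / (1 - (cd C s)%:C * kap C s w * w))).

(* Kreiss-Lopatinskii determinant: the boundary relation tested on the stable eigenvector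
   (1 - cd k w, cc w). *)
Definition Nsym C s b w (k : R[i]) :=
  (1 - (cd C s)%:C * k * w) * (1 - \sum_(j < size b) (bc_coef b j).1%:C * k ^+ j.+1)
  - (cc C s)%:C * w * \sum_(j < size b) (bc_coef b j).2%:C * k ^+ j.

Lemma NsymE C s b w : admissible C s -> 0 < cn w < 1 ->
  (1 - (cd C s)%:C * kap C s w * w) * (1 - Tsym C s b w) = Nsym C s b w (kap C s w).
Proof.
move=> hCs w01; have nz := dkw_neq1 hCs w01.
rewrite /Tsym /Nsym big_split/=; set S1 := \sum_(j < _) _; set S2 := \sum_(j < _) _.
have -> : S2 = (cc C s)%:C * w * (\sum_(j < size b) (bc_coef b j).2%:C * kap C s w ^+ j)
   / (1 - (cd C s)%:C * kap C s w * w).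
  by rewrite mulr_sumr mulr_suml; apply: eq_bigr => j _; field.
by field.
Qed.

Lemma op_bop C s b : admissible C s -> is_op (bop C s b) (Tsym C s b).
Proof.
move=> hCs.
apply: op_eqA (op_sum (index_enum 'I_(size b))
  (A := fun (j : 'I_(size b)) h n => (bc_coef b j).1 * F1 C s j.+1 h n.+1 +
     (bc_coef b j).2 * (cc C s * F1 C s j h n + cd C s * F2 C s j h n))
  (T := fun (j : 'I_(size b)) w => (bc_coef b j).1%:C * kap C s w ^+ j.+1 +
    (bc_coef b j).2%:C * ((cc C s)%:C * w * kap C s w ^+ j / (1 - (cd C s)%:C * kap C s w * w)))
  _).
  by move=> h n; apply: eq_bigr => j _; rewrite collide1 collide2 F1S.
move=> j; apply: op_add; apply: op_scale.
  apply: op_eqT (op_shift _ _ (op_F1 j.+1 hCs)).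
  - by move=> w /andP[w0 _]; rewrite mulrAC divff ?mul1r// -cn_gt0.
  - by move=> h h' N hh n nN; have [] := F_causal C s hh nN j.+1.
  - by [].
apply: op_eqT (op_add (op_scale (cc C s) (op_F1 j hCs)) (op_scale (cd C s) (op_F2 j hCs))).
move=> w w01; have nz := dkw_neq1 hCs w01.
by rewrite /beta; field.
Qed.

Lemma F1_bound C s r N j h : admissible C s -> 0 < r < 1 ->
  nrm r N (F1 C s j h) <= (r ^+ j) ^+ 2 * nrm r N h.
Proof.
move=> hCs /[dup] r01 /andP[r0 r1]; apply: (op_bound N h (op_F1 j hCs) r01).
  by rewrite exprn_ge0// ltW.
move=> w wr; have w01 : 0 < cn w < 1 by rewrite wr.
have [_ kw _ _] := kapP hCs w01; rewrite wr in kw.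
rewrite cnM cnX wr -[leRHS]mul1r ler_pM ?exprn_ge0 ?cn_ge0 ?(ltW r0) ?(ltW r1)//.
by rewrite lerXn2r// nnegrE ?cn_ge0 ?(ltW r0).
Qed.

Lemma beta_bound C s w : admissible C s -> 0 < cn w < 1 ->
  cn (beta C s w) <= `|cc C s| / (1 - gap C s).
Proof.
move=> hCs /[dup] w01 /andP[w0 w1]; have /andP[g0 g1] := gap01 hCs.
have [_ kw _ _] := kapP hCs w01.
rewrite /beta cnM cnV !cnM cn_real.
have h1 : 1 - gap C s <= cn (1 - (cd C s)%:C * kap C s w * w).
  have := cn_le_sub 1 (- ((cd C s)%:C * kap C s w * w)); rewrite cn1 cnN.
  by apply: le_trans; rewrite lerD2l lerN2 kap_gap.
have h0 : 0 < 1 - gap C s by lra.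
apply: ler_pM; rewrite ?mulr_ge0 ?cn_ge0 ?invr_ge0 ?cn_ge0//.
  rewrite -mulrA ler_piMr// mulr_ile1 ?cn_ge0 ?(ltW w1)//.
  exact: le_trans kw (ltW w1).
by rewrite lef_pV2// posrE (lt_le_trans h0).
Qed.

Lemma F2_bound C s r N j h : admissible C s -> 0 < r < 1 ->
  nrm r N (F2 C s j h) <= (r ^+ j * (`|cc C s| / (1 - gap C s))) ^+ 2 * nrm r N h.
Proof.
move=> hCs /[dup] r01 /andP[r0 r1]; apply: (op_bound N h (op_F2 j hCs) r01).
  rewrite mulr_ge0 ?exprn_ge0 ?(ltW r0)// divr_ge0//.
  by have /andP[_] := gap01 hCs; rewrite subr_ge0 => /ltW.
move=> w wr; have w01 : 0 < cn w < 1 by rewrite wr.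
have [_ kw _ _] := kapP hCs w01; rewrite wr in kw.
rewrite cnM ler_pM ?cn_ge0 ?beta_bound//.
rewrite cnM cnX wr -[leRHS]mul1r ler_pM ?exprn_ge0 ?cn_ge0 ?(ltW r0) ?(ltW r1)//.
by rewrite lerXn2r// nnegrE ?cn_ge0 ?(ltW r0).
Qed.

(** Since [m1^2 + m2^2 = 2 (f1^2 + f2^2)], the operator bounds on [F1] and [F2] leave only the ghost
    values to be controlled. *)
Lemma SS_of_ghost_bound lam C s b : 0 < lam -> admissible C s ->
  (exists B, forall r N g, 0 < r < 1 -> nrm r N (hsrc C s b g) <= B * nrm r N g) ->
  SS_est lam C s b.
Proof.
move=> lam0 hCs [B hB]; apply: estimate_intro => //.
  by move=> g n j; rewrite addr_ge0 ?sqr_ge0.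
pose c := `|cc C s| / (1 - gap C s).
exists (2 * (1 + c ^+ 2) * B) => r g N j r01; set h := hsrc C s b g.
have -> : \sum_(n < N) r ^+ n ^+ 2 * (mom1 C s b g n j ^+ 2 + mom2 C s b g n j ^+ 2) =
  2 * (nrm r N (F1 C s j h) + nrm r N (F2 C s j h)).
  rewrite mulrDr /nrm !mulr_sumr -big_split; apply: eq_bigr => n _.
  by rewrite /mom1 /mom2 sol_kd -/(F1 C s j h n) -/(F2 C s j h n) -/h /=; ring.
have b1 := F1_bound N j h hCs r01; have b2 := F2_bound N j h hCs r01.
have b3 := hB r N g r01; rewrite -/c in b2.
have -> : 2 * (1 + c ^+ 2) * B * r ^+ j ^+ 2 * nrm r N g =
  2 * ((1 + c ^+ 2) * r ^+ j ^+ 2 * (B * nrm r N g)) by ring.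
rewrite ler_pM2l//; apply: (@le_trans _ _ ((1 + c ^+ 2) * r ^+ j ^+ 2 * nrm r N h)).
  apply: le_trans (lerD b1 b2) _; rewrite exprMn.
  by rewrite le_eqVlt; apply/orP; left; apply/eqP; ring.
by rewrite ler_wpM2l// mulr_ge0 ?sqr_ge0// addr_ge0// sqr_ge0.
Qed.

(** Polynomials in w and kap, kept as syntax: one term yields both a function of w ([den]) and an
    operator on sequences ([act]), so a multiplier is given by a single formula. *)
Inductive sym : Type :=
| Sw | Sk | Sc of R | Sadd of sym & sym | Smul of sym & sym.

Fixpoint den C s (e : sym) w : R[i] := match e with
  | Sw => w | Sk => kap C s w | Sc x => x%:C
  | Sadd e1 e2 => den C s e1 w + den C s e2 w
  | Smul e1 e2 => den C s e1 w * den C s e2 w end.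

Fixpoint act C s (e : sym) h : nat -> R := match e with
  | Sw => delay h | Sk => kapop C s h | Sc x => fun n => x * h n
  | Sadd e1 e2 => fun n => act C s e1 h n + act C s e2 h n
  | Smul e1 e2 => act C s e1 (act C s e2 h) end.

Lemma op_act C s e : admissible C s -> is_op (act C s e) (den C s e).
Proof.
move=> hCs; elim: e => [||x|e1 h1 e2 h2|e1 h1 e2 h2] /=.
- exact: op_delay.
- exact: op_kapop.
- by apply: op_eqT (op_scale x (op_id R)) => w _; rewrite mulr1.
- exact: op_add.
- exact: op_comp.
Qed.

(* Multiplying the boundary relation (1 - T) h = g by a symbol G turns it into h = X h + G g. *)
Lemma ghost_bound_symbol C s b (G X : sym) q B : admissible C s -> 0 < q < 1 -> 0 <= B ->
  (forall w, 0 < cn w < 1 -> den C s G w * (1 - Tsym C s b w) = 1 - den C s X w) ->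
  (forall w, 0 < cn w < 1 -> cn (den C s G w) <= B) ->
  (forall w, 0 < cn w < 1 -> cn (den C s X w) <= q) ->
  exists B', forall r N g, 0 < r < 1 -> nrm r N (hsrc C s b g) <= B' * nrm r N g.
Proof.
move=> hCs q01 B0 e hG hX; exists (B ^+ 2 / (1 - q) ^+ 2) => r N g r01.
set h := hsrc C s b g.
have gE n : g n = h n - bop C s b h n by rewrite {1}/h hsrc_eq -/h addrAC subrr add0r.
have oA := op_sub (op_id R) (op_bop b hCs).
have oB := op_sub (op_id R) (op_act X hCs).
have oGA := op_eqT e (op_comp (op_act G hCs) oA).
have hE n : h n = act C s X h n + act C s G g n.
  have := op_ext oGA oB h n; have -> : (fun n => id h n - bop C s b h n) = g.
    by apply/funext => k; rewrite gE.
  by move=> ->; rewrite addrC subrK.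
have hX' w : cn w = r -> cn (den C s X w) <= q by move=> wr; apply: hX; rewrite wr.
have hc := @contraction_bound R _ _ r q N h (act C s G g) (op_act X hCs) r01 q01 hX' hE.
apply: le_trans hc _.
rewrite mulrAC ler_wpM2r ?invr_ge0 ?sqr_ge0//.
by apply: (op_bound N g (op_act G hCs) r01 B0) => w wr; apply: hG; rewrite wr.
Qed.

Definition Ssub e1 e2 := Sadd e1 (Smul (Sc (-1)) e2).

Definition Sdkw C s := Ssub (Sc 1) (Smul (Sc (cd C s)) (Smul Sk Sw)).

(** The multiplier is [1 - cd kap w], which clears the denominator of [Tsym]. *)
Lemma SS_of_symbol lam C s b (X : sym) q : 0 < lam -> admissible C s -> 0 < q < 1 ->
  (forall w, 0 < cn w < 1 -> Nsym C s b w (kap C s w) = 1 - den C s X w) ->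
  (forall w, 0 < cn w < 1 -> cn (den C s X w) <= q) ->
  SS_est lam C s b.
Proof.
move=> lam0 hCs q01 e hX; apply: SS_of_ghost_bound => //.
have eG w : den C s (Sdkw C s) w = 1 - (cd C s)%:C * kap C s w * w.
  by rewrite /= rmorphN rmorph1; ring.
apply: (@ghost_bound_symbol C s b (Sdkw C s) X q 2) => //.
  by move=> w w01; rewrite -e// -NsymE// eG.
move=> w w01; rewrite eG (le_trans (cnB _ _))// cn1 -[2]/(1 + 1) lerD2l.
by rewrite (le_trans (kap_gap hCs w01))// ltW//; have /andP[] := gap01 hCs.
Qed.

End Stability.

Arguments Sw {R}.
Arguments Sk {R}.

(** * Determinants of the boundary conditions and directly stable cases *)

Section StableCases.
Variable R : realType.
Implicit Types (C s lam r q x y : R) (w k : R[i]) (h g : nat -> R) (b : bcond R).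

(** Binomial expansion of [(1 - k)^sigma]: extrapolation annihilates a finite difference of order
    sigma. *)
Lemma sum_extr (sigma : nat) k :
  \sum_(j < sigma) ((-1) ^+ j * ('C(sigma, j.+1))%:R)%:C * k ^+ j.+1 = 1 - (1 - k) ^+ sigma :> R[i].
Proof.
rewrite exprDn big_ord_recl /= bin0 mulr1n expr0 mulr1 expr1n opprD addrA subrr sub0r.
rewrite -sumrN; apply: eq_bigr => j _; rewrite expr1n mul1r /bump leq0n add1n rmorphM rmorphXn rmorphN1.
rewrite rmorph_nat (exprNn k) [(-1) ^+ j.+1]exprS -mulr_natr.
set A := (-1) ^+ j; set B := k ^+ _; set D := _%:R; ring.
Qed.

Lemma Nsym_BB C s w k : Nsym C s (bc_BB R) w k = 1 - (cd C s)%:C * k * w - (cc C s)%:C * w.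
Proof. by rewrite /Nsym /bc_coef !big_ord_recl !big_ord0 /= rmorph0 rmorph1; ring. Qed.

Lemma Nsym_ABB C s w k : Nsym C s (bc_ABB R) w k = 1 - (cd C s)%:C * k * w + (cc C s)%:C * w.
Proof. by rewrite /Nsym /bc_coef !big_ord_recl !big_ord0 /= rmorph0 rmorphN1; ring. Qed.

Lemma cc_sub_cd C s : cc C s - cd C s = s - 1.
Proof. by rewrite /cc /cd; field. Qed.

(** The result is also the numerator of the symbol of m1 in [op_mom1]. *)
Lemma Nsym_ABB2 C s w k : Nsym C s (bc_ABB2 R) w k = 1 + (s - 1)%:C * k * w.
Proof.
rewrite /Nsym /bc_coef !big_ord_recl !big_ord0 /= !rmorph0 rmorphN1 -(cc_sub_cd C s).
by rewrite rmorphB; ring.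
Qed.

Lemma Nsym_extr C s sigma w k :
  Nsym C s (bc_extr R sigma) w k = (1 - (cd C s)%:C * k * w) * (1 - k) ^+ sigma.
Proof.
rewrite /Nsym size_map size_iota [X in _ - _ * X]big1 ?mulr0 ?subr0; last first.
  by move=> j _; rewrite /bc_coef (nth_map 0%N) ?size_iota//= rmorph0 mul0r.
rewrite (eq_bigr (fun j : 'I_sigma => ((-1) ^+ j * ('C(sigma, j.+1))%:R)%:C * k ^+ j.+1)).
  by rewrite sum_extr subKr.
by move=> j _; rewrite /bc_coef (nth_map 0%N) ?size_iota//= nth_iota.
Qed.

Lemma Nsym_extreq1 C s w k : Nsym C s (bc_extreq C 1) w k =
  (1 - (cd C s)%:C * k * w) * (1 - ((1 + C) / 2)%:C * k) - (cc C s)%:C * w * ((1 + C) / 2)%:C.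
Proof.
rewrite /Nsym /bc_coef !big_ord_recl !big_ord0 /= expr0 mul1r mulr1.
by rewrite -[LHS]/(_ - _); ring.
Qed.

Lemma Nsym_extreq3 C s w k : Nsym C s (bc_extreq C 3) w k =
  (1 - (cd C s)%:C * k * w) * (1 - ((1 + C) / 2)%:C * k * (3%:R - 3%:R * k + k ^+ 2))
  - (cc C s)%:C * w * ((1 + C) / 2)%:C * (3%:R - 3%:R * k + k ^+ 2).
Proof.
rewrite /Nsym /bc_coef !big_ord_recl !big_ord0 /=.
have -> : 'C(3, 1) = 3%N by []. have -> : 'C(3, 2) = 3%N by []. have -> : 'C(3, 3) = 1%N by [].
rewrite !rmorphM !rmorphXn !rmorphN1 !rmorph_nat /bump /=; ring.
Qed.

Lemma Nsym_future C s w k : Nsym C s (bc_future C) w k =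
  1 - (cd C s)%:C * k * w - ((1 + C) / 2)%:C * k * (1 + (s - 1)%:C * k * w).
Proof.
rewrite /Nsym /bc_coef !big_ord_recl !big_ord0 /= !rmorph0 -(cc_sub_cd C s) rmorphB.
by rewrite /bump /=; ring.
Qed.

Lemma Nsym_invented C s w k : Nsym C s (bc_invented R) w k =
  (1 - (cd C s)%:C * k * w) * (1 - k) - 2%:R * (cc C s)%:C * w.
Proof. by rewrite /Nsym /bc_coef !big_ord_recl !big_ord0 /= rmorph_nat rmorph1; ring. Qed.

(** Conservation of m1 by the relaxation, read on the stable eigenvector: the left side is w times
    the relaxed m1. *)
Lemma bulk_identity C s w k : w != 0 -> kchar C s w k ->
  k - (cd C s)%:C * k ^+ 2 * w + (cc C s)%:C * w = w * (1 + (s - 1)%:C * w * k).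
Proof.
move=> w0 hk; have e : (ca C s)%:C + (cc C s)%:C = 1 :> R[i] by rewrite -rmorphD ca_cc rmorph1.
have e2 : w^-1 * w = 1 by rewrite mulVf.
apply/eqP; rewrite -subr_eq0; apply/eqP.
transitivity (- w * ((cd C s)%:C * k ^+ 2 - cZ s w * k + (ca C s)%:C) +
   ((ca C s)%:C + (cc C s)%:C - 1) * w - (w^-1 * w - 1) * k).
  by rewrite /cZ -(opprB 1 s) rmorphN; ring.
by rewrite hk e e2 !subrr mulr0 !mul0r oppr0 !addr0.
Qed.

Lemma Nsym_extreq1_bulk C s w k : w != 0 -> kchar C s w k ->
  Nsym C s (bc_extreq C 1) w k =
  1 - (cd C s)%:C * k * w - ((1 + C) / 2)%:C * w * (1 + (s - 1)%:C * w * k).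
Proof.
move=> w0 hk; rewrite Nsym_extreq1 -[RHS]addrA -[_ * w * (1 + _)]mulrA -(bulk_identity w0 hk).
by ring.
Qed.

Lemma Nsym_extreq3_bulk C s w k : w != 0 -> kchar C s w k ->
  Nsym C s (bc_extreq C 3) w k =
  1 - (cd C s)%:C * k * w -
  ((1 + C) / 2)%:C * (3%:R - 3%:R * k + k ^+ 2) * (w * (1 + (s - 1)%:C * w * k)).
Proof. by move=> w0 hk; rewrite Nsym_extreq3 -(bulk_identity w0 hk); ring. Qed.

(** The modulus is that of the reflection coefficient at an inflow boundary. Energy dissipation on
    the eigenvector bounds it, because [1 - |k/w|^2 <= |w|^-2 - |k|^2]. *)
Lemma reflection_bound C s w : admissible C s -> 0 < C -> 0 < cn w < 1 ->
  (1 + C) * cn ((cc C s)%:C * w / (1 - (cd C s)%:C * kap C s w * w)) ^+ 2 <= 1 - C.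
Proof.
move=> hCs C0 /[dup] w01 /andP[w0 w1].
have wn0 : w != 0 by rewrite -cn_gt0.
have nz := dkw_neq1 hCs w01; have [hk kw _ _] := kapP hCs w01.
have /andP[s0 s2] := admissible_s hCs; have [_ /andP[C1 C2]] := admissible_C hCs.
set k := kap C s w in nz hk kw *; set c := cc C s; set f1 := w^-1 - (cd C s)%:C * k.
have hs : 0 <= s <= 2 by rewrite ltW.
have := energy_complex C f1 (c%:C * k) hs.
rewrite kernel_row1// -/f1.
have -> : (cc C s)%:C * f1 + (cd C s)%:C * (c%:C * k) = c%:C * w^-1 by rewrite /f1 /c; ring.
have -> : c%:C * w / (1 - (cd C s)%:C * k * w) = c%:C / f1.
  have e : 1 - (cd C s)%:C * k * w = w * f1 by rewrite /f1 mulrBr mulfV//; ring.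
  have f10 : f1 != 0 by apply: contra nz => /eqP f0; rewrite e f0 mulr0.
  by rewrite e; field; rewrite f10.
have f10 : 0 < cn f1.
  rewrite cn_gt0; apply: contra nz => /eqP f0.
  have -> : 1 - (cd C s)%:C * k * w = w * f1 by rewrite /f1 mulrBr mulfV//; ring.
  by rewrite f0 mulr0.
rewrite !cnM !cn_real !cnV; set F := cn f1 in f10 *; set t := (cn w)^-1; set y := cn k in kw *.
have t1 : 1 < t by rewrite invf_gt1.
have y0 : 0 <= y by exact: cn_ge0.
have y1 : y < 1 by exact: le_lt_trans w1.
have ty : t ^+ 2 - y ^+ 2 > 0.
  by rewrite subr_gt0 ltr_pXn2r ?nnegrE// ?(lt_trans y1)//; lra.
have ty1 : 1 - (t * y) ^+ 2 <= t ^+ 2 - y ^+ 2.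
  have t21 : 1 <= t ^+ 2 by rewrite exprn_ege1// ltW.
  rewrite -subr_ge0; have -> : t ^+ 2 - y ^+ 2 - (1 - (t * y) ^+ 2) = (t ^+ 2 - 1) * (1 + y ^+ 2) by ring.
  by apply: mulr_ge0; [lra|have := sqr_ge0 y; lra].
move=> en; rewrite expr_div_n mulrA ler_pdivrMr ?exprn_gt0//.
rewrite -(ler_pM2l ty); apply: (@le_trans _ _ ((1 - C) * ((1 - (t * y) ^+ 2) * F ^+ 2))); first by lra.
rewrite [leRHS]mulrCA ler_wpM2l ?subr_ge0// ler_wpM2r ?sqr_ge0//.
Qed.

Lemma ghost_bound_contraction C s b q : admissible C s -> 0 < q < 1 ->
  (forall w, 0 < cn w < 1 -> cn (Tsym C s b w) <= q) ->
  exists B', forall r N g, 0 < r < 1 -> nrm r N (hsrc C s b g) <= B' * nrm r N g.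
Proof.
move=> hCs q01 hT; exists (1 / (1 - q) ^+ 2) => r N g r01.
have hT' w : cn w = r -> cn (Tsym C s b w) <= q by move=> wr; apply: hT; rewrite wr.
have := @contraction_bound R _ _ r q N _ g (op_bop b hCs) r01 q01 hT' (hsrc_eq C s b g).
by rewrite mul1r mulrC.
Qed.

Lemma KD_stable lam C s : 0 < lam -> admissible C s -> lab_SS lam C s (bc_KD R).
Proof.
move=> lam0 hCs; apply: SS_of_ghost_bound => //.
apply: (@ghost_bound_contraction C s _ 2^-1) => //; first by lra.
by move=> w _; rewrite /Tsym big_ord0 cn0 invr_ge0.
Qed.

(** * Inflow: reflection is a contraction *)

Section Inflow.
Variables (lam C s : R).
Hypotheses (lam0 : 0 < lam) (hCs : admissible C s) (C0 : 0 < C).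

(** Mean of 1 and [rho = (1 - C) / (1 + C)]: it dominates [sqrt rho], the bound on the reflection
    coefficient, and lies strictly between 0 and 1 even for C = 1. *)
Definition inflow_q := ((1 - C) / (1 + C) + 1) / 2.
Local Notation q := inflow_q.

Lemma q_inflow : 0 < q < 1.
Proof.
have C0' := C0; have [_ /andP[_ C1]] := admissible_C hCs; have p : 0 < 1 + C by lra.
have t0 : 0 <= (1 - C) / (1 + C) by apply: divr_ge0; lra.
have t1 : (1 - C) / (1 + C) < 1 by rewrite ltr_pdivrMr//; lra.
by rewrite /inflow_q; lra.
Qed.

Lemma reflection_le_q w : 0 < cn w < 1 ->
  cn ((cc C s)%:C * w / (1 - (cd C s)%:C * kap C s w * w)) <= q.
Proof.
move=> w01; have C0' := C0; have := reflection_bound hCs C0 w01; set X := cn _.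
have p : 0 < 1 + C by lra.
rewrite mulrC -ler_pdivlMr// => hX.
have q0 : 0 <= q by case/andP: q_inflow => /ltW.
rewrite -ler_sqr ?nnegrE ?cn_ge0//; apply: le_trans hX _.
rewrite /inflow_q; set t := _ / _; rewrite -subr_ge0.
have -> : ((t + 1) / 2) ^+ 2 - t = ((t - 1) / 2) ^+ 2 by field.
exact: sqr_ge0.
Qed.

Lemma BB_inflow : lab_SS lam C s (bc_BB R).
Proof.
apply: SS_of_ghost_bound => //; apply: (@ghost_bound_contraction C s _ q) => //; first exact: q_inflow.
move=> w w01; rewrite /Tsym /bc_coef !big_ord_recl big_ord0 /= rmorph0 rmorph1 expr0.
rewrite mul0r add0r addr0 mul1r mulr1.
exact: reflection_le_q.
Qed.

Lemma ABB_inflow : lab_SS lam C s (bc_ABB R).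
Proof.
apply: SS_of_ghost_bound => //; apply: (@ghost_bound_contraction C s _ q) => //; first exact: q_inflow.
move=> w w01; rewrite /Tsym /bc_coef !big_ord_recl big_ord0 /= rmorph0 rmorphN1 expr0.
rewrite mul0r add0r addr0 mulN1r mulr1 cnN.
exact: reflection_le_q.
Qed.

Lemma ABB2_inflow : lab_SS lam C s (bc_ABB2 R).
Proof.
apply: SS_of_ghost_bound => //; apply: (@ghost_bound_contraction C s _ q) => //; first exact: q_inflow.
move=> w /[dup] w01 /andP[w0 w1]; have [_ kw _ _] := kapP hCs w01.
rewrite /Tsym /bc_coef !big_ord_recl big_ord0 /= !rmorph0 rmorphN1 !mul0r !add0r addr0 mulN1r cnN.
rewrite expr1 mulrAC cnM; have := reflection_le_q w01; set X := cn _ => hX.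
rewrite -[leRHS]mulr1 ler_pM ?cn_ge0//; exact: le_trans kw (ltW w1).
Qed.

End Inflow.

(** * Outflow with s < 2 *)

Section OutflowDissipative.
Variables (lam C s : R).
Hypotheses (lam0 : 0 < lam) (hCs : admissible C s) (C0 : C < 0) (s2 : s < 2).

Lemma kap_outflow : exists2 q, 0 < q < 1 & forall w, 0 < cn w < 1 -> cn (kap C s w) <= q.
Proof.
have s2' := s2; have [d0 _ _] := coef_neg hCs C0; have /andP[s0 _] := admissible_s hCs.
have ad : `|ca C s| < cd C s.
  by have sC : s * C < 0; [rewrite pmulr_rlt0|rewrite ltr_norml /ca /cd; lra].
have t0 : 0 <= `|ca C s| / cd C s by apply: divr_ge0 => //; exact: ltW.
have t1 : `|ca C s| / cd C s < 1 by rewrite ltr_pdivrMr// mul1r.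
(* Averaging with 1 keeps q positive when ca = 0. *)
exists ((`|ca C s| / cd C s + 1) / 2); first by lra.
move=> w /[dup] w01 /andP[w0 w1]; have [_ _ _ /(_ C0)] := kapP hCs w01.
rewrite gtr0_norm// => h; apply: (@le_trans _ _ (`|ca C s| / cd C s)); last by lra.
rewrite ler_pdivlMr// mulrC (le_trans h)// ler_piMr// ltW//.
Qed.

Lemma ABB2_outflow : lab_SS lam C s (bc_ABB2 R).
Proof.
have s2' := s2; have /andP[s0 _] := admissible_s hCs.
have s1 : `|s - 1| < 1 by rewrite ltr_norml; lra.
apply: (@SS_of_symbol _ lam C s (bc_ABB2 R) (Smul (Sc (1 - s)) (Smul Sk Sw))
  ((`|s - 1| + 1) / 2)) => //.
- by have := normr_ge0 (s - 1); move=> ?; lra.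
- by move=> w w01; rewrite Nsym_ABB2 /= -(opprB s) rmorphN; ring.
move=> w /[dup] w01 /andP[w0 w1]; have [_ kw _ _] := kapP hCs w01.
rewrite /= !cnM cn_real distrC; apply: (@le_trans _ _ `|s - 1|); last by lra.
by rewrite ler_piMr// mulr_ile1 ?cn_ge0 ?(ltW w1)// (le_trans kw)// ltW.
Qed.

Lemma iter_contraction (q r : R) N n h :
  0 < r < 1 -> 0 < q < 1 -> (forall w, 0 < cn w < 1 -> cn (kap C s w) <= q) ->
  nrm r N h <= (1 - q) ^- (2 * n) *
    nrm r N (iter n (fun u m => u m - kapop C s u m) h).
Proof.
move=> r01 q01 hq; elim: n h => [|n ih] h; first by rewrite muln0 expr0 invr1 mul1r.
have hq' w : cn w = r -> cn (kap C s w) <= q by move=> wr; apply: hq; rewrite wr.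
have e m : h m = kapop C s h m + (h m - kapop C s h m) by rewrite addrC subrK.
have := @contraction_bound R _ _ r q N h _ (op_kapop hCs) r01 q01 hq' e.
move/le_trans; apply; rewrite iterSr mulnS exprD; set a := (1 - q) ^+ 2.
set c := (1 - q) ^+ (2 * n); rewrite (invfM a) -(mulrA a^-1) [leLHS]mulrC.
by apply: ler_wpM2l; [rewrite invr_ge0 sqr_ge0|exact: ih].
Qed.

(** Here [1 - T = (1 - kap)^sigma], and each factor is inverted at the cost [(1 - q)^-2]. *)
Lemma extr_outflow sigma : lab_SS lam C s (bc_extr R sigma).
Proof.
have [q q01 hq] := kap_outflow; apply: SS_of_ghost_bound => //.
exists ((1 - q) ^- (2 * sigma)) => r N g r01; set h := hsrc _ _ _ _.
apply: le_trans (iter_contraction N sigma h r01 q01 hq) _.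
rewrite le_eqVlt; apply/orP; left; apply/eqP; congr (_ * _); apply: eq_nrm => n _.
have oA : is_op (iter sigma (fun u m => u m - kapop C s u m)) (fun w => (1 - kap C s w) ^+ sigma).
  elim: sigma {h} => [|m ih]; first by apply: op_eqT (op_id R) => w _; rewrite expr0.
  by apply: op_eqT (op_comp (op_sub (op_id R) (op_kapop hCs)) ih) => w _; rewrite exprS.
have oB := op_sub (op_id R) (op_bop (bc_extr R sigma) hCs).
rewrite (op_ext oA (op_eqT _ oB)) /=; first by rewrite {1}/h hsrc_eq -/h addrAC subrr add0r.
move=> w w01; have nz := dkw_neq1 hCs w01.
by apply: (mulfI nz); rewrite NsymE// Nsym_extr.
Qed.

End OutflowDissipative.

End StableCases.

(** * Outflow with s = 2: bounds on m1 alone *)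

Section ConservativeOutflow.
Variable R : realType.
Implicit Types (C s lam r q x y : R) (w k : R[i]) (h g : nat -> R) (b : bcond R).

Lemma SSOO_of_bound lam C s b : 0 < lam ->
  (exists B, forall r N g j, 0 < r < 1 ->
     nrm r N (fun n => F1 C s j (hsrc C s b g) n + F2 C s j (hsrc C s b g) n) <=
     B * (r ^+ j) ^+ 2 * nrm r N g) ->
  SSOO_est lam C s b.
Proof.
move=> lam0 [B hB]; apply: estimate_intro => //; first by move=> g n j; exact: sqr_ge0.
exists B => r g N j r01; apply: le_trans (hB r N g j r01).
rewrite le_eqVlt; apply/orP; left; apply/eqP; apply: eq_bigr => n _.
by rewrite exprMn /mom1 sol_kd.
Qed.

Lemma op_mom1 C s j : admissible C s ->
  is_op (fun h n => F1 C s j h n + F2 C s j h n)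
    (fun w => w * kap C s w ^+ j * ((1 + (s - 1)%:C * kap C s w * w) /
       (1 - (cd C s)%:C * kap C s w * w))).
Proof.
move=> hCs; apply: op_eqT (op_add (op_F1 j hCs) (op_F2 j hCs)) => w w01.
have nz := dkw_neq1 hCs w01.
by rewrite /beta -(cc_sub_cd C s) rmorphB /=; field.
Qed.

Lemma op_mom2 C s j : admissible C s ->
  is_op (fun h n => F1 C s j h n - F2 C s j h n)
    (fun w => w * kap C s w ^+ j * ((1 - (1 - s * C)%:C * kap C s w * w) /
       (1 - (cd C s)%:C * kap C s w * w))).
Proof.
move=> hCs; apply: op_eqT (op_sub (op_F1 j hCs) (op_F2 j hCs)) => w w01.
have nz := dkw_neq1 hCs w01.
have -> : 1 - s * C = cc C s + cd C s by rewrite /cc /cd; field.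
by rewrite /beta rmorphD /=; field.
Qed.

Lemma ghost_defect C s b g n :
  g n = hsrc C s b g n - bop C s b (hsrc C s b g) n.
Proof. by rewrite {1}hsrc_eq addrAC subrr add0r. Qed.

(** The determinant equals the numerator of m1, so the zero of one cancels that of the other: m1 is
    exactly [F1] driven by g. *)
Lemma ABB2_SSOO lam C s : 0 < lam -> admissible C s -> SSOO_est lam C s (bc_ABB2 R).
Proof.
move=> lam0 hCs; apply: SSOO_of_bound => //; exists 1 => r N g j r01; rewrite mul1r.
set h := hsrc _ _ _ _.
have -> : nrm r N (fun n => F1 C s j h n + F2 C s j h n) = nrm r N (F1 C s j g); last exact: F1_bound.
apply: eq_nrm => n _.
have oB := op_comp (op_F1 j hCs) (op_sub (op_id R) (op_bop (bc_ABB2 R) hCs)).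
rewrite (op_ext (op_mom1 j hCs) (op_eqT _ oB)).
  by congr (F1 C s j _ n); apply/funext => m; rewrite -ghost_defect.
move=> w w01; have nz := dkw_neq1 hCs w01.
by rewrite -(Nsym_ABB2 C) -NsymE//; field.
Qed.

(** Factored bulk equation for s = 2. It links the vanishing of [1 + w] to that of [1 - k] at the
    critical point (-1, 1). *)
Lemma leapfrog_identity C w k : w != 0 -> kchar C 2 w k ->
  k * (1 - w) * (1 + w) = C%:C * w * (1 + k) * (1 - k).
Proof.
move=> w0 hk.
have a2 : ca C 2 = C by rewrite /ca; field.
have d2 : cd C 2 = - C by rewrite /cd; field.
move: hk; rewrite /kchar a2 d2 /cZ rmorphN -(opprB 2 1) rmorphN /= => hk.
have e2 : w^-1 * w = 1 by rewrite mulVf.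
have e1 : (2 - 1 : R)%:C = 1 :> R[i] by rewrite -(rmorph1 (real_complex R)); congr (_%:C); lra.
rewrite e1 in hk.
apply/eqP; rewrite -subr_eq0; apply/eqP.
transitivity (- w * (- C%:C * k ^+ 2 - (w^-1 + -1 * w) * k + C%:C) - (w^-1 * w - 1) * k).
  by ring.
by rewrite hk e2 subrr mulr0 mul0r subr0.
Qed.

Lemma cn_half (w : R[i]) x : 0 <= x -> cn w <= x -> cn ((2^-1)%:C * w) <= x / 2.
Proof. by move=> x0 h; rewrite cnM cn_real ger0_norm ?invr_ge0// mulrC ler_wpM2r ?invr_ge0. Qed.

(** At k = w = 1 the symbol would equal 1. By [kap_sign] the real parts of k and w have opposite
    signs, which keeps that corner out of reach: with [X = k (1 + w) / 2],
    [|1 + X|^2 <= 3 <= (7/4)^2]. *)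
Lemma extr1_contraction C w : admissible C 2 -> C < 0 -> 0 < cn w < 1 ->
  cn (2^-1%:C * (1 + 2^-1%:C * kap C 2 w * (1 + w))) <= 7 / 8.
Proof.
move=> hC C0 /[dup] w01 /andP[w0 w1]; have := kap_sign hC erefl w01.
have [_ kw _ _] := kapP hC w01; set k := kap C 2 w in kw *.
have k1 : cn k <= 1 by exact: le_trans kw (ltW w1).
rewrite -mulrA nmulr_rge0// => sg.
set X := _ * k * _.
suff hX : cn (1 + X) ^+ 2 <= 3.
  have h : cn (1 + X) <= 7 / 4.
    by rewrite -ler_sqr ?nnegrE ?cn_ge0//; lra.
  by have := @cn_half (1 + X) (7/4) ltac:(lra) h; lra.
have hk2 : cn k ^+ 2 <= 1 by rewrite expr_le1 ?cn_ge0.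
have hw2 : cn w ^+ 2 <= 1 by rewrite expr_le1 ?cn_ge0// ltW.
have X2 : cn X ^+ 2 = 1/4 * cn k ^+ 2 * cn (1 + w) ^+ 2.
  rewrite /X !cnM !exprMn cn_real ger0_norm ?invr_ge0//; congr (_ * _ * _).
  by field.
have E1 : cn (1 + X) ^+ 2 = 1 + 2 * Re X + cn X ^+ 2.
  by rewrite !cn_sqr; case: (X) => x1 x2 /=; ring.
have E2 : cn (1 + w) ^+ 2 = 1 + 2 * Re w + cn w ^+ 2.
  by rewrite !cn_sqr; case: (w) => x1 x2 /=; ring.
have E3 : Re X = 1/2 * (Re k * (1 + Re w) - Im k * Im w).
  by rewrite /X; case: (k) => x1 x2; case: (w) => y1 y2 /=; field.
have hRw : `|Re w| <= 1 by apply: le_trans (cn_Re w) (ltW w1).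
have hRk : `|Re k| <= 1 by apply: le_trans (cn_Re k) k1.
have hIw : `|Im w| <= 1 by apply: le_trans (cn_Im w) (ltW w1).
have hIk : `|Im k| <= 1 by apply: le_trans (cn_Im k) k1.
have hII : - (Im k * Im w) <= 1.
  by rewrite (le_trans (ler_norm _))// normrN normrM mulr_ile1.
have k20 := sqr_ge0 (cn k).
move: hRw hRk; rewrite !ler_norml => /andP[a1 a2] /andP[b1 b2].
case: (lerP (Re w) 0) => rw.
  have X2' : cn X ^+ 2 <= 1/2.
    rewrite X2 E2; have : cn k ^+ 2 * (1 + 2 * Re w + cn w ^+ 2) <= 1 * 2.
      by apply: ler_pM => //; [rewrite -E2 sqr_ge0|lra].
    by lra.
  have : Re X <= 1 * cn X by rewrite mul1r (le_trans (ler_norm _))// cn_Re.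
  have := sqr_ge0 (2 * cn X - 1); move=> ? ?.
  have : cn X <= 3/4 by rewrite -ler_sqr ?nnegrE ?cn_ge0//; lra.
  by rewrite E1; lra.
have rk : Re k <= 0 by have := sg; rewrite pmulr_lle0.
have h1 : Re k * (1 + Re w) <= 0 by apply: mulr_le0_ge0 => //; lra.
have h2 : cn X ^+ 2 <= 1.
  rewrite X2 E2; have : cn k ^+ 2 * (1 + 2 * Re w + cn w ^+ 2) <= 1 * 4.
    by apply: ler_pM => //; [rewrite -E2 sqr_ge0|lra].
  by lra.
by rewrite E1 E3; lra.
Qed.

(** The ghost values h are not controlled near w = -1, but [(1 + w) h] is: by [leapfrog_identity],
    [(1 - X) (1 + w) = G (1 - kap)] with X a contraction. This suffices for m1, whose numerator is
    [1 + kap w = (1 + w) - w (1 - kap)]. *)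
Lemma extr1_SSOO lam C : 0 < lam -> admissible C 2 -> C < 0 -> SSOO_est lam C 2 (bc_extr R 1).
Proof.
move=> lam0 hC C0; apply: SSOO_of_bound => //.
pose X : sym R := Smul (Sc 2^-1) (Sadd (Sc 1) (Smul (Smul (Sc 2^-1) Sk) (Sadd (Sc 1) Sw))).
pose G : sym R := Smul (Sc 2^-1) (Sadd (Sadd (Sc 1) Sw)
  (Smul (Sc (C / 2)) (Smul Sw (Sadd (Sc 1) Sk)))).
pose Y h n := h n + delay h n.
have oY : is_op Y (fun w => 1 + w) by exact: op_add (op_id R) (op_delay R).
have oT := op_sub (op_id R) (op_bop (bc_extr R 1) hC).
have eT w : 0 < cn w < 1 -> 1 - Tsym C 2 (bc_extr R 1) w = 1 - kap C 2 w.
  move=> w01; apply: (mulfI (dkw_neq1 hC w01)); rewrite NsymE// Nsym_extr expr1//.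
have gT g : g = (fun n => id (hsrc C 2 (bc_extr R 1) g) n -
    bop C 2 (bc_extr R 1) (hsrc C 2 (bc_extr R 1) g) n).
  by apply/funext => n; rewrite -ghost_defect.
have hY r N g : 0 < r < 1 ->
  nrm r N (Y (hsrc C 2 (bc_extr R 1) g)) <= (2 ^+ 2 / (1 - 7 / 8) ^+ 2) * nrm r N g.
  move=> r01; set h := hsrc _ _ _ _.
  have e n : Y h n = act C 2 X (Y h) n + act C 2 G g n.
    have o1 := op_comp (op_sub (op_id R) (op_act X hC)) oY.
    have o2 := op_comp (op_act G hC) oT.
    have := op_ext o1 (op_eqT _ o2) h n; rewrite -gT => <-; first by rewrite addrC subrK.
    move=> w w01; rewrite eT//.
    have [hk _ _ _] := kapP hC w01; case/andP: w01 => w0 _.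
    have li := leapfrog_identity _ hk; rewrite -cn_gt0 in li.
    apply/eqP; rewrite -subr_eq0; apply/eqP; rewrite /= rmorphM !fmorphV rmorph_nat rmorph1.
    transitivity (- 4^-1 * (kap C 2 w * (1 - w) * (1 + w) - C%:C * w * (1 + kap C 2 w) * (1 - kap C 2 w))).
      by field.
    by rewrite li// subrr mulr0.
  have q01 : 0 < (7 / 8 : R) < 1 by lra.
  have hX w : cn w = r -> cn (den C 2 X w) <= 7 / 8.
    move=> wr; have w01 : 0 < cn w < 1 by rewrite wr.
    by have := extr1_contraction hC C0 w01; rewrite /= rmorph1.
  have := @contraction_bound R _ _ r (7/8) N (Y h) _ (op_act X hC) r01 q01 hX e.
  move/le_trans; apply; rewrite mulrAC ler_wpM2r ?invr_ge0 ?sqr_ge0//.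
  apply: (op_bound N g (op_act G hC) r01) => // w wr.
  have w01 : 0 < cn w < 1 by rewrite wr. have /andP[w0 w1] := w01.
  have [_ kw _ _] := kapP hC w01.
  have [_ /andP[C1 _]] := admissible_C hC.
  have h1 : cn (1 + w) <= 2 by rewrite (le_trans (cnD _ _))// cn1; lra.
  have h2 : cn (1 + kap C 2 w) <= 2 by rewrite (le_trans (cnD _ _))// cn1; lra.
  rewrite /= rmorph1 cnM cn_real ger0_norm ?invr_ge0// mulrC ler_pdivrMr//.
  rewrite (le_trans (cnD _ _))// !cnM cn_real.
  have h3 : `|C / 2| <= 1 by rewrite ler_norml; lra.
  have h4 : cn w * cn (1 + kap C 2 w) <= 1 * 2 by rewrite ler_pM ?cn_ge0// ltW.
  have : `|C / 2| * (cn w * cn (1 + kap C 2 w)) <= 1 * (1 * 2).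
    by rewrite ler_pM// mulr_ge0 ?cn_ge0.
  by lra.
have g01 := gap01 hC; have /andP[g0 g1] := g01.
set B1 := 2 ^+ 2 / _ in hY.
have hd r N u : 0 < r < 1 -> nrm r N (delay u) <= nrm r N u.
  move=> r01; have := @op_bound R _ _ r 1 N u (op_delay R) r01 ler01.
  by rewrite expr1n mul1r; apply => w ->; case/andP: r01 => _ /ltW.
exists (2 * (B1 + 1) / (1 - gap C 2) ^+ 2) => r N g j r01; set h := hsrc _ _ _ _.
pose V n := F1 C 2 j (Y h) n - F1 C 2 j (delay g) n.
pose D : sym R := Smul (Smul (Sc (cd C 2)) Sk) Sw.
have e n : F1 C 2 j h n + F2 C 2 j h n =
  act C 2 D (fun n => F1 C 2 j h n + F2 C 2 j h n) n + V n.
  have o1 := op_comp (op_sub (op_id R) (op_act D hC)) (op_mom1 j hC).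
  have o2 := op_sub (op_comp (op_F1 j hC) oY)
    (op_comp (op_F1 j hC) (op_comp (op_delay R) oT)).
  have := op_ext o1 (op_eqT _ o2) h n; rewrite -gT -/(V n) => <-.
    by rewrite [RHS]addrC subrK.
  move=> w w01; rewrite eT//; have nz := dkw_neq1 hC w01.
  have e1 : (2 - 1 : R)%:C = 1 :> R[i] by rewrite -(rmorph1 (real_complex R)); congr (_%:C); lra.
  by rewrite /= e1; field.
have hD w : cn w = r -> cn (den C 2 D w) <= gap C 2 by move=> wr; apply: kap_gap => //; rewrite wr.
have := @contraction_bound R _ _ r _ N _ _ (op_act D hC) r01 g01 hD e.
move/le_trans; apply.
have hV : nrm r N V <= 2 * (B1 + 1) * r ^+ j ^+ 2 * nrm r N g.
  apply: le_trans (nrmD _ _ _ _) _.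
  have -> : nrm r N (fun n => - F1 C 2 j (delay g) n) = nrm r N (F1 C 2 j (delay g)).
    by apply: eq_bigr => n _; rewrite mulrN sqrrN.
  have b1 := F1_bound N j (Y h) hC r01; have b2 := F1_bound N j (delay g) hC r01.
  have b3 := hY r N g r01; have b4 := hd r N g r01.
  have r0 : 0 <= r ^+ j ^+ 2 by rewrite sqr_ge0.
  have b5 := ler_wpM2l r0 b3; have b6 := ler_wpM2l r0 b4.
  rewrite -/h in b5; lra.
have := ler_wpM2r (_ : 0 <= ((1 - gap C 2) ^+ 2)^-1) hV.
by rewrite invr_ge0 sqr_ge0 => /(_ isT)/le_trans; apply; rewrite le_eqVlt; apply/orP; left; apply/eqP; ring.
Qed.

End ConservativeOutflow.

(** * C = -1/2: stable special cases *)

Section SpecialParameters.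
Variable R : realType.
Implicit Types (C s lam r q x y : R) (w k u v : R[i]) (h g : nat -> R) (b : bcond R).

(** The triangle inequality alone gives 4, and the symbols to be bounded carry the factor 1/4.
    Opposite signs of the real parts lower this to 13/4: according to the sign of [Re v], [1 + 2 v]
    or [2 + u] has modulus at most 9/4. *)
Lemma half_plane_bound u v : cn u <= 1 -> cn v <= 1 -> Re u * Re v <= 0 ->
  cn (u * (2%:R * v + 1 + u * v)) <= 13 / 4.
Proof.
have aux (t : R[i]) : cn t <= 1 -> Re t <= 0 -> cn (1 + 2%:R * t) <= 9 / 4 /\ cn (2%:R + t) <= 9 / 4.
  move=> t1 t0; have t2 : cn t ^+ 2 <= 1 by rewrite expr_le1 ?cn_ge0.
  have e2 : (2%:R : R[i]) = 2%:R%:C by rewrite rmorph_nat.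
  rewrite !e2.
  have h0 : 0 <= 9 / 4 :> R by lra.
  by split; rewrite -ler_sqr ?nnegrE ?cn_ge0//;
    move: t2 t0; rewrite !cn_sqr; case: t {t1} => a b /=; rewrite ?mul0r ?subr0 ?addr0 => ? ?; lra.
move=> u1 v1 uv; have uv1 : cn u * cn v <= 1 by rewrite mulr_ile1 ?cn_ge0.
case: (lerP (Re v) 0) => hv.
  have [h _] := aux v v1 hv.
  have -> : u * (2%:R * v + 1 + u * v) = u * (1 + 2%:R * v) + u * (u * v) by ring.
  rewrite (le_trans (cnD _ _))// !cnM.
  have : cn u * cn (1 + 2%:R * v) <= 1 * (9 / 4) by rewrite ler_pM ?cn_ge0.
  have : cn u * (cn u * cn v) <= 1 * 1 by rewrite ler_pM ?mulr_ge0 ?cn_ge0.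
  lra.
have hu : Re u <= 0 by rewrite -(pmulr_lle0 _ hv).
have [_ h] := aux u u1 hu.
have -> : u * (2%:R * v + 1 + u * v) = u + u * v * (2%:R + u) by ring.
rewrite (le_trans (cnD _ _))// !cnM.
have : cn u * cn v * cn (2%:R + u) <= 1 * (9 / 4) by rewrite ler_pM ?mulr_ge0 ?cn_ge0.
lra.
Qed.

Notation C0 := (- (1 / 2) : R).

Lemma adm32 : admissible C0 (3 / 2).
Proof. by left; split; [lra|rewrite normrN ger0_norm; lra]. Qed.

Lemma adm2 : admissible C0 2.
Proof. by right; split=> //; rewrite normrN ger0_norm; lra. Qed.

Lemma coef32 : [/\ cd C0 (3 / 2) = 5 / 8, cc C0 (3 / 2) = 9 / 8, ca C0 (3 / 2) = - (1 / 8),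
  (1 + C0) / 2 = 1 / 4 & (3 / 2 - 1 : R) = 1 / 2].
Proof. by split; rewrite /cd /cc /ca; lra. Qed.

Lemma coef2 : [/\ cd C0 2 = 1 / 2, cc C0 2 = 3 / 2, ca C0 2 = - (1 / 2),
  (1 + C0) / 2 = 1 / 4 & (2 - 1 : R) = 1].
Proof. by split; rewrite /cd /cc /ca; lra. Qed.

Definition crat := (rmorphM, rmorphD, rmorphN, fmorphV, rmorph_nat, rmorph1).

Lemma kap32 w : 0 < cn w < 1 -> cn (kap C0 (3 / 2) w) <= 1 / 5.
Proof.
move=> /[dup] w01 /andP[w0 w1]; have C0lt : C0 < 0 by lra.
have [d e a _ _] := coef32; have [_ _ _ /(_ C0lt)] := kapP adm32 w01.
rewrite d a normrN !ger0_norm; lra.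
Qed.

Variables (lam : R) (lam0 : 0 < lam).

Lemma extreq1_32 : lab_SS lam C0 (3 / 2) (bc_extreq C0 1).
Proof.
have [d c a p s1] := coef32.
apply: (@SS_of_symbol _ lam C0 (3 / 2) _
  (Sadd (Smul (Sc (5/8)) (Smul Sk Sw))
    (Sadd (Smul (Sc (1/4)) Sw) (Smul (Sc (1/8)) (Smul Sw (Smul Sk Sw))))) (9/10) lam0 adm32).
- by lra.
- move=> w /[dup] w01 /andP[w0 w1]; have [hk _ _ _] := kapP adm32 w01.
  rewrite Nsym_extreq1_bulk//; last by rewrite -cn_gt0.
  by rewrite d p s1 /= !crat; field.
move=> w /[dup] w01 /andP[w0 w1]; have k5 := kap32 w01; rewrite /=.
rewrite (le_trans (cnD _ _))//.
have : cn ((1 / 4)%:C * w + (1 / 8)%:C * (w * (kap C0 (3 / 2) w * w))) <=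
  cn ((1 / 4)%:C * w) + cn ((1 / 8)%:C * (w * (kap C0 (3 / 2) w * w))) by exact: cnD.
rewrite !cnM !cn_real !ger0_norm; try lra.
set K := cn (kap _ _ _) in k5 *; set W := cn w in w0 w1 *.
have K0 : 0 <= K by exact: cn_ge0.
have KW : K * W <= 1 / 5 * 1 by rewrite ler_pM// ltW.
have WKW : W * (K * W) <= 1 * (1 / 5 * 1) by rewrite ler_pM// ?mulr_ge0 ?(ltW w0) ?(ltW w1).
lra.
Qed.

Lemma extreq3_32 : lab_SS lam C0 (3 / 2) (bc_extreq C0 3).
Proof.
have [d c a p s1] := coef32.
pose P : sym R := Smul Sk Sw.
apply: (@SS_of_symbol _ lam C0 (3 / 2) _
  (Sadd (Smul (Sc (3/4)) Sw) (Sadd (Smul (Sc (-(1/8))) P) (Sadd (Smul (Sc (1/4)) (Smul Sk P))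
   (Sadd (Smul (Sc (3/8)) (Smul Sw P)) (Sadd (Smul (Sc (-(3/8))) (Smul P P))
      (Smul (Sc (1/8)) (Smul Sk (Smul P P)))))))) (9/10) lam0 adm32).
- by lra.
- move=> w /[dup] w01 /andP[w0 w1]; have [hk _ _ _] := kapP adm32 w01.
  rewrite Nsym_extreq3_bulk//; last by rewrite -cn_gt0.
  by rewrite d p s1 /= !crat; field.
move=> w /[dup] w01 /andP[w0 w1]; have k5 := kap32 w01; rewrite /=.
set k := kap _ _ _ in k5 *.
(* With [|k| <= 1/5] and [|w| <= 1] the moduli of the six terms sum to at most 0.876. *)
do 5! (apply: le_trans (cnD _ _) _; rewrite -lerBrDl).
rewrite !cnM !cn_real !normrN !ger0_norm; try lra.
set K := cn k in k5 *; set W := cn w in w0 w1 *.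
have K0 : 0 <= K by exact: cn_ge0.
have W0 := ltW w0; have W1 := ltW w1; have KW0 : 0 <= K * W by rewrite mulr_ge0.
have KW : K * W <= 1 / 5 by rewrite -[leRHS]mulr1 ler_pM.
have h1 : K * (K * W) <= 1 / 5 * (1 / 5) by rewrite ler_pM.
have h2 : W * (K * W) <= 1 * (1 / 5) by rewrite ler_pM.
have h3 : K * W * (K * W) <= 1 / 5 * (1 / 5) by rewrite ler_pM.
have h4 : K * (K * W * (K * W)) <= 1 / 5 * (1 / 5 * (1 / 5)) by rewrite ler_pM// mulr_ge0.
lra.
Qed.

Lemma future_32 : lab_SS lam C0 (3 / 2) (bc_future C0).
Proof.
have [d c a p s1] := coef32.
apply: (@SS_of_symbol _ lam C0 (3 / 2) _
  (Sadd (Smul (Sc (5/8)) (Smul Sk Sw))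
    (Sadd (Smul (Sc (1/4)) Sk) (Smul (Sc (1/8)) (Smul Sk (Smul Sk Sw))))) (9/10) lam0 adm32).
- by lra.
- move=> w /[dup] w01 /andP[w0 w1].
  by rewrite Nsym_future d p s1 /= !crat; field.
move=> w /[dup] w01 /andP[w0 w1]; have k5 := kap32 w01; rewrite /=.
set k := kap _ _ _ in k5 *.
do 2! (apply: le_trans (cnD _ _) _; rewrite -lerBrDl).
rewrite !cnM !cn_real !ger0_norm; try lra.
set K := cn k in k5 *; set W := cn w in w0 w1 *.
have K0 : 0 <= K by exact: cn_ge0.
have W0 := ltW w0; have W1 := ltW w1; have KW0 : 0 <= K * W by rewrite mulr_ge0.
have KW : K * W <= 1 / 5 by rewrite -[leRHS]mulr1 ler_pM.
have h1 : K * (K * W) <= 1 / 5 * (1 / 5) by rewrite ler_pM.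
lra.
Qed.

Lemma sign2 w : 0 < cn w < 1 -> Re w * Re (kap C0 2 w) <= 0.
Proof. by move=> w01; have := kap_sign adm2 erefl w01; lra. Qed.

Lemma extreq1_2 : lab_SS lam C0 2 (bc_extreq C0 1).
Proof.
have [d c a p s1] := coef2.
apply: (@SS_of_symbol _ lam C0 2 _ (Smul (Sc (1/4)) (Smul Sw
   (Sadd (Sadd (Smul (Sc 2) Sk) (Sc 1)) (Smul Sw Sk)))) (9/10) lam0 adm2).
- by lra.
- move=> w /[dup] w01 /andP[w0 w1]; have [hk _ _ _] := kapP adm2 w01.
  rewrite Nsym_extreq1_bulk//; last by rewrite -cn_gt0.
  by rewrite d p s1 /= !crat; field.
move=> w /[dup] w01 /andP[w0 w1]; have [_ kw _ _] := kapP adm2 w01.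
have := half_plane_bound (ltW w1) (le_trans kw (ltW w1)) (sign2 w01).
by move=> hb; rewrite /= cnM cn_real !crat ger0_norm; lra.
Qed.

Lemma future_2 : lab_SS lam C0 2 (bc_future C0).
Proof.
have [d c a p s1] := coef2.
apply: (@SS_of_symbol _ lam C0 2 _ (Smul (Sc (1/4)) (Smul Sk
   (Sadd (Sadd (Smul (Sc 2) Sw) (Sc 1)) (Smul Sk Sw)))) (9/10) lam0 adm2).
- by lra.
- move=> w /[dup] w01 /andP[w0 w1].
  by rewrite Nsym_future d p s1 /= !crat; field.
move=> w /[dup] w01 /andP[w0 w1]; have [_ kw _ _] := kapP adm2 w01.
have sg : Re (kap C0 2 w) * Re w <= 0 by rewrite mulrC sign2.
have := half_plane_bound (le_trans kw (ltW w1)) (ltW w1) sg.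
by move=> hb; rewrite /= cnM cn_real !crat ger0_norm; lra.
Qed.

End SpecialParameters.

(** * Instability criteria *)

Section Instability.
Variable R : realType.
Implicit Types (C s lam r q x y t : R) (w k l : R[i]) (h g u : nat -> R) (b : bcond R).

Lemma estimate_le lam C s b (q q' : (nat -> R) -> nat -> nat -> R) : 0 < lam ->
  (forall g n j, 0 <= q' g n j <= q g n j) -> estimate lam C s b q -> estimate lam C s b q'.
Proof.
move=> lam0 hq [K [K0 hK]]; exists K; split=> // alpha a0 g dx dx0.
have := hK alpha a0 g dx dx0; cbv zeta; apply: le_trans.
have dt0 : 0 < dx / lam by rewrite divr_gt0.
apply: lee_wpmul2l.
  by rewrite lee_fin divr_ge0 ?(ltW a0)// addr_ge0// mulr_ge0// ltW.
have c0 n : 0 <= dx / lam * dx * expR (- (2 * alpha * n%:R * (dx / lam))).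
  by rewrite mulr_ge0 ?expR_ge0// mulr_ge0// ltW.
apply: lee_nneseries => [n _ _|n _].
  by apply: nneseries_ge0 => j _ _; rewrite lee_fin mulr_ge0//; case/andP: (hq g n j).
apply: lee_nneseries => [j _ _|j _]; rewrite lee_fin.
  by rewrite mulr_ge0//; case/andP: (hq g n j).
by rewrite ler_wpM2l//; case/andP: (hq g n j).
Qed.

Lemma SS_SSOO lam C s b : 0 < lam -> SS_est lam C s b -> SSOO_est lam C s b.
Proof.
move=> lam0; apply: estimate_le => // g n j.
by rewrite sqr_ge0 lerDl sqr_ge0.
Qed.

(** Choosing dx = lam gives dt = 1, and a single cell is kept on the left. For bounded sources the
    right side is at most a geometric series. *)
Lemma estimate_elim lam C s b (q : (nat -> R) -> nat -> nat -> R) : 0 < lam ->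
  (forall g n j, 0 <= q g n j) -> estimate lam C s b q ->
  exists2 K, 0 < K & forall x, 0 < x -> forall g, (forall n, `|g n| <= 1) -> forall N j,
    \sum_(n < N) (expR (- x) ^+ n) ^+ 2 * q g n j <=
    K * ((1 + x) / x) / (1 - expR (- x) ^+ 2).
Proof.
move=> lam0 q0 [K [K0 hK]]; exists (K / lam); first by rewrite divr_gt0.
move=> x x0 g g1 N j.
have [r01 _] := decay_rate x0; have /andP[r0 r1] := r01.
have := hK x x0 g lam lam0; cbv zeta; rewrite divff ?gt_eqF// mulr1.
under eq_eseriesr do under eq_eseriesr do rewrite weight_exp mulr1 mul1r.
under [X in (_ <= _ * X)%E]eq_eseriesr do rewrite weight_exp mulr1 mul1r.
set r := expR (- x) in r01 r0 r1 *.
have r20 : 0 <= r ^+ 2 by rewrite sqr_ge0.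
have r21 : 0 < 1 - r ^+ 2 by rewrite subr_gt0 expr_lt1// ltW.
have a0 n i : 0 <= lam * r ^+ n ^+ 2 * q g n i by rewrite mulr_ge0// mulr_ge0 ?sqr_ge0// ltW.
have low : ((\sum_(0 <= n < N) lam * r ^+ n ^+ 2 * q g n j)%:E <=
   \sum_(n <oo) \sum_(i <oo) (lam * r ^+ n ^+ 2 * q g n i)%:E)%E.
  rewrite -sumEFin; apply: (@le_trans _ _
    (\sum_(0 <= n < N) \sum_(i <oo) (lam * r ^+ n ^+ 2 * q g n i)%:E)%E).
    apply: lee_sum => n _; apply: (@le_trans _ _ (\sum_(0 <= i < j.+1) (lam * r ^+ n ^+ 2 * q g n i)%:E)%E).
      by rewrite sumEFin lee_fin big_nat_recr//= lerDr sumr_ge0.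
    by apply: nneseries_lim_ge => i _ _; rewrite lee_fin.
  by apply: nneseries_lim_ge => n _ _; apply: nneseries_ge0 => i _ _; rewrite lee_fin.
have up : (\sum_(n <oo) (r ^+ n ^+ 2 * g n ^+ 2)%:E <= ((1 - r ^+ 2)^-1)%:E)%E.
  apply: lime_le.
    by apply: is_cvg_nneseries => n _ _; rewrite lee_fin mulr_ge0 ?sqr_ge0.
  apply: nearW => M; rewrite sumEFin lee_fin big_mkord.
  rewrite -[leRHS]mul1r ler_pdivlMr//.
  apply: (@le_trans _ _ ((\sum_(n < M) (r ^+ 2) ^+ n) * (1 - r ^+ 2))).
    rewrite ler_wpM2r ?(ltW r21)//; apply: ler_sum => n _; rewrite -!exprM mulnC.
    rewrite ler_piMr ?exprn_ge0 ?(ltW r0)// -(real_normK (num_real (g n))).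
    by rewrite expr_le1.
  by rewrite geo_sum gerBl exprn_ge0.
have p1 : 0 < 1 + x by rewrite addr_gt0.
move=> h.
have : ((x / (1 + x))%:E * (\sum_(0 <= n < N) lam * r ^+ n ^+ 2 * q g n j)%:E <=
  K%:E * ((1 - r ^+ 2)^-1)%:E)%E.
  apply: le_trans (le_trans h _).
    by apply: lee_wpmul2l => //; rewrite lee_fin divr_ge0 ?ltW.
  by apply: lee_wpmul2l => //; rewrite lee_fin ltW.
rewrite -!EFinM lee_fin big_mkord.
have -> : \sum_(i < N) lam * r ^+ i ^+ 2 * q g i j = lam * \sum_(i < N) r ^+ i ^+ 2 * q g i j.
  by rewrite mulr_sumr; apply: eq_bigr => i _; rewrite mulrA.
set S := \sum_(i < N) _ => hS.
have -> : K / lam * ((1 + x) / x) / (1 - r ^+ 2) = (K / (1 - r ^+ 2)) / (x / (1 + x) * lam).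
  by field; rewrite ?gt_eqF.
rewrite ler_pdivlMr; last by apply: mulr_gt0 => //; exact: divr_gt0.
by apply: le_trans hS; rewrite le_eqVlt; apply/orP; left; apply/eqP; ring.
Qed.

Lemma bernoulli y n : 1 <= y -> 1 + n%:R * (y - 1) <= y ^+ n.
Proof.
move=> y1; elim: n => [|n ih]; first by rewrite mul0r addr0 expr0.
rewrite exprS; apply: (@le_trans _ _ (y * (1 + n%:R * (y - 1)))); last first.
  by rewrite ler_wpM2l// (le_trans ler01).
rewrite -subr_ge0 -natr1.
have -> : y * (1 + n%:R * (y - 1)) - (1 + (n%:R + 1) * (y - 1)) = n%:R * (y - 1) ^+ 2 by ring.
by rewrite mulr_ge0 ?sqr_ge0.
Qed.

(* The bulk recursion recovers f2, hence the whole solution, from m1. *)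
Lemma sol2_growth C s b g M y : 0 <= s <= 2 -> 1 <= y -> 0 <= M ->
  (forall n j, `|mom1 C s b g n j| <= M * y ^+ n) ->
  forall n j, `|(sol C s b g n).2 j| <= `|cc C s| * M * n%:R * y ^+ n.
Proof.
move=> /andP[s0 s2] y1 M0 hM; elim=> [|n ih] j; first by rewrite /= normr0 mulr0 mul0r.
have -> : (sol C s b g n.+1).2 j =
   cc C s * mom1 C s b g n j.+1 + (1 - s) * (sol C s b g n).2 j.+1.
  rewrite sol2S /mom1.
  have -> : 1 - s = cd C s - cc C s by rewrite -(opprB s) -(cc_sub_cd C s) opprB.
  by ring.
rewrite (le_trans (ler_normD _ _))// (normrM (cc C s)) (normrM (1 - s)).
have s1 : `|1 - s| <= 1 by rewrite ler_norml; lra.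
have h1 : `|cc C s| * `|mom1 C s b g n j.+1| <= `|cc C s| * (M * y ^+ n) by rewrite ler_wpM2l.
have h2 : `|1 - s| * `|(sol C s b g n).2 j.+1| <= 1 * (`|cc C s| * M * n%:R * y ^+ n) by rewrite ler_pM.
apply: le_trans (lerD h1 h2) _.
have -> : `|cc C s| * (M * y ^+ n) + 1 * (`|cc C s| * M * n%:R * y ^+ n) =
  `|cc C s| * M * n.+1%:R * y ^+ n by rewrite -natr1; ring.
rewrite ler_wpM2l ?mulr_ge0//; apply: ler_weXn2l => //.
Qed.

(** The ghost value is f1 at cell 0 one step later, that is [m1 - f2]. The estimate bounds m1 by a
    multiple of [Y^n], f2 grows at most like [n Y^n], and [Y = sqrt y] leaves a second factor [Y^n]
    to absorb n. *)
Lemma hsrc_tame lam C s b g : 0 < lam -> 0 <= s <= 2 -> SSOO_est lam C s b ->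
  (forall n, `|g n| <= 1) -> tame (hsrc C s b g).
Proof.
move=> lam0 hs est g1 y y1.
have q0 (g' : nat -> R) n j : 0 <= mom1 C s b g' n j ^+ 2 by exact: sqr_ge0.
have [K K0 hK] := @estimate_elim lam C s b _ lam0 q0 est.
have y0 : 0 < y by exact: lt_trans y1.
pose x := ln y / 2; have lny : 0 < ln y by rewrite ln_gt0.
have x0 : 0 < x by rewrite divr_gt0.
pose Y := expR x; have Y1 : 1 < Y by rewrite -expR0 ltr_expR.
have Y0 : 0 < Y by exact: lt_trans Y1.
have Y2 : Y ^+ 2 = y.
  by rewrite /Y -expRM_natl /x -{2}(lnK y0); congr expR; field.
have rY : expR (- x) = Y^-1 by rewrite expRN.
have [r01 _] := decay_rate x0.
have r21 : 0 < 1 - expR (- x) ^+ 2.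
  by case/andP: r01 => r0 r1; rewrite subr_gt0 expr_lt1// ltW.
pose M := K * ((1 + x) / x) / (1 - expR (- x) ^+ 2).
have M0 : 0 <= M.
  apply: divr_ge0; last exact: ltW.
  by apply: mulr_ge0; [exact: ltW|apply: divr_ge0; lra].
have hm n j : `|mom1 C s b g n j| <= (1 + M) * Y ^+ n.
  have Yn : 0 < Y ^+ n by rewrite exprn_gt0.
  rewrite -ler_pdivrMr// -[Y ^+ n in leLHS](gtr0_norm Yn) -normf_div; apply: norm_sqr_bound => //.
  apply: le_trans (hK x x0 g g1 n.+1 j); rewrite big_ord_recr/= rY.
  apply: (@le_trans _ _ (Y^-1 ^+ n ^+ 2 * mom1 C s b g n j ^+ 2)).
    by rewrite exprMn mulrC exprVn.
  by rewrite lerDr sumr_ge0// => i _; rewrite mulr_ge0// sqr_ge0.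
have M10 : 0 <= 1 + M by rewrite addr_ge0.
have h2 := sol2_growth hs (ltW Y1) M10 hm.
exists ((1 + M) * (1 + `|cc C s| / (Y - 1)) * y) => n.
have -> : hsrc C s b g n = mom1 C s b g n.+1 0 - (sol C s b g n.+1).2 0%N.
  by rewrite /mom1 addrK.
apply: le_trans (ler_normB _ _) _; apply: le_trans (lerD (hm _ _) (h2 _ _)) _.
have Y10 : 0 < Y - 1 by rewrite subr_gt0.
have hn : n.+1%:R <= Y ^+ n.+1 / (Y - 1).
  rewrite ler_pdivlMr//; have := bernoulli n.+1 (ltW Y1); lra.
have Yn : 1 <= Y ^+ n.+1 by rewrite exprn_ege1// ltW.
have -> : (1 + M) * (1 + `|cc C s| / (Y - 1)) * y * y ^+ n =
  (1 + M) * Y ^+ n.+1 * Y ^+ n.+1 + `|cc C s| * (1 + M) * (Y ^+ n.+1 / (Y - 1)) * Y ^+ n.+1.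
  by rewrite -mulrA -exprS -Y2 -exprM mulnC exprM; ring.
apply: lerD.
  by rewrite -[leLHS]mulr1 ler_pM// mulr_ge0// exprn_ge0// ltW.
rewrite ler_wpM2r ?exprn_ge0 ?(ltW Y0)// ler_wpM2l// mulr_ge0//.
Qed.

Lemma hsrc_hat C s b g w l : admissible C s -> 0 < cn w < 1 -> tame (hsrc C s b g) ->
  is_hat g w l -> exists2 lh, is_hat (hsrc C s b g) w lh & (1 - Tsym C s b w) * lh = l.
Proof.
move=> hCs w01 th hg.
have [lh hlh] : exists lh, is_hat (hsrc C s b g) w lh.
  by apply: tame_is_hat => //; case/andP: w01.
exists lh => //; apply: (is_hat_unique _ hg).
have [_ _ o3] := op_sub (op_id R) (op_bop b hCs).
apply: eq_is_hat (o3 _ _ _ th w01 hlh) => n.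
by rewrite -ghost_defect.
Qed.

Lemma stable_root_kap C s z k : admissible C s -> 1 < cn z -> kchar C s z^-1 k -> cn k < 1 ->
  0 < cn z^-1 < 1 /\ k = kap C s z^-1.
Proof.
move=> hCs z1 hk k1; have w01 : 0 < cn z^-1 < 1.
  by rewrite cnV invr_gt0 (lt_trans ltr01 z1) invf_lt1// (lt_trans ltr01).
by split=> //; exact: kap_unique.
Qed.

(** The impulse has transform 1, whereas the transform of [h - bop h] would vanish at w. *)
Lemma GR_not_SSOO lam C s b w : 0 < lam -> admissible C s -> 0 < cn w < 1 ->
  Nsym C s b w (kap C s w) = 0 -> ~ SSOO_est lam C s b.
Proof.
move=> lam0 hCs w01 hN est.
pose g n : R := if n == 0%N then 1 else 0.
have g1 n : `|g n| <= 1 by rewrite /g; case: ifP; rewrite ?normr1 ?normr0.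
have hs : 0 <= s <= 2 by have /andP[? ?] := admissible_s hCs; lra.
have th := hsrc_tame lam0 hs est g1.
have hg : is_hat g w 1.
  have -> : 1 = psum g w 1 by rewrite /psum big_ord1 /g eqxx mul1r expr0.
  by apply: is_hat_fin => -[].
have [lh _ e] := hsrc_hat hCs w01 th hg.
have nz := dkw_neq1 hCs w01.
move: hN; rewrite -NsymE// => /eqP; rewrite mulf_eq0 (negbTE nz)/= => /eqP T0.
by move: e; rewrite T0 mul0r => /esym/eqP; rewrite oner_eq0.
Qed.

Lemma cauchy_schwarz (N : nat) (u v : nat -> R) (A B : R) : 0 <= B ->
  \sum_(n < N) u n ^+ 2 <= A -> \sum_(n < N) v n ^+ 2 <= B ->
  (\sum_(n < N) u n * v n) ^+ 2 <= A * B.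
Proof.
move=> B0 hA hB; set S := \sum_(n < N) u n * v n.
have A0 : 0 <= A by apply: le_trans hA; apply: sumr_ge0 => i _; exact: sqr_ge0.
have key (a c : R) : 0 <= a ^+ 2 * A - 2 * a * c * S + c ^+ 2 * B.
  apply: (@le_trans _ _ (\sum_(n < N) (a * u n - c * v n) ^+ 2)).
    by apply: sumr_ge0 => i _; exact: sqr_ge0.
  have -> : \sum_(n < N) (a * u n - c * v n) ^+ 2 =
    a ^+ 2 * \sum_(n < N) u n ^+ 2 - 2 * a * c * S + c ^+ 2 * \sum_(n < N) v n ^+ 2.
    rewrite /S !mulr_sumr -sumrN -!big_split; apply: eq_bigr => i _ /=; ring.
  by apply: lerD; [apply: lerD => //|]; rewrite ler_wpM2l ?sqr_ge0.
move: B0; rewrite le_eqVlt => /orP[/eqP B0|B0]; last first.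
  have := key B S; have -> : B ^+ 2 * A - 2 * B * S * S + S ^+ 2 * B = B * (A * B - S ^+ 2) by ring.
  by rewrite pmulr_rge0// subr_ge0.
have : forall n : 'I_N, v n = 0.
  move=> n; apply/eqP; rewrite -sqrf_eq0 eq_le sqr_ge0 andbT.
  have : v n ^+ 2 <= B.
    apply: le_trans hB; rewrite (bigD1 n)//= lerDl sumr_ge0// => i _; exact: sqr_ge0.
  by rewrite -B0.
move=> v0; rewrite /S big1 ?expr0n/= -?B0 ?mulr0// => n _; by rewrite v0 mulr0.
Qed.

Lemma hat_sqr_bound u w l Q : 0 <= Q -> (forall N, cn (psum u w N) ^+ 2 <= Q) ->
  is_hat u w l -> cn l ^+ 2 <= Q.
Proof.
move=> Q0 hQ /is_hatP hl.
rewrite -[leRHS]sqr_sqrtr// ler_sqr ?nnegrE ?cn_ge0 ?sqrtr_ge0//.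
apply/ler_addgt0Pr => e /hl[N _ hN].
have -> : l = psum u w N + (l - psum u w N) by rewrite addrC subrK.
rewrite (le_trans (cnD _ _))// lerD//; last by rewrite ltW// hN//=.
by rewrite -ler_sqr ?nnegrE ?cn_ge0 ?sqrtr_ge0// sqr_sqrtr.
Qed.

(** At [w = sg t] the source [sg^n] has transform [1 / (1 - t)]. The hypothesis on the determinant
    makes the transform of the observed quantity at least of order [(1 - t)^-2], while the estimate
    and Cauchy-Schwarz allow only [(1 - t)^(-3/2)]. *)
Lemma unstable_criterion lam C s b (q : (nat -> R) -> nat -> nat -> R)
  (A : (nat -> R) -> nat -> R) (mu : R[i] -> R[i]) (sg L : R) :
  0 < lam -> admissible C s -> `|sg| = 1 -> 0 <= L ->
  (forall g n j, mom1 C s b g n j ^+ 2 <= q g n j) ->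
  (forall g n, A (hsrc C s b g) n ^+ 2 <= q g n 0%N) ->
  is_op A (fun w => w * (mu w / (1 - (cd C s)%:C * kap C s w * w))) ->
  (forall t, 1/2 < t < 1 -> mu (sg * t)%:C != 0 /\
     cn (Nsym C s b (sg * t)%:C (kap C s (sg * t)%:C)) <= L * (1 - t) * cn (mu (sg * t)%:C)) ->
  ~ estimate lam C s b q.
Proof.
move=> lam0 hCs sg1 L0 hq1 hq2 oA hN est.
have q0 g n j : 0 <= q g n j by apply: le_trans (hq1 g n j); exact: sqr_ge0.
have est1 : SSOO_est lam C s b.
  by apply: estimate_le est => // g n j; rewrite sqr_ge0 hq1.
have hs : 0 <= s <= 2 by have /andP[? ?] := admissible_s hCs; lra.
have [K K0 hK] := @estimate_elim lam C s b _ lam0 q0 est.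
have sg2 : sg * sg = 1 by rewrite -expr2 -(real_normK (num_real sg)) sg1 expr1n.
pose g n := sg ^+ n.
have g1 n : `|g n| <= 1 by rewrite normrX sg1 expr1n.
have th := hsrc_tame lam0 hs est1 g1.
(* Large enough for [1 - 4 x <= 8 K L^2 x], the inequality reached at the end, to fail at
   [x = 1 / D]; moreover [D >= 8] gives t > 1/2. *)
pose D := 8 * (1 + K * L ^+ 2 * 4).
have D8 : 8 <= D.
  have : 0 <= K * L ^+ 2 * 4 by rewrite mulr_ge0// mulr_ge0 ?sqr_ge0// ltW.
  by rewrite /D; lra.
have D0 : 0 < D by lra.
pose x := D^-1; have x0 : 0 < x by rewrite invr_gt0.
have x8 : x <= 1 / 8 by rewrite /x -[leRHS]mulrC mulr1 lef_pV2 ?posrE.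
have [r01 _] := decay_rate x0; set r := expR (- x) in r01.
have /andP[r0 r1] := r01.
(* [t = r^2] lets Cauchy-Schwarz split [t^n] into [r^n r^n], one factor going with the solution. *)
pose t := r ^+ 2.
have t1 : t < 1 by rewrite expr_lt1// ltW.
have tx : 1 - 2 * x <= t.
  by rewrite /t /r -expRM_natl mulrN; have := expR_ge1Dx (- (2 * x)); lra.
have t12 : 1/2 < t < 1 by rewrite t1 andbT; lra.
have t0 : 0 < t by lra.
pose w : R[i] := (sg * t)%:C.
have cw : cn w = t by rewrite cn_real normrM sg1 mul1r gtr0_norm.
have w01 : 0 < cn w < 1 by rewrite cw t0.
have [mu0 hNt] := hN t t12; rewrite -/w in mu0 hNt.
have ot : 0 < 1 - t by rewrite subr_gt0.
have hg : is_hat g w ((1 - t)^-1)%:C.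
  apply/is_hatP => e e0.
  have eN N : cn ((1 - t)^-1%:C - psum g w N) = t ^+ N / (1 - t).
    have -> : psum g w N = ((1 - t ^+ N) / (1 - t))%:C.
      rewrite -geo_sum mulfK ?gt_eqF// rmorph_sum; apply: eq_bigr => i _.
      by rewrite /w -rmorphXn -rmorphM; congr (_%:C); rewrite /g exprMn mulrA -exprMn sg2 expr1n mul1r.
    rewrite -rmorphB cn_real.
    have -> : (1 - t)^-1 - (1 - t ^+ N) / (1 - t) = t ^+ N / (1 - t) by field; rewrite gt_eqF.
    by rewrite ger0_norm// divr_ge0 ?exprn_ge0// ltW.
  have tn : `|t| < 1 by rewrite gtr0_norm.
  have /cvgrPdist_lt/(_ e e0) := cvg0_mull (1 - t)^-1 (cvg_expr tn).
  apply: filterS => N; rewrite /= sub0r normrN eN ger0_norm 1?mulrC//.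
  by rewrite mulr_ge0 ?exprn_ge0 ?invr_ge0// ltW.
have [lh hlh e] := hsrc_hat hCs w01 th hg.
have [_ _ o3] := oA; have hA := o3 _ _ _ th w01 hlh.
pose M := K * ((1 + x) / x) / (1 - t).
have M0 : 0 <= M.
  apply: divr_ge0; last exact: ltW.
  by apply: mulr_ge0; [exact: ltW|apply: divr_ge0; lra].
have bound N : cn (psum (A (hsrc C s b g)) w N) ^+ 2 <= M * (1 - t)^-1.
  apply: (@le_trans _ _ ((\sum_(n < N) (r ^+ n * `|A (hsrc C s b g) n|) * r ^+ n) ^+ 2)).
    rewrite lerXn2r ?nnegrE ?cn_ge0//.
      by apply: sumr_ge0 => i _; rewrite !mulr_ge0// exprn_ge0// ltW.
    apply: le_trans (cn_sum _ _ _) _; apply: ler_sum => i _.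
    by rewrite cnM cn_real cnX cw /t -exprM mulnC exprM expr2; lra.
  apply: (@cauchy_schwarz N (fun n => r ^+ n * `|A (hsrc C s b g) n|) (fun n => r ^+ n)).
  - by rewrite invr_ge0 ltW.
  - apply: le_trans (hK x x0 g g1 N 0%N); apply: ler_sum => i _.
    by rewrite exprMn real_normK ?num_real// ler_wpM2l ?sqr_ge0.
  rewrite -[leRHS]mul1r ler_pdivlMr//.
  rewrite (eq_bigr (fun i : 'I_N => t ^+ i)); last by move=> i _; rewrite /t -!exprM mulnC.
  by rewrite geo_sum gerBl exprn_ge0// ltW.
have := hat_sqr_bound _ bound hA; rewrite mulr_ge0 ?invr_ge0 ?(ltW ot)// => /(_ isT) hb.
have nz := dkw_neq1 hCs w01; set dk := 1 - _ in nz hb.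
set N0 := cn (Nsym _ _ _ _ _) in hNt; set m0 := cn (mu w) in hNt.
have hN0 : N0 = cn dk * cn (1 - Tsym C s b w) by rewrite /N0 -NsymE// cnM.
have hlh1 : cn (1 - Tsym C s b w) * cn lh = (1 - t)^-1.
  by rewrite -cnM e cn_real gtr0_norm ?invr_gt0.
have m00 : 0 < m0 by rewrite cn_gt0.
have dk0 : 0 < cn dk by rewrite cn_gt0.
have main : t ^+ 2 * m0 ^+ 2 <= K * ((1 + x) / x) * N0 ^+ 2.
  move: hb; rewrite !cnM cnV cw -/m0 => hb.
  have e1 : t ^+ 2 * m0 ^+ 2 * (1 - t)^-1 ^+ 2 =
     (t * (m0 / cn dk) * cn lh) ^+ 2 * N0 ^+ 2.
    by rewrite -hlh1 hN0; field; rewrite gt_eqF.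
  rewrite -(@ler_pM2r _ ((1 - t)^-1 ^+ 2)) ?exprn_gt0 ?invr_gt0// e1.
  have -> : K * ((1 + x) / x) * N0 ^+ 2 * (1 - t)^-1 ^+ 2 = M / (1 - t) * N0 ^+ 2.
    by rewrite /M; ring.
  by rewrite ler_wpM2r ?sqr_ge0.
have N02 : N0 ^+ 2 <= (L * (2 * x)) ^+ 2 * m0 ^+ 2.
  rewrite -exprMn lerXn2r ?nnegrE ?cn_ge0//.
    by rewrite mulr_ge0 ?(ltW m00)// mulr_ge0// mulr_ge0// ltW.
  apply: le_trans hNt _; rewrite ler_wpM2r ?(ltW m00)// ler_wpM2l//; lra.
have fin : t ^+ 2 <= K * (1 + x) * (4 * L ^+ 2) * x.
  rewrite -(@ler_pM2r _ (m0 ^+ 2)) ?exprn_gt0//; apply: le_trans main _.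
  have c0 : 0 <= K * ((1 + x) / x) by apply: mulr_ge0; [exact: ltW|apply: divr_ge0; lra].
  apply: le_trans (ler_wpM2l c0 N02) _; rewrite le_eqVlt; apply/orP; left; apply/eqP.
  by field; rewrite gt_eqF.
have t2 : 1 - 4 * x <= t ^+ 2.
  have : (1 - 2 * x) ^+ 2 <= t ^+ 2 by rewrite lerXn2r ?nnegrE; lra.
  by have := sqr_ge0 x; lra.
have KL : 0 <= K * L ^+ 2 by rewrite mulr_ge0 ?sqr_ge0// ltW.
have xD : x * D = 1 by rewrite mulVf// gt_eqF.
have : K * (1 + x) * (4 * L ^+ 2) * x <= (K * L ^+ 2) * 8 * x.
  have -> : K * (1 + x) * (4 * L ^+ 2) * x = K * L ^+ 2 * (4 * (1 + x)) * x by ring.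
  by rewrite ler_wpM2r ?(ltW x0)// ler_wpM2l//; lra.
have : x * (8 * (1 + K * L ^+ 2 * 4)) = 1 by exact: xD.
have : 0 <= K * L ^+ 2 * x by rewrite mulr_ge0// ltW.
lra.
Qed.

Lemma not_SSOO lam C s b (sg L : R) :
  0 < lam -> admissible C s -> `|sg| = 1 -> 0 <= L ->
  (forall t, 1/2 < t < 1 ->
     cn (Nsym C s b (sg * t)%:C (kap C s (sg * t)%:C)) <=
     L * (1 - t) * cn (1 + (s - 1)%:C * kap C s (sg * t)%:C * (sg * t)%:C)) ->
  ~ SSOO_est lam C s b.
Proof.
move=> lam0 hCs sg1 L0 hN.
apply: (@unstable_criterion lam C s b _ (fun h n => F1 C s 0 h n + F2 C s 0 h n)
  (fun w => 1 + (s - 1)%:C * kap C s w * w) sg L) => //.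
- by move=> g n; rewrite /mom1 sol_kd.
- by apply: op_eqT (op_mom1 0 hCs) => w _; rewrite expr0 mulr1.
move=> t t12; split; last exact: hN.
have /andP[t2 t1] := t12.
have w01 : 0 < cn (sg * t)%:C < 1.
  by rewrite cn_real normrM sg1 mul1r gtr0_norm; lra.
have [_ kw _ _] := kapP hCs w01; have /andP[w0 w1] := w01.
have /andP[s0 s2] := admissible_s hCs.
apply/eqP => /eqP; rewrite addrC addr_eq0 => /eqP /(congr1 (@cn R)).
rewrite cnN cn1 !cnM cn_real => e.
have s1 : `|s - 1| <= 1 by rewrite ler_norml; lra.
have : `|s - 1| * cn (kap C s (sg * t)%:C) * cn (sg * t)%:C <= 1 * 1 * cn (sg * t)%:C.
  rewrite ler_wpM2r ?cn_ge0// ler_pM ?cn_ge0// (le_trans kw)// ltW//.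
by rewrite e !mul1r leNgt w1.
Qed.

(** Meant for critical modes on which m1 vanishes: m2 then detects the growth. *)
Lemma not_SS_mom2 lam C s b (sg L : R) :
  0 < lam -> admissible C s -> `|sg| = 1 -> 0 <= L ->
  (forall t, 1/2 < t < 1 -> 1 - (1 - s * C)%:C * kap C s (sg * t)%:C * (sg * t)%:C != 0 /\
     cn (Nsym C s b (sg * t)%:C (kap C s (sg * t)%:C)) <=
     L * (1 - t) * cn (1 - (1 - s * C)%:C * kap C s (sg * t)%:C * (sg * t)%:C)) ->
  ~ SS_est lam C s b.
Proof.
move=> lam0 hCs sg1 L0 hN.
apply: (@unstable_criterion lam C s b _ (fun h n => F1 C s 0 h n - F2 C s 0 h n)
  (fun w => 1 - (1 - s * C)%:C * kap C s w * w) sg L) => //.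
- by move=> g n j; rewrite lerDl sqr_ge0.
- by move=> g n; rewrite /mom1 /mom2 sol_kd lerDr sqr_ge0.
by apply: op_eqT (op_mom2 0 hCs) => w _; rewrite expr0 mulr1.
Qed.

End Instability.

(** * Modes of the bulk and boundary symbols *)

Section Modes.
Variable R : realType.
Implicit Types (C s lam r q x y t sg : R) (w k z l : R[i]) (h g u : nat -> R) (b : bcond R).

Lemma bulk_charE C s z k :
  bulk_char C s z k = k * z ^+ 2 - z * ((ca C s)%:C + (cd C s)%:C * k ^+ 2) + (1 - s)%:C * k.
Proof.
rewrite /bulk_char (expand_det_row _ 0) !big_ord_recl big_ord0 /cofactor !det_mx11.
rewrite !mxE !big_ord_recl !big_ord0 !mxE /= -(det_relaxC C s).
rewrite /bump /= !addn0 expr0 expr1 /ca /cb /cc /cd.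
ring.
Qed.

Lemma bulk_char_kchar C s z k : z != 0 -> (bulk_char C s z k = 0 <-> kchar C s z^-1 k).
Proof.
move=> z0; have e : bulk_char C s z k =
  - z * ((cd C s)%:C * k ^+ 2 - cZ s z^-1 * k + (ca C s)%:C).
  by rewrite bulk_charE /cZ; field.
rewrite e /kchar; split=> [/eqP|->]; last by rewrite mulr0.
by rewrite mulf_eq0 oppr_eq0 (negbTE z0) => /eqP.
Qed.

Lemma bulkN_row0 C s z k (phi : 'cV[R[i]]_2) : (bulkN C s z k *m phi) 0 0 =
  (z * k - (ca C s)%:C) * phi 0 0 - (cb C s)%:C * phi 1 0.
Proof.
rewrite !mxE !big_ord_recl big_ord0 !mxE !big_ord_recl !big_ord0 !mxE /=.
have -> : lift ord0 ord0 = 1 :> 'I_2 by apply/val_inj.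
by rewrite /= /ca /cb; ring.
Qed.

Lemma bulkN_row1 C s z k (phi : 'cV[R[i]]_2) : (bulkN C s z k *m phi) 1 0 =
  - (k * (cc C s)%:C) * phi 0 0 + (z - k * (cd C s)%:C) * phi 1 0.
Proof.
rewrite !mxE !big_ord_recl big_ord0 !mxE !big_ord_recl !big_ord0 !mxE /=.
have -> : lift ord0 ord0 = 1 :> 'I_2 by apply/val_inj.
by rewrite /= /cc /cd; ring.
Qed.

Lemma relaxM_row0 C s (phi : 'cV[R[i]]_2) : (relaxM C s *m phi) 0 0 =
  (ca C s)%:C * phi 0 0 + (cb C s)%:C * phi 1 0.
Proof.
rewrite !mxE !big_ord_recl big_ord0 !mxE /= addr0.
by have -> : lift ord0 ord0 = 1 :> 'I_2 by apply/val_inj.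
Qed.

Lemma relaxM_row1 C s (phi : 'cV[R[i]]_2) : (relaxM C s *m phi) 1 0 =
  (cc C s)%:C * phi 0 0 + (cd C s)%:C * phi 1 0.
Proof.
rewrite !mxE !big_ord_recl big_ord0 !mxE /= addr0.
by have -> : lift ord0 ord0 = 1 :> 'I_2 by apply/val_inj.
Qed.

Lemma cV2P (phi psi : 'cV[R[i]]_2) : phi 0 0 = psi 0 0 -> phi 1 0 = psi 1 0 -> phi = psi.
Proof.
move=> h0 h1; apply/matrixP => i j; rewrite (ord1 j).
case: i => -[|[|//]] hi.
  by rewrite (_ : Ordinal hi = 0)//; apply/val_inj.
by rewrite (_ : Ordinal hi = 1)//; apply/val_inj.
Qed.

(* The kernel of the bulk symbol is spanned by phi = (z - d k, c k), for which M phi = (z k phi_1, c z):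
   the boundary equation then reads z^2 N = 0. *)
Lemma boundary_defect C s b z k : z != 0 ->
  z * (z - (cd C s)%:C * k) - \sum_(j < size b)
    k ^+ j * ((bc_coef b j).1%:C * (z * k * (z - (cd C s)%:C * k)) +
              (bc_coef b j).2%:C * ((cc C s)%:C * z)) = z ^+ 2 * Nsym C s b z^-1 k.
Proof.
move=> z0; rewrite /Nsym.
have -> : \sum_(j < size b)
    k ^+ j * ((bc_coef b j).1%:C * (z * k * (z - (cd C s)%:C * k)) +
              (bc_coef b j).2%:C * ((cc C s)%:C * z)) =
   z * (z - (cd C s)%:C * k) * (\sum_(j < size b) (bc_coef b j).1%:C * k ^+ j.+1) +
   (cc C s)%:C * z * (\sum_(j < size b) (bc_coef b j).2%:C * k ^+ j).
  by rewrite !mulr_sumr -big_split; apply: eq_bigr => j _; rewrite exprS /=; ring.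
by field.
Qed.

Lemma mode_intro C s b z k : z != 0 -> kchar C s z^-1 k -> z - (cd C s)%:C * k != 0 ->
  Nsym C s b z^-1 k = 0 -> boundary_mode C s b z k.
Proof.
move=> z0 hk nz hN.
pose phi : 'cV[R[i]]_2 := \col_(i < 2) (if i == 0 then z - (cd C s)%:C * k else (cc C s)%:C * k).
have p0 : phi 0 0 = z - (cd C s)%:C * k by rewrite mxE.
have p1 : phi 1 0 = (cc C s)%:C * k by rewrite mxE.
have zi0 : z^-1 != 0 by rewrite invr_eq0.
have := kernel_row1 zi0 hk; rewrite invrK => row0.
have row1 : (cc C s)%:C * (z - (cd C s)%:C * k) + (cd C s)%:C * ((cc C s)%:C * k) = (cc C s)%:C * z.
  by ring.
exists phi; split.
  by apply: contra nz => /eqP e; rewrite -p0 e mxE.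
split.
  apply: cV2P; rewrite [RHS]mxE ?bulkN_row0 ?bulkN_row1 p0 p1; last by ring.
  by rewrite mulrBl -row0; ring.
rewrite relaxM_row0 relaxM_row1 p0 p1 row0 row1.
by apply/eqP; rewrite -subr_eq0 boundary_defect// hN mulr0.
Qed.

Lemma mode_elim C s b z k : z != 0 -> kchar C s z^-1 k -> z - (cd C s)%:C * k != 0 ->
  boundary_mode C s b z k -> Nsym C s b z^-1 k = 0.
Proof.
move=> z0 hk nz [phi [phi0 [ker bd]]].
have r1 : (bulkN C s z k *m phi) 1 0 = 0 by rewrite ker mxE.
have r0 : (bulkN C s z k *m phi) 0 0 = 0 by rewrite ker mxE.
rewrite bulkN_row1 in r1; rewrite bulkN_row0 in r0.
pose f := phi 0 0 / (z - (cd C s)%:C * k).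
have p0 : phi 0 0 = (z - (cd C s)%:C * k) * f by rewrite /f mulrC divfK.
have p1 : phi 1 0 = (cc C s)%:C * k * f.
  apply: (mulfI nz); apply/eqP; rewrite -subr_eq0 -r1 p0; apply/eqP; ring.
have f0 : f != 0.
  apply: contra phi0 => /eqP e; apply/eqP/cV2P; rewrite [RHS]mxE ?p0 ?p1 e mulr0//.
have zi0 : z^-1 != 0 by rewrite invr_eq0.
have := kernel_row1 zi0 hk; rewrite invrK => row0.
have := boundary_defect C s b k z0.
have -> : z * (z - (cd C s)%:C * k) - \sum_(j < size b)
    k ^+ j * ((bc_coef b j).1%:C * (z * k * (z - (cd C s)%:C * k)) +
              (bc_coef b j).2%:C * ((cc C s)%:C * z)) = 0.
  apply: (mulIf f0); rewrite mul0r mulrBl mulr_suml.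
  have e3 : z * (z - (cd C s)%:C * k) * f = z * phi 0 0 by rewrite p0 mulrA.
  rewrite e3; apply/eqP; rewrite subr_eq0 bd; apply/eqP; apply: eq_bigr => j _.
  rewrite relaxM_row0 relaxM_row1 p0 p1 -row0; ring.
by move=> /esym/eqP; rewrite mulf_eq0 expf_eq0/= (negbTE z0) => /eqP.
Qed.

Lemma stable_rootP C s z k : admissible C s -> stable_root C s z k ->
  [/\ z != 0, 0 < cn z^-1 < 1, kchar C s z^-1 k, k = kap C s z^-1 & z - (cd C s)%:C * k != 0].
Proof.
move=> hCs [z1 [k1 hb]].
have z1' : 1 < cn z by move: z1; rewrite normE -(rmorph1 (real_complex R)) ltcR.
have k1' : cn k < 1 by move: k1; rewrite normE -(rmorph1 (real_complex R)) ltcR.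
have z0 : z != 0 by rewrite -cn_gt0 (lt_trans ltr01).
have hk := (bulk_char_kchar C s k z0).1 hb.
have [w01 ek] := stable_root_kap hCs z1' hk k1'.
split=> //; have := dkw_neq1 hCs w01; rewrite -ek; apply: contra => /eqP e.
by rewrite -[1](mulfV z0) -mulrBl e mul0r.
Qed.

Lemma stable_root_intro C s w : admissible C s -> 0 < cn w < 1 ->
  stable_root C s w^-1 (kap C s w).
Proof.
move=> hCs /[dup] w01 /andP[w0 w1]; have [hk kw _ _] := kapP hCs w01.
have wn0 : w != 0 by rewrite -cn_gt0.
split; first by rewrite normE -(rmorph1 (real_complex R)) ltcR cnV invf_gt1.
split; first by rewrite normE -(rmorph1 (real_complex R)) ltcR (le_lt_trans kw).
by apply/bulk_char_kchar; rewrite ?invr_eq0// invrK.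
Qed.

Lemma no_GR C s b : admissible C s ->
  (forall w, 0 < cn w < 1 -> Nsym C s b w (kap C s w) != 0) -> ~ GR_mode C s b.
Proof.
move=> hCs hN [z [k [sr bm]]]; have [z0 w01 hk ek nz] := stable_rootP hCs sr.
by have := mode_elim z0 hk nz bm; rewrite ek; apply/eqP; exact: hN.
Qed.

Lemma GR_L_intro lam C s b z k : 0 < lam -> admissible C s ->
  1 < cn z -> cn k < 1 -> kchar C s z^-1 k -> Nsym C s b z^-1 k = 0 -> lab_GR_L lam C s b.
Proof.
move=> lam0 hCs z1 k1 hk hN.
have z0 : z != 0 by rewrite -cn_gt0 (lt_trans ltr01).
have [w01 ek] := stable_root_kap hCs z1 hk k1.
have sr : stable_root C s z k by rewrite -[z]invrK ek; exact: stable_root_intro.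
have nSSOO : ~ SSOO_est lam C s b by apply: (GR_not_SSOO lam0 hCs w01); rewrite -ek.
split; first by move=> /(SS_SSOO lam0).
split=> //; exists z, k; split=> //; split; first by case: sr => _ [].
have [_ _ _ _ nz] := stable_rootP hCs sr.
exact: mode_intro.
Qed.

(** The critical mode is approached along the radius [w = sg t], where a Lipschitz bound in 1 - t
    gives the convergence of [kap]. *)
Lemma real_limit_root C s sg (k0 : R[i]) L : admissible C s -> sg ^+ 2 = 1 -> 0 <= L ->
  kchar C s sg%:C k0 ->
  (forall t, 1/2 < t < 1 -> cn (kap C s (sg * t)%:C - k0) <= L * (1 - t)) ->
  limit_stable_root C s sg%:C k0.
Proof.
move=> hCs sg2 L0 hk hL.
have sgn : `|sg| = 1.
  by apply/eqP; rewrite -(@eqrXn2 _ 2)// real_normK ?num_real// sg2 expr1n.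
have sg0 : sg%:C != 0 :> R[i] by rewrite -cn_gt0 cn_real sgn.
have sgV : sg%:C^-1 = sg%:C :> R[i].
  by apply: (mulfI sg0); rewrite mulfV// -rmorphM -expr2 sg2 rmorph1.
split; first by rewrite normE cn_real sgn.
split; first by apply/bulk_char_kchar => //; rewrite sgV.
move=> eps eps0.
(* The entry 3/4 keeps 1/t at most 4/3; the other one gives [(L + 2) (1 - t) <= eps / 2]. *)
pose t := Num.max (3 / 4) (1 - eps / (2 * (L + 2))).
have L2 : 0 < 2 * (L + 2) by lra.
have e1 : 0 < eps / (2 * (L + 2)) by rewrite divr_gt0.
have t34 : 3 / 4 <= t by rewrite le_max lexx.
have t1 : t < 1 by rewrite gt_max; apply/andP; split; lra.
have t2 : 1 - t <= eps / (2 * (L + 2)).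
  by rewrite lerBlDl -lerBlDr le_max lexx orbT.
have ht : (L + 2) * (1 - t) < eps.
  apply: le_lt_trans (ler_wpM2l (_ : 0 <= L + 2) t2) _; first by lra.
  have -> : (L + 2) * (eps / (2 * (L + 2))) = eps / 2 by field; rewrite gt_eqF//; lra.
  by lra.
have t12 : 1/2 < t < 1 by rewrite t1 andbT; lra.
pose w : R[i] := (sg * t)%:C.
have cw : cn w = t by rewrite cn_real normrM sgn mul1r gtr0_norm//; lra.
have w01 : 0 < cn w < 1 by rewrite cw; lra.
have t0 : 0 < t by lra.
exists w^-1, (kap C s w); split; first exact: stable_root_intro.
rewrite !normE !ltcR; split.
  have -> : w^-1 - sg%:C = (sg * (t^-1 - 1))%:C.
    by rewrite /w rmorphM invfM sgV -fmorphV !rmorphM rmorphB rmorph1; ring.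
  rewrite cn_real normrM sgn mul1r.
  have -> : t^-1 - 1 = (1 - t) / t by field; rewrite gt_eqF.
  rewrite ger0_norm; last by apply: divr_ge0; lra.
  rewrite ltr_pdivrMr//.
  have : 0 <= L * (1 - t) by apply: mulr_ge0 => //; lra.
  have : (1 - t) * 1 <= (1 - t) * (4 / 3 * t) by apply: ler_wpM2l; lra.
  have : eps * (3 / 4) <= eps * t by rewrite ler_wpM2l// ltW.
  lra.
apply: le_lt_trans (hL t t12) _; apply: le_lt_trans _ ht; lra.
Qed.

End Modes.

(** * Critical modes on the unit circle *)

Section MildInstability.
Variable R : realType.
Implicit Types (C s lam r q x y t sg : R) (w k z l S : R[i]) (h g u : nat -> R) (b : bcond R).

(** Since [ca + cd = 2 - s], the roots at w = S are S and [S ca / cd]; the right side measures the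
    departure from that situation. *)
Lemma char_factor C s w k S : w != 0 -> S ^+ 2 = 1 -> kchar C s w k ->
  w * ((S * k - 1) * (S * (cd C s)%:C * k - (ca C s)%:C)) =
  (1 - S * w) * (1 - (1 - s)%:C * S * w) * k.
Proof.
move=> w0 S2 hk; have e2 : w^-1 * w = 1 by rewrite mulVf.
have e3 : (ca C s)%:C + (cd C s)%:C = 1 + (1 - s)%:C :> R[i].
  by rewrite -(rmorph1 (real_complex R)) -!rmorphD; congr (_%:C); rewrite /ca /cd; field.
apply/eqP; rewrite -subr_eq0; apply/eqP.
transitivity (w * ((cd C s)%:C * k ^+ 2 - cZ s w * k + (ca C s)%:C)
  + (S ^+ 2 - 1) * (w * (cd C s)%:C * k ^+ 2 - (1 - s)%:C * w ^+ 2 * k)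
  + (w^-1 * w - 1) * k - ((ca C s)%:C + (cd C s)%:C - (1 + (1 - s)%:C)) * S * w * k).
  by rewrite /cZ; ring.
by rewrite hk e2 e3 S2 !subrr mulr0 !mul0r !addr0 subrr.
Qed.

Lemma mom1_neq0 C s w : admissible C s -> 0 < cn w < 1 ->
  1 + (s - 1)%:C * kap C s w * w != 0.
Proof.
move=> hCs /[dup] w01 /andP[w0 w1]; have [_ kw _ _] := kapP hCs w01.
have /andP[s0 s2] := admissible_s hCs.
apply/eqP => /eqP; rewrite addrC addr_eq0 => /eqP /(congr1 (@cn R)).
rewrite cnN cn1 !cnM cn_real => e.
have s1 : `|s - 1| <= 1 by rewrite ler_norml; lra.
have : `|s - 1| * cn (kap C s w) * cn w <= 1 * 1 * cn w.
  by rewrite ler_wpM2r ?cn_ge0// ler_pM ?cn_ge0// (le_trans kw)// ltW.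
by rewrite e !mul1r leNgt w1.
Qed.

Lemma sg_facts sg t : sg ^+ 2 = 1 -> 1/2 < t < 1 ->
  [/\ `|sg| = 1, sg%:C ^+ 2 = 1 :> R[i], cn (sg * t)%:C = t, 0 < cn (sg * t)%:C < 1 &
      1 - sg%:C * (sg * t)%:C = (1 - t)%:C :> R[i]].
Proof.
move=> sg2 /andP[t2 t1].
have sgn : `|sg| = 1.
  by apply/eqP; rewrite -(@eqrXn2 _ 2)// real_normK ?num_real// sg2 expr1n.
have ct : cn (sg * t)%:C = t by rewrite cn_real normrM sgn mul1r gtr0_norm//; lra.
split=> //; first by rewrite -rmorphXn sg2 rmorph1.
  by rewrite ct; lra.
by rewrite -(rmorph1 (real_complex R)) -rmorphM -rmorphB mulrA -expr2 sg2 mul1r.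
Qed.

(* At w = sg t, both factors of [char_factor] cannot be small, so one of them is O(1 - t). *)
Lemma char_factor_bound C s sg t : admissible C s -> sg ^+ 2 = 1 -> 1/2 < t < 1 ->
  let k := kap C s (sg * t)%:C in
  cn (1 - sg%:C * k) * cn (sg%:C * (cd C s)%:C * k - (ca C s)%:C) <= 2 * (1 - t).
Proof.
move=> hCs sg2 t12 /=; set k := kap _ _ _; have [sgn S2 ct w01 e1] := sg_facts sg2 t12.
have /andP[t2 t1] := t12.
have [hk kw _ _] := kapP hCs w01; rewrite -/k ct in hk kw.
have wn0 : (sg * t)%:C != 0 :> R[i] by rewrite -cn_gt0 ct; lra.
have := congr1 (@cn R) (char_factor wn0 S2 hk); rewrite e1 !cnM ct cn_real (cnC _ 1).
have /andP[s0 s2] := admissible_s hCs.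
have h3 : cn (1 - (1 - s)%:C * sg%:C * (sg * t)%:C) <= 2.
  rewrite (le_trans (cnB _ _))// cn1 !cnM ct !cn_real sgn mulr1.
  have s1 : `|1 - s| <= 1 by rewrite ler_norml; lra.
  have : `|1 - s| * t <= 1 * 1 by rewrite ler_pM//; lra.
  by lra.
rewrite ger0_norm; last by lra.
set X := cn _; set Y := cn (_ - (ca C s)%:C); set V := cn (1 - (1 - s)%:C * _ * _) in h3 * => e.
have t0 : 0 < t by lra.
rewrite -(ler_pM2l t0) e; have -> : t * (2 * (1 - t)) = (1 - t) * 2 * t by ring.
by rewrite ler_pM ?cn_ge0// ?mulr_ge0 ?cn_ge0//; [lra|rewrite ler_wpM2l//; lra].
Qed.

(** * Inflow: the critical point w = 1, kap = 1 *)

Section Inflow.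
Variables (C s : R).
Hypotheses (hCs : admissible C s) (C0 : 0 < C).

(** The second factor of [char_factor] stays away from 0: by [|cd| < ca] if s < 2, and by [kap_sign]
    if s = 2. *)
Lemma inflow_kap : exists2 L, 0 <= L & forall t, 1/2 < t < 1 ->
  cn (kap C s (1 * t)%:C - 1) <= L * (1 - t).
Proof.
have C0' := C0; have /andP[s0 s2] := admissible_s hCs.
have sC : 0 < s * C by rewrite mulr_gt0.
suff [c c0 hc] : exists2 c, 0 < c & forall t, 1/2 < t < 1 ->
    c <= cn ((cd C s)%:C * kap C s (1 * t)%:C - (ca C s)%:C).
  exists (2 / c); first by apply: divr_ge0 => //; exact: ltW.
  move=> t t12; have := char_factor_bound hCs (expr1n R 2) t12 => /=.
  rewrite !rmorph1 !mul1r => h; rewrite cnC mulrAC ler_pdivlMr//.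
  by apply: le_trans h; rewrite ler_wpM2l ?cn_ge0//; have := hc t t12; rewrite mul1r.
case: (ltrP s 2) => [s2'|s2'].
  have ad : `|cd C s| < ca C s by rewrite ltr_norml /ca /cd; lra.
  exists (ca C s - `|cd C s|); first by rewrite subr_gt0.
  move=> t t12; have [_ _ ct w01 _] := sg_facts (expr1n R 2) t12.
  have [_ kw _ _] := kapP hCs w01; rewrite cnC.
  have := cn_le_sub (ca C s)%:C (- ((cd C s)%:C * kap C s (1 * t)%:C)).
  rewrite cnN cnM !cn_real; apply: le_trans.
  have : 0 <= ca C s by apply: le_trans (normr_ge0 _) (ltW ad).
  move=> /ger0_norm ->; rewrite lerD2l lerN2 ler_piMr// (le_trans kw)// ltW//.
  by case/andP: w01.
have es : s = 2 by apply: le_anti; rewrite s2.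
exists C => // t t12; have [_ _ ct w01 _] := sg_facts (expr1n R 2) t12.
have := kap_sign hCs es w01; set k := kap _ _ _.
have a2 : ca C s = C by rewrite /ca es; field.
have d2 : cd C s = - C by rewrite /cd es; field.
have -> : (cd C s)%:C * k - (ca C s)%:C = - (C%:C * (1 + k)) by rewrite a2 d2 rmorphN; ring.
have t0 : 0 < t by case/andP: t12 => ? ?; lra.
rewrite /= mul1r -mulrA pmulr_rge0// pmulr_lge0//.
move=> rk; rewrite cnN cnM cn_real gtr0_norm//; apply: ler_peMr; first exact: ltW.
have := cn_Re (1 + k); rewrite ReD /= => h.
by apply: le_trans (le_trans _ (ler_norm _)) h; rewrite lerDl.
Qed.

(** The growth of the critical mode is visible on m1, so SSOO fails as well as SS. *)
Lemma inflow_mom1 : exists2 c, 0 < c & forall t, 1/2 < t < 1 ->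
  c <= cn (1 + (s - 1)%:C * kap C s (1 * t)%:C * (1 * t)%:C).
Proof.
have C0' := C0; have /andP[s0 s2] := admissible_s hCs.
case: (ltrP s 2) => [s2'|s2'].
  have s1 : `|s - 1| < 1 by rewrite ltr_norml; lra.
  exists (1 - `|s - 1|); first by rewrite subr_gt0.
  move=> t t12; have [_ _ ct w01 _] := sg_facts (expr1n R 2) t12.
  have [_ kw _ _] := kapP hCs w01; have /andP[w0 w1] := w01.
  have := cn_le_sub 1 ((s - 1)%:C * kap C s (1 * t)%:C * (1 * t)%:C).
  apply: le_trans; rewrite cn1 lerD2l lerN2 !cnM cn_real -mulrA ler_piMr//.
  by rewrite mulr_ile1 ?cn_ge0 ?(ltW w1)// (le_trans kw)// ltW.
have es : s = 2 by apply: le_anti; rewrite s2.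
exists 1 => // t t12; have [_ _ ct w01 _] := sg_facts (expr1n R 2) t12.
have := kap_sign hCs es w01; set k := kap _ _ _.
have t0 : 0 < t by case/andP: t12 => ? ?; lra.
rewrite /= !mul1r -mulrA pmulr_rge0// => rk.
have e1 : (s - 1)%:C = 1 :> R[i] by rewrite es -(rmorph1 (real_complex R)); congr (_%:C); lra.
rewrite e1 mul1r; have := cn_Re (1 + k * t%:C).
have -> : Re (1 + k * t%:C) = 1 + Re k * t by case: (k) => a b' /=; rewrite mulr0 subr0.
by apply: le_trans; apply: le_trans (ler_norm _); rewrite lerDl.
Qed.

Lemma inflow_kchar1 : kchar C s 1 1.
Proof.
rewrite /kchar /cZ invr1 expr1n !mulr1 -(rmorph1 (real_complex R)) -!rmorphD -rmorphB -rmorphD.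
by rewrite -(rmorph0 (real_complex R)); congr (_%:C); rewrite /ca /cd; field.
Qed.

Lemma inflow_mode b : Nsym C s b 1 1 = 0 -> MU_E_mode C s b.
Proof.
move=> hN; exists 1, 1; have [L L0 hL] := inflow_kap.
have := real_limit_root (sg := 1) (k0 := 1) hCs (expr1n R 2) L0.
rewrite rmorph1 => /(_ inflow_kchar1 hL) hl; split=> //; split; first by rewrite normr1.
apply: mode_intro; rewrite ?invr1 ?oner_neq0//; first exact: inflow_kchar1.
have C0' := C0; have /andP[s0 s2] := admissible_s hCs; have sC : 0 < s * C by rewrite mulr_gt0.
rewrite mulr1 -(rmorph1 (real_complex R)) -rmorphB -cn_gt0 cn_real normr_gt0 /cd gt_eqF//; lra.
Qed.

(* Any boundary symbol vanishing at (1, 1) with bounded increments there. *)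
Lemma inflow_not_SSOO lam b (A B : R) : 0 < lam -> 0 <= A -> 0 <= B ->
  (forall w, 0 < cn w < 1 ->
     cn (Nsym C s b w (kap C s w)) <= A * cn (1 - w) + B * cn (1 - kap C s w)) ->
  ~ SSOO_est lam C s b.
Proof.
move=> lam0 A0 B0 hN; have [L L0 hL] := inflow_kap; have [c c0 hc] := inflow_mom1.
have L'0 : 0 <= (A + B * L) / c by apply: divr_ge0; [rewrite addr_ge0// mulr_ge0|exact: ltW].
apply: (@not_SSOO _ lam C s b 1 ((A + B * L) / c)) => //; first by rewrite normr1.
move=> t t12; have [_ _ ct w01 e1] := sg_facts (expr1n R 2) t12; have /andP[t2 t1] := t12.
apply: le_trans (hN _ w01) _.
have -> : cn (1 - (1 * t)%:C) = 1 - t by move: e1;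
  rewrite rmorph1 !mul1r => ->; rewrite cn_real ger0_norm//; lra.
have h2 := hL t t12; have h3 := hc t t12; rewrite cnC.
apply: (@le_trans _ _ ((A + B * L) / c * (1 - t) * c)); last first.
  by rewrite ler_wpM2l// mulr_ge0//; lra.
have -> : (A + B * L) / c * (1 - t) * c = A * (1 - t) + B * (L * (1 - t)) by field; rewrite gt_eqF.
by rewrite lerD2l ler_wpM2l.
Qed.

Lemma inflow_MU_E lam b (A B : R) : 0 < lam -> 0 <= A -> 0 <= B ->
  (forall w, 0 < cn w < 1 ->
     cn (Nsym C s b w (kap C s w)) <= A * cn (1 - w) + B * cn (1 - kap C s w)) ->
  (forall w, 0 < cn w < 1 -> Nsym C s b w (kap C s w) != 0) ->
  Nsym C s b 1 1 = 0 -> lab_MU_E lam C s b.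
Proof.
move=> lam0 A0 B0 hN hN0 hN1; have nS := inflow_not_SSOO lam0 A0 B0 hN.
split; first by move=> /(SS_SSOO lam0).
by split=> //; split; [exact: no_GR|exact: inflow_mode].
Qed.

Lemma one_sub_kap_neq0 w : 0 < cn w < 1 -> 1 - kap C s w != 0.
Proof.
move=> /[dup] w01 /andP[w0 w1]; have [_ kw _ _] := kapP hCs w01.
rewrite subr_eq0; apply/eqP => e; move: kw; rewrite -e cn1; apply/negP.
by rewrite -ltNge.
Qed.

End Inflow.

Lemma extr_neq0 C s sigma w : admissible C s -> 0 < cn w < 1 ->
  Nsym C s (bc_extr R sigma) w (kap C s w) != 0.
Proof.
move=> hCs w01; rewrite Nsym_extr mulf_neq0 ?dkw_neq1// expf_neq0//.
exact: one_sub_kap_neq0.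
Qed.

Lemma cn_dkw_le2 C s w : admissible C s -> 0 < cn w < 1 ->
  cn (1 - (cd C s)%:C * kap C s w * w) <= 2.
Proof.
move=> hCs w01; rewrite (le_trans (cnB _ _))// cn1.
have := kap_gap hCs w01; have /andP[_ g1] := gap01 hCs; lra.
Qed.

Lemma cn_one_sub_kap C s w : admissible C s -> 0 < cn w < 1 -> cn (1 - kap C s w) <= 2.
Proof.
move=> hCs /[dup] w01 /andP[w0 w1]; have [_ kw _ _] := kapP hCs w01.
rewrite (le_trans (cnB _ _))// cn1; lra.
Qed.

Lemma extr_inflow lam C s sigma : 0 < lam -> admissible C s -> 0 < C -> (0 < sigma)%N ->
  lab_MU_E lam C s (bc_extr R sigma).
Proof.
move=> lam0 hCs C0; case: sigma => // n _.
apply: (@inflow_MU_E C s hCs C0 lam _ 0 (2 * 2 ^+ n)) => //.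
- move=> w w01; rewrite Nsym_extr mul0r add0r cnM cnX exprS mulrCA mulrC.
  have h1 := cn_dkw_le2 hCs w01; have h2 := cn_one_sub_kap hCs w01.
  rewrite ler_wpM2r ?cn_ge0// ler_pM ?cn_ge0 ?exprn_ge0 ?cn_ge0//.
  by rewrite lerXn2r// nnegrE ?cn_ge0.
- by move=> w w01; exact: extr_neq0.
by rewrite Nsym_extr subrr exprS mul0r mulr0.
Qed.

(** * Outflow: bounce-back (sg = 1) and anti-bounce-back (sg = -1) *)

Section Outflow.
Variables (C s sg : R).
Hypotheses (hCs : admissible C s) (C0 : C < 0) (sg2 : sg ^+ 2 = 1).

(** [kap] keeps away from sg, by [kap_outflow] if s < 2 and by [kap_sign] if s = 2; hence its limit
    is the other root, [sg ca / cd]. *)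
Lemma outflow_sep : exists2 c, 0 < c & forall t, 1/2 < t < 1 ->
  c <= cn (1 - sg%:C * kap C s (sg * t)%:C).
Proof.
have C0' := C0; have /andP[s0 s2] := admissible_s hCs.
case: (ltrP s 2) => [s2'|s2'].
  have [q /andP[q0 q1] hq] := kap_outflow hCs C0 s2'.
  exists (1 - q); first by rewrite subr_gt0.
  move=> t t12; have [sgn _ _ w01 _] := sg_facts sg2 t12.
  have := cn_le_sub 1 (- (sg%:C * kap C s (sg * t)%:C)).
  apply: le_trans; rewrite cn1 cnN cnM cn_real sgn mul1r lerD2l lerN2.
  exact: hq.
have es : s = 2 by apply: le_anti; rewrite s2.
exists 1 => // t t12; have [sgn _ _ w01 _] := sg_facts sg2 t12.
have := kap_sign hCs es w01; set k := kap _ _ _.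
have t0 : 0 < t by case/andP: t12 => ? ?; lra.
rewrite /= -mulrA nmulr_rge0// mulrA pmulr_lle0// => rk.
have := cn_Re (1 - sg%:C * k).
have -> : Re (1 - sg%:C * k) = 1 - Re k * sg.
  by case: (k) => a b' /=; rewrite mul0r subr0 mulrC.
by apply: le_trans; apply: le_trans (ler_norm _); rewrite lerDl oppr_ge0.
Qed.

Lemma outflow_kap : exists2 L, 0 <= L & forall t, 1/2 < t < 1 ->
  cn (kap C s (sg * t)%:C - (sg * (ca C s / cd C s))%:C) <= L * (1 - t).
Proof.
have [c c0 hc] := outflow_sep; have [d0 _ _] := coef_neg hCs C0.
exists (2 / (c * cd C s)); first by rewrite divr_ge0// mulr_ge0// ltW.
move=> t t12; have [sgn S2 ct w01 _] := sg_facts sg2 t12.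
have := char_factor_bound hCs sg2 t12 => /=; have := hc t t12.
set k := kap _ _ _ => h1 h2.
have e : sg%:C * (cd C s)%:C * k - (ca C s)%:C =
   sg%:C * (cd C s)%:C * (k - (sg * (ca C s / cd C s))%:C).
  have e1 : (ca C s)%:C = (cd C s)%:C * (ca C s / cd C s)%:C :> R[i].
    by rewrite -rmorphM mulrC divfK// gt_eqF.
  have -> : (sg * (ca C s / cd C s))%:C = sg%:C * (ca C s / cd C s)%:C :> R[i] by rewrite rmorphM.
  rewrite {1}e1; set q := (ca C s / cd C s)%:C.
  transitivity (sg%:C * (cd C s)%:C * k - sg%:C ^+ 2 * ((cd C s)%:C * q)).
    by rewrite S2 mul1r.
  by ring.
rewrite e !cnM !cn_real sgn mul1r gtr0_norm// in h2.
have -> : 2 / (c * cd C s) * (1 - t) = 2 * (1 - t) / (c * cd C s) by ring.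
rewrite ler_pdivlMr; last by rewrite mulr_gt0.
apply: le_trans h2.
by rewrite mulrC -mulrA ler_wpM2r// mulr_ge0 ?cn_ge0 ?(ltW d0).
Qed.

Lemma outflow_kchar : kchar C s sg%:C (sg * (ca C s / cd C s))%:C.
Proof.
have [d0 _ _] := coef_neg hCs C0.
have sg0 : sg != 0 by apply/eqP => e; move: sg2; rewrite e expr0n => /eqP; rewrite eq_sym oner_eq0.
have sgV : sg^-1 = sg by apply: (mulfI sg0); rewrite mulfV// -expr2 sg2.
rewrite /kchar /cZ -fmorphV sgV -rmorphXn -!rmorphM -rmorphD -rmorphM -rmorphB -rmorphD.
rewrite -(rmorph0 (real_complex R)); congr (_%:C).
have e : (2 - s) = ca C s + cd C s by rewrite /ca /cd; field.
have -> : (sg + (1 - s) * sg) * (sg * (ca C s / cd C s)) = sg ^+ 2 * (2 - s) * (ca C s / cd C s) by ring.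
by rewrite exprMn sg2 e; field; rewrite gt_eqF.
Qed.

(** The determinant is the numerator of m1 times [(1 - sg w) / (1 - sg k)], a ratio that is nonzero
    inside the disc and O(1 - t) on the radius towards sg. The absence of Godunov-Ryabenkii modes
    and the instability both follow. *)
Lemma reflect_identity w k : w != 0 -> kchar C s w k ->
  (1 - (cd C s)%:C * k * w - sg%:C * (cc C s)%:C * w) * (1 - sg%:C * k) =
  (1 - sg%:C * w) * (1 + (s - 1)%:C * k * w).
Proof.
move=> w0 hk; have S2 : sg%:C ^+ 2 = 1 :> R[i] by rewrite -rmorphXn sg2 rmorph1.
have hb := bulk_identity w0 hk.
have e : (s - 1)%:C = (cc C s)%:C - (cd C s)%:C :> R[i] by rewrite -(cc_sub_cd C) rmorphB.
apply/eqP; rewrite -subr_eq0; apply/eqP.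
transitivity (- sg%:C * (k - (cd C s)%:C * k ^+ 2 * w + (cc C s)%:C * w - w * (1 + (s - 1)%:C * w * k))
  + (sg%:C ^+ 2 - 1) * ((cc C s)%:C * k * w) +
  ((cc C s)%:C - (cd C s)%:C - (s - 1)%:C) * k * w).
  by ring.
by rewrite hb S2 e !subrr mulr0 !mul0r !addr0.
Qed.

Variables (lam : R) (b : bcond R).
Hypothesis lam0 : 0 < lam.
Hypothesis hb : forall w k, Nsym C s b w k = 1 - (cd C s)%:C * k * w - sg%:C * (cc C s)%:C * w.

Lemma reflect_not_SSOO : ~ SSOO_est lam C s b.
Proof.
have [c c0 hc] := outflow_sep.
have sgn : `|sg| = 1.
  by apply/eqP; rewrite -(@eqrXn2 _ 2)// real_normK ?num_real// sg2 expr1n.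
apply: (@not_SSOO _ lam C s b sg c^-1) => //; first by rewrite invr_ge0 ltW.
move=> t t12; have [_ _ ct w01 e1] := sg_facts sg2 t12; have /andP[t2 t1] := t12.
have [hk _ _ _] := kapP hCs w01.
have wn0 : (sg * t)%:C != 0 :> R[i] by rewrite -cn_gt0; case/andP: w01.
have := congr1 (@cn R) (reflect_identity wn0 hk);
  rewrite -hb e1 !(cnM (Nsym _ _ _ _ _)) (cnM (1 - t)%:C) cn_real.
rewrite ger0_norm; last by lra.
set N := cn (Nsym _ _ _ _ _); set m := cn (1 + _) => e.
rewrite -mulrA mulrC ler_pdivlMr// -e ler_wpM2l ?cn_ge0//; exact: hc.
Qed.

Lemma reflect_no_GR : ~ GR_mode C s b.
Proof.
apply: no_GR => // w /[dup] w01 /andP[w0 w1].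
have [hk _ _ _] := kapP hCs w01; have wn0 : w != 0 by rewrite -cn_gt0.
have sgn : `|sg| = 1.
  by apply/eqP; rewrite -(@eqrXn2 _ 2)// real_normK ?num_real// sg2 expr1n.
apply/eqP => e; have := reflect_identity wn0 hk; rewrite -hb e mul0r => /esym/eqP.
rewrite mulf_eq0 (negbTE (mom1_neq0 hCs w01)) orbF subr_eq0 => /eqP /(congr1 (@cn R)).
by rewrite cn1 cnM cn_real sgn mul1r => e1; move: w1; rewrite -e1 ltxx.
Qed.

Lemma reflect_mode : limit_stable_root C s sg%:C (sg * (ca C s / cd C s))%:C /\
  boundary_mode C s b sg%:C (sg * (ca C s / cd C s))%:C.
Proof.
have [L L0 hL] := outflow_kap; have [d0 _ _] := coef_neg hCs C0.
split; first exact: (real_limit_root hCs sg2 L0 outflow_kchar hL).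
have sg0 : sg != 0 by apply/eqP => e; move: sg2; rewrite e expr0n => /eqP; rewrite eq_sym oner_eq0.
have sgV : sg^-1 = sg by apply: (mulfI sg0); rewrite mulfV// -expr2 sg2.
have da : cd C s * (ca C s / cd C s) = ca C s by rewrite mulrC divfK// gt_eqF.
have a1 : ca C s < 1 by apply: le_lt_trans (ler_norm _) (ca_lt1 hCs C0).
apply: mode_intro.
- by rewrite -(rmorph0 (real_complex R)) (inj_eq (@complexI R)).
- by rewrite -fmorphV sgV; exact: outflow_kchar.
- have -> : sg%:C - (cd C s)%:C * (sg * (ca C s / cd C s))%:C = (sg * (1 - ca C s))%:C.
    by rewrite -rmorphM -rmorphB; congr (_%:C); rewrite mulrCA da; ring.
  rewrite -(rmorph0 (real_complex R)) (inj_eq (@complexI R)) mulf_neq0//.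
  by rewrite subr_eq0 eq_sym lt_eqF.
rewrite hb -fmorphV sgV -(rmorph1 (real_complex R)) -!rmorphM -!rmorphB.
rewrite -(rmorph0 (real_complex R)); congr (_%:C).
have -> : cd C s * (sg * (ca C s / cd C s)) * sg = sg ^+ 2 * (cd C s * (ca C s / cd C s)) by ring.
have -> : sg * cc C s * sg = sg ^+ 2 * cc C s by ring.
by rewrite sg2 !mul1r da -addrA -opprD ca_cc subrr.
Qed.

(** The ratio is below 1 for s < 2 and equal to 1 for s = 2, which decides between the suffixes L
    and E. *)
Lemma limit_root_norm : `|(sg * (ca C s / cd C s))%:C : R[i]| = (`|ca C s| / cd C s)%:C.
Proof.
have [d0 _ _] := coef_neg hCs C0.
have sgn : `|sg| = 1.
  by apply/eqP; rewrite -(@eqrXn2 _ 2)// real_normK ?num_real// sg2 expr1n.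
by rewrite normE cn_real normrM sgn mul1r normrM normfV (gtr0_norm d0).
Qed.

Lemma reflect_MU_L : s < 2 -> lab_MU_L lam C s b.
Proof.
move=> s2; have C0' := C0; have nS := reflect_not_SSOO.
split; first by move=> /(SS_SSOO lam0).
split=> //; split; first exact: reflect_no_GR.
have [m1 m2] := reflect_mode; exists sg%:C, (sg * (ca C s / cd C s))%:C; split=> //; split=> //.
have [d0 _ _] := coef_neg hCs C0; have /andP[s0 _] := admissible_s hCs.
have sC : s * C < 0 by rewrite pmulr_rlt0.
rewrite limit_root_norm -(rmorph1 (real_complex R)) ltcR ltr_pdivrMr// mul1r.
by rewrite ltr_norml /ca /cd; lra.
Qed.

Lemma conservative_limit_norm : s = 2 -> `|(sg * (ca C s / cd C s))%:C : R[i]| = 1.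
Proof.
move=> s2; have [d0 _ _] := coef_neg hCs C0.
have da : ca C s = - cd C s by rewrite /ca /cd s2; field.
by rewrite limit_root_norm da normrN gtr0_norm// divff ?gt_eqF// rmorph1.
Qed.

Lemma reflect_MU_E : s = 2 -> lab_MU_E lam C s b.
Proof.
move=> s2; have nS := reflect_not_SSOO.
split; first by move=> /(SS_SSOO lam0).
split=> //; split; first exact: reflect_no_GR.
have [m1 m2] := reflect_mode; exists sg%:C, (sg * (ca C s / cd C s))%:C; split=> //; split=> //.
exact: conservative_limit_norm.
Qed.

End Outflow.

End MildInstability.

(** * Outflow with s = 2: the critical point w = -1, kap = 1 *)

Section ConservativeCases.
Variable R : realType.
Variables (C lam : R).
Hypotheses (hC : admissible C 2) (C0 : C < 0) (lam0 : 0 < lam).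

Lemma cons_coef : ca C 2 = C /\ cd C 2 = - C.
Proof. by split; rewrite /ca /cd; field. Qed.

Lemma sqrN1 : (-1 : R) ^+ 2 = 1. Proof. by rewrite sqrrN expr1n. Qed.

Lemma cons_limit : (-1 * (ca C 2 / cd C 2))%:C = 1 :> R[i].
Proof.
have [-> ->] := cons_coef; rewrite -(rmorph1 (real_complex R)); congr (_%:C).
by have C0' := C0; field; rewrite lt_eqF.
Qed.

Lemma cons_kap : exists2 L, 0 <= L & forall t, 1/2 < t < 1 ->
  cn (1 - kap C 2 (-1 * t)%:C) <= L * (1 - t).
Proof.
have [L L0 hL] := outflow_kap hC C0 sqrN1; exists L => // t t12.
by have := hL t t12; rewrite cons_limit cnC.
Qed.

(** The numerator of m1 is only known to be at least 1 - t on the radius, so a determinant of order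
    [(1 - t)^2] is wanted; [(1 - kap)^sigma] supplies it from sigma = 2 on. *)
Lemma extr_conservative sigma : (2 <= sigma)%N -> lab_MU_E lam C 2 (bc_extr R sigma).
Proof.
case: sigma => [|[|n]] // _; have [L L0 hL] := cons_kap.
have nS : ~ SSOO_est lam C 2 (bc_extr R n.+2).
  apply: (@not_SSOO _ lam C 2 _ (-1) (2 * (L * (L * 2 ^+ n)))) => //.
  - by rewrite normrN normr1.
  - by rewrite !mulr_ge0// exprn_ge0.
  move=> t t12; have [sgn S2 ct w01 e1] := sg_facts sqrN1 t12; have /andP[t2 t1] := t12.
  have ot : 0 <= 1 - t by lra.
  rewrite Nsym_extr; set w := (-1 * t)%:C in ct w01 *; set k := kap C 2 w.
  have [_ kw _ _] := kapP hC w01; rewrite -/k ct in kw.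
  have hk := hL t t12; rewrite -/w -/k in hk.
  have m1 : 1 - t <= cn (1 + (2 - 1)%:C * k * w).
    have := cn_le_sub 1 ((2 - 1)%:C * k * w); apply: le_trans.
    rewrite cn1 lerD2l lerN2 !cnM cn_real ct ger0_norm; last by lra.
    have : (2 - 1) * cn k * t <= (2 - 1) * 1 * t.
      by rewrite ler_wpM2r ?ler_wpM2l//; lra.
    by lra.
  have h1 := cn_dkw_le2 hC w01; have h2 := cn_one_sub_kap hC w01; rewrite -/k in h1 h2.
  have hk0 := cn_ge0 (1 - k).
  have hn : cn (1 - k) ^+ n <= 2 ^+ n by rewrite lerXn2r// nnegrE.
  rewrite cnM cnX !exprS.
  apply: (@le_trans _ _ (2 * (L * (1 - t) * (L * (1 - t) * 2 ^+ n)))).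
    apply: ler_pM; rewrite ?cn_ge0 ?mulr_ge0 ?exprn_ge0//.
    apply: ler_pM; rewrite ?mulr_ge0 ?exprn_ge0//.
    by apply: ler_pM; rewrite ?exprn_ge0.
  have -> : 2 * (L * (1 - t) * (L * (1 - t) * 2 ^+ n)) =
    2 * (L * (L * 2 ^+ n)) * (1 - t) * (1 - t) by ring.
  by rewrite ler_wpM2l// !mulr_ge0// exprn_ge0.
split; first by move=> /(SS_SSOO lam0).
split=> //; split; first by apply: no_GR => // w w01; exact: extr_neq0.
have [L' L'0 hL'] := outflow_kap hC C0 sqrN1.
have hk := outflow_kchar hC C0 sqrN1.
rewrite cons_limit in hk; rewrite cons_limit in hL'.
exists (-1)%:C, 1; split; first exact: (real_limit_root hC sqrN1 L'0 hk hL').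
split; first by rewrite normr1.
have n1 : (-1 : R)%:C^-1 = (-1)%:C :> R[i] by rewrite -fmorphV invrN1.
apply: mode_intro; rewrite ?n1//.
- by rewrite rmorphN1 oppr_eq0 oner_eq0.
- have [_ ->] := cons_coef; rewrite mulr1 -rmorphB -cn_gt0 cn_real normr_gt0.
  by have C0' := C0; rewrite lt_eqF//; lra.
by rewrite Nsym_extr subrr exprS mul0r mulr0.
Qed.

(** On the negative radius [Re kap >= 0] by [kap_sign], so both terms have nonnegative real part: m2
    does not vanish together with m1. *)
Lemma mom2_lower t : 1/2 < t < 1 ->
  1 <= cn (1 - (1 - 2 * C)%:C * kap C 2 (-1 * t)%:C * (-1 * t)%:C).
Proof.
move=> t12; have [sgn S2 ct w01 e1] := sg_facts sqrN1 t12; have /andP[t2 t1] := t12.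
have := kap_sign hC erefl w01; set k := kap _ _ _ => hs.
have t0 : 0 < t by lra.
have rk : 0 <= Re k.
  move: hs => /=; have C0' := C0; rewrite mulN1r mulrN -mulNr -mulNr pmulr_lge0// pmulr_rge0//; lra.
have := cn_Re (1 - (1 - 2 * C)%:C * k * (-1 * t)%:C).
have -> : Re (1 - (1 - 2 * C)%:C * k * (-1 * t)%:C) = 1 + (1 - 2 * C) * Re k * t.
  by case: (k) => a b /=; ring.
apply: le_trans; apply: le_trans (ler_norm _); rewrite lerDl mulr_ge0 ?(ltW t0)// mulr_ge0//.
by have C0' := C0; lra.
Qed.

Lemma conservative_not_SS b (A B : R) : 0 <= A -> 0 <= B ->
  (forall w, 0 < cn w < 1 ->
    cn (Nsym C 2 b w (kap C 2 w)) <= A * cn (1 + w) + B * cn (1 - kap C 2 w)) ->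
  ~ SS_est lam C 2 b.
Proof.
move=> A0 B0 hN; have [L L0 hL] := cons_kap.
apply: (@not_SS_mom2 _ lam C 2 b (-1) (A + B * L)) => //.
- by rewrite normrN normr1.
- by rewrite addr_ge0// mulr_ge0.
move=> t t12; have h1 := mom2_lower t12; split.
  by rewrite -cn_gt0 (lt_le_trans ltr01).
have [sgn S2 ct w01 e1] := sg_facts sqrN1 t12; have /andP[t2 t1] := t12.
apply: le_trans (hN _ w01) _; have h2 := hL t t12.
have -> : cn (1 + (-1 * t)%:C) = 1 - t.
  by rewrite mulN1r rmorphN -(rmorph1 (real_complex R)) -rmorphB cn_real ger0_norm; lra.
apply: (@le_trans _ _ ((A + B * L) * (1 - t) * 1)).
  rewrite mulr1 mulrDl lerD2l -mulrA ler_wpM2l//.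
apply: ler_wpM2l => //; apply: mulr_ge0; last by lra.
by rewrite addr_ge0// mulr_ge0.
Qed.

Lemma ABB2_conservative : lab_SSOO lam C 2 (bc_ABB2 R).
Proof.
split; first exact: ABB2_SSOO.
apply: (@conservative_not_SS _ 1 1) => // w /[dup] w01 /andP[w0 w1].
rewrite Nsym_ABB2; set k := kap _ _ _.
have e1 : (2 - 1 : R)%:C = 1 :> R[i] by rewrite -(rmorph1 (real_complex R)); congr (_%:C); lra.
have -> : 1 + (2 - 1)%:C * k * w = (1 + w) - w * (1 - k) by rewrite e1; ring.
rewrite (le_trans (cnB _ _))// !mul1r lerD2l cnM ler_piMl ?cn_ge0// ltW//.
Qed.

Lemma extr1_conservative : lab_SSOO lam C 2 (bc_extr R 1).
Proof.
split; first exact: extr1_SSOO.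
apply: (@conservative_not_SS _ 0 2) => // w w01.
by rewrite Nsym_extr expr1 mul0r add0r cnM ler_wpM2r ?cn_ge0// cn_dkw_le2.
Qed.

End ConservativeCases.

(** * C = 1/2: mildly unstable special cases *)

Section InflowSpecial.
Variable R : realType.
Implicit Types (s x : R) (w k u v c : R[i]).
Notation C1 := (1 / 2 : R).

Lemma adm_inflow s : s = 3 / 2 \/ s = 2 -> admissible C1 s.
Proof.
by move=> [->|->]; [left; split; [lra|]|right; split=> //]; rewrite ger0_norm; lra.
Qed.

Lemma coef_inflow s : s = 3 / 2 \/ s = 2 ->
  [/\ cd C1 s = 1 - 3 / 4 * s, cc C1 s = s / 4 & (1 + C1) / 2 = 3 / 4].
Proof. by move=> _; split; rewrite /cd /cc; lra. Qed.

(** Serves to exclude zeros of the determinant in the disc: u and v are taken affine in w or in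
    [kap w] with real coefficients, so that comparing their moduli is a polynomial inequality,
    strict because the real part is below 1. *)
Lemma dominated_neq0 u v c : cn c <= 1 -> cn v ^+ 2 < cn u ^+ 2 -> u - c * v != 0.
Proof.
move=> c1 h; rewrite subr_eq0; apply/eqP => e.
move: h; rewrite e cnM exprMn ltNge => /negP; apply.
by rewrite ler_piMl ?sqr_ge0// expr_le1 ?cn_ge0.
Qed.

Variables (s lam : R).
Hypotheses (hs : s = 3 / 2 \/ s = 2) (lam0 : 0 < lam).

Lemma s_range : 3 / 2 <= s <= 2.
Proof. by case: hs => ->; lra. Qed.

Lemma cd_small : `|cd C1 s| <= 1.
Proof. by have [-> _ _] := coef_inflow hs; have /andP[? ?] := s_range; rewrite ler_norml; lra. Qed.

Lemma cn_kap_le1 w : 0 < cn w < 1 -> cn (kap C1 s w) <= 1.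
Proof.
move=> /[dup] w01 /andP[w0 w1]; have [_ kw _ _] := kapP (adm_inflow hs) w01.
by rewrite (le_trans kw)// ltW.
Qed.

Lemma extreq1_inflow : lab_MU_E lam C1 s (bc_extreq C1 1).
Proof.
have hCs := adm_inflow hs; have [d c p] := coef_inflow hs.
have C10 : 0 < C1 by lra.
have hsr := s_range; have /andP[sl su] := hsr.
have bulkN w : 0 < cn w < 1 -> Nsym C1 s (bc_extreq C1 1) w (kap C1 s w) =
    1 - (cd C1 s)%:C * kap C1 s w * w - (3 / 4)%:C * w * (1 + (s - 1)%:C * w * kap C1 s w).
  move=> /[dup] w01 /andP[w0 w1]; have [hk _ _ _] := kapP hCs w01.
  by rewrite Nsym_extreq1_bulk// ?p// -cn_gt0.
apply: (@inflow_MU_E _ C1 s hCs C10 lam _ 4 2) => //.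
- move=> w w01; rewrite bulkN//; set k := kap _ _ _.
  have w1 : cn w <= 1 by case/andP: w01 => _ /ltW.
  have k1 : cn k <= 1 by exact: cn_kap_le1.
  have e : (cd C1 s)%:C + (3 / 4)%:C + (3 / 4)%:C * (s - 1)%:C = 1 :> R[i].
    by rewrite -!rmorphM -!rmorphD -(rmorph1 (real_complex R)); congr (_%:C); rewrite d; field.
  (* By [e] the coefficients sum to 1, so the determinant vanishes at (1, 1) and splits into
     multiples of 1 - w and 1 - k. *)
  have -> : 1 - (cd C1 s)%:C * k * w - (3 / 4)%:C * w * (1 + (s - 1)%:C * w * k) =
    ((cd C1 s)%:C + (3 / 4)%:C + (3 / 4)%:C * (s - 1)%:C * (1 + w)) * (1 - w) +
    ((cd C1 s)%:C * w + (3 / 4)%:C * (s - 1)%:C * w ^+ 2) * (1 - k).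
    by rewrite -[X in X - _ * w]e; ring.
  rewrite (le_trans (cnD _ _))// !cnM lerD// ler_wpM2r ?cn_ge0//.
    rewrite (le_trans (cnD _ _))//; have := cnD (cd C1 s)%:C (3 / 4)%:C.
    rewrite !cnM !cn_real (ger0_norm (_ : 0 <= 3 / 4)); last by lra.
    rewrite (ger0_norm (_ : 0 <= s - 1)); last by lra.
    have hw : cn (1 + w) <= 2 by rewrite (le_trans (cnD _ _))// cn1; lra.
    have : 3 / 4 * (s - 1) * cn (1 + w) <= 3 / 4 * 1 * 2.
      by rewrite ler_pM ?cn_ge0 ?mulr_ge0//; lra.
    have := cd_small; lra.
  rewrite (le_trans (cnD _ _))// !cnM !cn_real (ger0_norm (_ : 0 <= 3 / 4)); last by lra.
  rewrite (ger0_norm (_ : 0 <= s - 1)); last by lra.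
  have w2 : cn w * cn w <= 1 by rewrite mulr_ile1 ?cn_ge0.
  have : 3 / 4 * (s - 1) * (cn w * cn w) <= 3 / 4 * 1 * 1.
    by rewrite ler_pM ?mulr_ge0 ?cn_ge0//; lra.
  have : `|cd C1 s| * cn w <= 1 * 1 by rewrite ler_pM ?cn_ge0// cd_small.
  lra.
- move=> w /[dup] w01 /andP[w0 w1]; rewrite bulkN//; set k := kap _ _ _.
  have k1 : cn k <= 1 by exact: cn_kap_le1.
  have -> : 1 - (cd C1 s)%:C * k * w - (3 / 4)%:C * w * (1 + (s - 1)%:C * w * k) =
    (1 - (3 / 4)%:C * w) - (k * w) * ((cd C1 s)%:C + (3 / 4)%:C * (s - 1)%:C * w) by ring.
  apply: dominated_neq0; first by rewrite cnM mulr_ile1 ?cn_ge0// ltW.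
  have w2 : cn w ^+ 2 < 1 by rewrite expr_lt1 ?cn_ge0.
  move: w2; rewrite !cn_sqr; case: (w) => x y /= w2.
  have x1 : x < 1.
    rewrite ltNge; apply/negP => x1; have : 1 <= x ^+ 2 by rewrite exprn_ege1.
    by have := sqr_ge0 y; lra.
  rewrite !mul0r !subr0 !addr0 d.
  have y2 := sqr_ge0 y; have x12 := sqr_ge0 (1 - x).
  by case: hs => ->; lra.
rewrite Nsym_extreq1 !mulr1 p -(rmorph1 (real_complex R)) -!rmorphB -!rmorphM -rmorphB.
by rewrite -(rmorph0 (real_complex R)); congr (_%:C); rewrite d c; field.
Qed.

Lemma future_inflow : lab_MU_E lam C1 s (bc_future C1).
Proof.
have hCs := adm_inflow hs; have [d c p] := coef_inflow hs.
have C10 : 0 < C1 by lra.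
have hsr := s_range; have /andP[sl su] := hsr.
apply: (@inflow_MU_E _ C1 s hCs C10 lam _ 2 4) => //.
- move=> w w01; rewrite Nsym_future p; set k := kap _ _ _.
  have w1 : cn w <= 1 by case/andP: w01 => _ /ltW.
  have k1 : cn k <= 1 by exact: cn_kap_le1.
  have e : (cd C1 s)%:C + (3 / 4)%:C + (3 / 4)%:C * (s - 1)%:C = 1 :> R[i].
    by rewrite -!rmorphM -!rmorphD -(rmorph1 (real_complex R)); congr (_%:C); rewrite d; field.
  have -> : 1 - (cd C1 s)%:C * k * w - (3 / 4)%:C * k * (1 + (s - 1)%:C * k * w) =
    ((cd C1 s)%:C * k + (3 / 4)%:C * (s - 1)%:C * k ^+ 2) * (1 - w) +
    ((cd C1 s)%:C + (3 / 4)%:C + (3 / 4)%:C * (s - 1)%:C * (1 + k)) * (1 - k).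
    by rewrite -[X in X - _ * w]e; ring.
  rewrite (le_trans (cnD _ _))// !cnM lerD// ler_wpM2r ?cn_ge0//.
    rewrite (le_trans (cnD _ _))// !cnM !cn_real (ger0_norm (_ : 0 <= 3 / 4)); last by lra.
    rewrite (ger0_norm (_ : 0 <= s - 1)); last by lra.
    have w2 : cn k * cn k <= 1 by rewrite mulr_ile1 ?cn_ge0.
    have : 3 / 4 * (s - 1) * (cn k * cn k) <= 3 / 4 * 1 * 1.
      by rewrite ler_pM ?mulr_ge0 ?cn_ge0//; lra.
    have : `|cd C1 s| * cn k <= 1 * 1 by rewrite ler_pM ?cn_ge0// cd_small.
    lra.
  rewrite (le_trans (cnD _ _))//; have := cnD (cd C1 s)%:C (3 / 4)%:C.
  rewrite !cnM !cn_real (ger0_norm (_ : 0 <= 3 / 4)); last by lra.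
  rewrite (ger0_norm (_ : 0 <= s - 1)); last by lra.
  have hw : cn (1 + k) <= 2 by rewrite (le_trans (cnD _ _))// cn1; lra.
  have : 3 / 4 * (s - 1) * cn (1 + k) <= 3 / 4 * 1 * 2.
    by rewrite ler_pM ?cn_ge0 ?mulr_ge0//; lra.
  have := cd_small; lra.
- move=> w /[dup] w01 /andP[w0 w1]; rewrite Nsym_future p; set k := kap _ _ _.
  have k1 : cn k <= 1 by exact: cn_kap_le1.
  have -> : 1 - (cd C1 s)%:C * k * w - (3 / 4)%:C * k * (1 + (s - 1)%:C * k * w) =
    (1 - (cd C1 s)%:C * (k * w)) - k * ((3 / 4)%:C * (1 + (s - 1)%:C * (k * w))) by ring.
  apply: dominated_neq0 => //.
  have w2 : cn (k * w) ^+ 2 < 1.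
    by rewrite expr_lt1 ?cn_ge0// cnM (le_lt_trans _ w1)// ler_piMl ?cn_ge0.
  move: w2; rewrite !cn_sqr; case: (k * w) => x y /= w2.
  have x1 : x < 1.
    rewrite ltNge; apply/negP => x1; have : 1 <= x ^+ 2 by rewrite exprn_ege1.
    by have := sqr_ge0 y; lra.
  rewrite !mul0r !subr0 !addr0 d.
  have y2 := sqr_ge0 y; have x12 := sqr_ge0 (1 - x).
  by case: hs => ->; lra.
rewrite Nsym_future !mulr1 p -(rmorph1 (real_complex R)) -!rmorphD -!rmorphM -!rmorphB.
by rewrite -(rmorph0 (real_complex R)); congr (_%:C); rewrite d; field.
Qed.

End InflowSpecial.

(** * Godunov-Ryabenkii modes *)

Section GodunovRyabenkii.
Variable R : realType.
Implicit Types (C s x lam : R) (z k y : R[i]).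

(* With k = 2 - z the bulk polynomial factors as (1 - z) Q(z) and the boundary equation is Q(z) = 0. *)
Lemma invented_GR lam C s : 0 < lam -> admissible C s -> C < 1 -> lab_GR_L lam C s (bc_invented R).
Proof.
move=> lam0 hCs C1; have /andP[s0 s2] := admissible_s hCs.
set d := cd C s.
pose Q : {poly R} := (1 + d)%:P * 'X^2 - (1 + 3 * d)%:P * 'X - (2 * (s - 1))%:P.
have QE x : Q.[x] = (1 + d) * x ^+ 2 - (1 + 3 * d) * x - 2 * (s - 1) by rewrite /Q !hornerE.
(* [Q(1) = s (C - 1)] and [Q(3) = 8 - 2 s]; on (1, 3) both [z > 1] and [|2 - z| < 1] hold. *)
have Q1 : Q.[1] < 0.
  rewrite QE /d /cd; have : s * (C - 1) < 0 by rewrite pmulr_rlt0// subr_lt0.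
  by lra.
have Q3 : 0 < Q.[3] by rewrite QE; lra.
have [x /andP[x1 x3] /rootP rx] : exists2 x, 1 <= x <= 3 & root Q x.
  by apply: poly_ivt; [lra|rewrite (ltW Q1) (ltW Q3)].
have x1' : 1 < x.
  by rewrite lt_def x1 andbT; apply/eqP => e; move: Q1; rewrite -e rx ltxx.
have x3' : x < 3.
  by rewrite lt_def x3 andbT; apply/eqP => e; move: Q3; rewrite e rx ltxx.
rewrite QE in rx.
have x0 : x != 0 by rewrite gt_eqF//; lra.
have z0 : x%:C != 0 :> R[i] by rewrite -(rmorph0 (real_complex R)) (inj_eq (@complexI R)).
apply: (@GR_L_intro _ lam C s _ x%:C (2 - x)%:C) => //.
- by rewrite cn_real gtr0_norm; lra.
- by rewrite cn_real ltr_norml; lra.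
- apply/(bulk_char_kchar C s _ z0); rewrite bulk_charE.
  rewrite -!rmorphXn -!rmorphM -rmorphD -rmorphM -rmorphB -rmorphD.
  rewrite -(rmorph0 (real_complex R)); congr (_%:C).
  have -> : ca C s = 2 - s - d by rewrite /d /ca /cd; field.
  rewrite -/d; transitivity ((1 - x) * ((1 + d) * x ^+ 2 - (1 + 3 * d) * x - 2 * (s - 1))).
    by ring.
  by rewrite rx mulr0.
rewrite Nsym_invented -fmorphV -(rmorph1 (real_complex R)) -(rmorph_nat (real_complex R) 2).
rewrite -!rmorphM -!rmorphB -!rmorphM -rmorphB -(rmorph0 (real_complex R)); congr (_%:C).
have -> : cc C s = d + s - 1 by rewrite /d /cc /cd; field.
rewrite -/d; transitivity (((1 + d) * x ^+ 2 - (1 + 3 * d) * x - 2 * (s - 1)) / x).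
  by field.
by rewrite rx mul0r.
Qed.

(* Eliminating z^2 between the bulk and boundary equations leaves z = (s - 1) k A / B and one
   polynomial equation in y = 1 - k. *)
Lemma extreq3_elimination lam C s y (A B z : R[i]) : 0 < lam -> admissible C s ->
  let p := ((1 + C) / 2)%:C in let E := 1 - y ^+ 3 in let k := 1 - y in
  A = 1 - p * E -> B = p * E - (ca C s)%:C ->
  k ^+ 2 * A * ((s - 1)%:C * A - (cd C s)%:C * B) - (ca C s)%:C * A * B - B ^+ 2 = 0 ->
  B != 0 -> k != 0 -> z * B = (s - 1)%:C * k * A -> 1 < cn z -> cn k < 1 ->
  lab_GR_L lam C s (bc_extreq C 3).
Proof.
move=> lam0 hCs; cbv zeta; set p := ((1 + C) / 2)%:C; set k := 1 - y.
set a := (ca C s)%:C; set d := (cd C s)%:C; set S := (s - 1)%:C.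
move=> hA hB hF B0 k0 hz z1 k1.
have z0 : z != 0 by rewrite -cn_gt0 (lt_trans ltr01).
have hbulk : bulk_char C s z k = 0.
  have e1 : (1 - s)%:C = - S by rewrite /S -rmorphN opprB.
  have : B ^+ 2 * bulk_char C s z k = 0.
    rewrite bulk_charE -/a -/d e1.
    have -> : B ^+ 2 * (k * z ^+ 2 - z * (a + d * k ^+ 2) + - S * k) =
      k * (z * B) ^+ 2 - (z * B) * B * (a + d * k ^+ 2) - S * k * B ^+ 2 by ring.
    rewrite hz.
    have -> : k * (S * k * A) ^+ 2 - S * k * A * B * (a + d * k ^+ 2) - S * k * B ^+ 2 =
      S * k * (k ^+ 2 * A * (S * A - d * B) - a * A * B - B ^+ 2) by ring.
    by rewrite hF mulr0.
  by move=> /eqP; rewrite mulf_eq0 expf_eq0/= (negbTE B0) => /eqP.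
have hk := (bulk_char_kchar C s k z0).1 hbulk.
apply: (@GR_L_intro _ lam C s _ z k) => //.
have zi : z^-1 != 0 by rewrite invr_eq0.
rewrite (Nsym_extreq3_bulk zi hk) -/p -/d -/S.
apply: (mulfI (mulf_neq0 k0 (expf_neq0 2 z0))); rewrite mulr0.
have e1 : (1 - s)%:C = - S by rewrite /S -rmorphN opprB.
transitivity (bulk_char C s z k - (z * B - S * k * A)).
  rewrite bulk_charE -/a -/d e1 hA hB /k; field; exact: z0.
by rewrite hbulk hz !subrr.
Qed.

(* p'/p is the sum of the 1 / (z - r), so the nearest root is within deg p |p/p'|. *)
Lemma near_root (p : {poly R[i]}) z (e : R) :
  ((size p).-1)%:R * cn p.[z] < e * cn p^`().[z] -> exists2 r, root p r & cn (z - r) <= e.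
Proof.
move=> h; have [rs Dp] := closed_field_poly_normal p.
have p0 : p != 0.
  by apply/eqP => e0; move: h; rewrite e0 deriv0 !horner0 cn0 !mulr0 ltxx.
have lc0 : lead_coef p != 0 by rewrite lead_coef_eq0.
case: (pselect (exists2 r, r \in rs & cn (z - r) <= e)) => [[r hr he]|hno].
  by exists r => //; rewrite Dp rootZ// root_prod_XsubC.
exfalso; have hfar r : r \in rs -> e <= cn (z - r).
  by move=> hr; rewrite leNgt; apply/negP => /ltW hle; apply: hno; exists r.
have sz : (size p).-1 = size rs by rewrite {1}Dp size_scale// size_prod_XsubC.
have key : forall ss : seq R[i], {subset ss <= rs} ->
  e * cn (\prod_(r <- ss) ('X - r%:P))^`().[z] <= (size ss)%:R * cn (\prod_(r <- ss) ('X - r%:P)).[z].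
  elim=> [|r ss ih] hss; first by rewrite big_nil derivC horner0 cn0 mulr0 mul0r.
  have {}ih := ih (fun v hv => hss v (mem_behead (s := r :: ss) hv)).
  rewrite big_cons derivM derivXsubC mul1r hornerD !hornerM hornerXsubC cnM.
  set P := \prod_(_ <- _) _ in ih *.
  have hr := hfar r (hss r (mem_head _ _)).
  have e0 : 0 <= cn (z - r) by exact: cn_ge0.
  case: (lerP 0 e) => e1; last first.
    apply: (@le_trans _ _ 0); first by rewrite nmulr_rle0// cn_ge0.
    by rewrite mulr_ge0// mulr_ge0 ?cn_ge0.
  apply: (@le_trans _ _ (e * (cn P.[z] + cn (z - r) * cn P^`().[z]))).
    by rewrite ler_wpM2l// -cnM cnD.
  rewrite /= -natr1 mulrDr.
  have b1 := ler_wpM2r (cn_ge0 P.[z]) hr; have b2 := ler_wpM2l e0 ih; lra.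
have := key rs (fun _ => id); set P := \prod_(_ <- _) _ => hk.
move: h; rewrite sz {1 2}Dp -/P derivZ !hornerZ !cnM ltNge => /negP; apply.
by have := ler_wpM2l (cn_ge0 (lead_coef p)) hk; lra.
Qed.

(** The last hypothesis is z > 1 with the denominator B cleared. *)
Lemma extreq3_real lam C s x : 0 < lam -> admissible C s ->
  let p := (1 + C) / 2 in let k := 1 - x in let A := 1 - p * (1 - x ^+ 3) in
  let B := p * (1 - x ^+ 3) - ca C s in
  k ^+ 2 * A * ((s - 1) * A - cd C s * B) - ca C s * A * B - B ^+ 2 = 0 ->
  0 < x < 1 -> 0 < B -> B < (s - 1) * k * A -> lab_GR_L lam C s (bc_extreq C 3).
Proof.
move=> lam0 hCs; cbv zeta; set p := (1 + C) / 2; set k := 1 - x.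
set A := 1 - p * (1 - x ^+ 3); set B := p * (1 - x ^+ 3) - ca C s => hF /andP[x0 x1] B0 hz.
have kC : 1 - x%:C = k%:C :> R[i] by rewrite /k rmorphB rmorph1.
have EC : 1 - x%:C ^+ 3 = (1 - x ^+ 3)%:C :> R[i] by rewrite rmorphB rmorph1 rmorphXn.
apply: (@extreq3_elimination lam C s x%:C A%:C B%:C ((s - 1) * k * A / B)%:C) => //.
- by rewrite EC /A rmorphB rmorph1 rmorphM.
- by rewrite EC /B rmorphB rmorphM.
- rewrite kC -!rmorphXn -!rmorphM -!rmorphB -!rmorphM -!rmorphB hF; exact: rmorph0.
- by rewrite -cn_gt0 cn_real normr_gt0 gt_eqF.
- by rewrite kC -cn_gt0 cn_real normr_gt0 /k gt_eqF// subr_gt0.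
- by rewrite kC -!rmorphM divfK// gt_eqF.
- by rewrite cn_real (lt_le_trans _ (ler_norm _))// ltr_pdivlMr// mul1r.
- by rewrite kC cn_real /k gtr0_norm; lra.
Qed.

(** A root y = 1 - k of the elimination polynomial is bracketed by the intermediate value theorem,
    in an interval short enough for z > 1 to hold throughout. *)
Lemma extreq3_inflow lam s : 0 < lam -> s = 3 / 2 \/ s = 2 ->
  lab_GR_L lam (1 / 2) s (bc_extreq (1 / 2) 3).
Proof.
move=> lam0 hs; have hCs := adm_inflow hs.
pose C : R := 1 / 2; pose p : R := (1 + C) / 2.
pose A : {poly R} := 1 - p%:P * (1 - 'X^3).
pose B : {poly R} := p%:P * (1 - 'X^3) - (ca C s)%:P.
pose F : {poly R} := (1 - 'X) ^+ 2 * A * ((s - 1)%:P * A - (cd C s)%:P * B) - (ca C s)%:P * A * B - B ^+ 2.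
have FE x : F.[x] = (1 - x) ^+ 2 * (1 - p * (1 - x ^+ 3)) *
   ((s - 1) * (1 - p * (1 - x ^+ 3)) - cd C s * (p * (1 - x ^+ 3) - ca C s)) -
   ca C s * (1 - p * (1 - x ^+ 3)) * (p * (1 - x ^+ 3) - ca C s) - (p * (1 - x ^+ 3) - ca C s) ^+ 2.
  by rewrite /F /A /B !(hornerE, horner_exp).
have [lo [hi [lh hlo hhi fin]]] : exists lo hi : R, [/\ lo <= hi, F.[lo] <= 0, 0 <= F.[hi] &
    forall x, lo <= x <= hi -> [/\ 0 < x < 1, 0 < p * (1 - x ^+ 3) - ca C s &
       p * (1 - x ^+ 3) - ca C s < (s - 1) * (1 - x) * (1 - p * (1 - x ^+ 3))]].
  have cube x (lo hi : R) : 0 <= lo -> lo <= x <= hi -> lo ^+ 3 <= x ^+ 3 <= hi ^+ 3.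
    by move=> l0 /andP[l1 l2]; rewrite !lerXn2r ?nnegrE//; lra.
  case: hs => es.
  - have da : ca C s = 5 / 8 by rewrite /ca /C es; field.
    have dd : cd C s = - (1 / 8) by rewrite /cd /C es; field.
    exists (43 / 100), (44 / 100); rewrite !FE da dd es /p /C; split; [lra|lra|lra|].
    move=> x hx; have := cube x _ _ (_ : 0 <= 43/100) hx.
    case/andP: hx => h1 h2 => /(_ ltac:(lra)) /andP[c1 c2].
    (* Replacing the factor 1 - x by its lower bound leaves inequalities that are linear in
       [x ^+ 3]. *)
    have hA : 56/100 * (1 - (1 + 1 / 2) / 2 * (1 - x ^+ 3)) <= (1 - x) * (1 - (1 + 1 / 2) / 2 * (1 - x ^+ 3)).
      by rewrite ler_wpM2r//; lra.
    by split; lra.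
  - have da : ca C s = 1 / 2 by rewrite /ca /C es; field.
    have dd : cd C s = - (1 / 2) by rewrite /cd /C es; field.
    exists (57 / 100), (59 / 100); rewrite !FE da dd es /p /C; split; [lra|lra|lra|].
    move=> x hx; have := cube x _ _ (_ : 0 <= 57/100) hx.
    case/andP: hx => h1 h2 => /(_ ltac:(lra)) /andP[c1 c2].
    have hA : 41/100 * (1 - (1 + 1 / 2) / 2 * (1 - x ^+ 3)) <= (1 - x) * (1 - (1 + 1 / 2) / 2 * (1 - x ^+ 3)).
      by rewrite ler_wpM2r//; lra.
    by split; lra.
have [x hx /rootP rx] : exists2 x, lo <= x <= hi & root F x.
  by apply: poly_ivt => //; rewrite hlo hhi.
have [x01 B0 hz] := fin x hx; rewrite FE in rx.
exact: (@extreq3_real lam C s x lam0 hCs rx x01 B0 hz).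
Qed.

End GodunovRyabenkii.

(** * C = -1/2, s = 2: a complex unstable mode *)

Section ComplexMode.
Variable R : realType.
Implicit Types (lam C s : R) (z : R[i]).
(* The factor of the elimination polynomial of [extreq3_elimination] for C = -1/2, s = 2 carrying the
   unstable mode. *)
Definition sextic (T : comNzRingType) : {poly T} := Poly [:: 6%:R; 3%:R; - 5%:R; 3%:R; -1; -1; 1].

Lemma sexticE (T : comNzRingType) (z : T) : (sextic T).[z] =
  z ^+ 6 - z ^+ 5 - z ^+ 4 + 3%:R * z ^+ 3 - 5%:R * z ^+ 2 + 3%:R * z + 6%:R.
Proof. rewrite horner_Poly /=; ring. Qed.

Lemma dsexticE (T : comNzRingType) (z : T) : (sextic T)^`().[z] =
  6%:R * z ^+ 5 - 5%:R * z ^+ 4 - 4%:R * z ^+ 3 + 9%:R * z ^+ 2 - 10%:R * z + 3%:R.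
Proof.
rewrite /sextic [Poly _]/= !cons_poly_def !derivMXaddC deriv0.
rewrite !(hornerD, hornerMX, hornerC, horner0); ring.
Qed.

Lemma size_sextic (T : comNzRingType) : ((size (sextic T)).-1 <= 6)%N.
Proof. by move: (size_Poly [:: 6%:R; 3%:R; - 5%:R; 3%:R; -1; -1; 1 : T]); case: size. Qed.

(** Rational approximation of the root y = 1 - k. This mode is not real, so it is located by
    [near_root] instead of a change of sign. *)
Definition approx_root : R[i] := Complex (719 / 500) (71 / 125).

Lemma Complex_powers (a b : R) : let z := Complex a b in
  [/\ z ^+ 2 = Complex (a ^+ 2 - b ^+ 2) (2 * a * b),
      z ^+ 3 = Complex (a ^+ 3 - 3 * a * b ^+ 2) (3 * a ^+ 2 * b - b ^+ 3),
      z ^+ 4 = Complex (a ^+ 4 - 6 * a ^+ 2 * b ^+ 2 + b ^+ 4) (4 * a ^+ 3 * b - 4 * a * b ^+ 3),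
      z ^+ 5 = Complex (a ^+ 5 - 10 * a ^+ 3 * b ^+ 2 + 5 * a * b ^+ 4)
         (5 * a ^+ 4 * b - 10 * a ^+ 2 * b ^+ 3 + b ^+ 5) &
      z ^+ 6 = Complex (a ^+ 6 - 15 * a ^+ 4 * b ^+ 2 + 15 * a ^+ 2 * b ^+ 4 - b ^+ 6)
         (6 * a ^+ 5 * b - 20 * a ^+ 3 * b ^+ 3 + 6 * a * b ^+ 5)].
Proof.
cbv zeta.
have mE (x y u v : R) : Complex x y * Complex u v = Complex (x * u - y * v) (x * v + y * u) by [].
have e2 : Complex a b ^+ 2 = Complex (a ^+ 2 - b ^+ 2) (2 * a * b) by rewrite expr2 mE; congr Complex; ring.
have e3 : Complex a b ^+ 3 = Complex (a ^+ 3 - 3 * a * b ^+ 2) (3 * a ^+ 2 * b - b ^+ 3).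
  by rewrite exprS e2 mE; congr Complex; ring.
have e4 : Complex a b ^+ 4 =
    Complex (a ^+ 4 - 6 * a ^+ 2 * b ^+ 2 + b ^+ 4) (4 * a ^+ 3 * b - 4 * a * b ^+ 3).
  by rewrite exprS e3 mE; congr Complex; ring.
have e5 : Complex a b ^+ 5 = Complex (a ^+ 5 - 10 * a ^+ 3 * b ^+ 2 + 5 * a * b ^+ 4)
    (5 * a ^+ 4 * b - 10 * a ^+ 2 * b ^+ 3 + b ^+ 5).
  by rewrite exprS e4 mE; congr Complex; ring.
by split=> //; rewrite exprS e5 mE; congr Complex; ring.
Qed.

Lemma ReImE : (forall u v : R, Re (Complex u v) = u) * (forall u v : R, Im (Complex u v) = v) *
  (forall u v : R[i], Re (u * v) = Re u * Re v - Im u * Im v) *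
  (forall u v : R[i], Im (u * v) = Re u * Im v + Im u * Re v) *
  (forall u v : R[i], Re (u + v) = Re u + Re v) * (forall u v : R[i], Im (u + v) = Im u + Im v) *
  (forall u : R[i], Re (- u) = - Re u) * (forall u : R[i], Im (- u) = - Im u) *
  (forall n, Re (n%:R : R[i]) = n%:R) * (forall n, Im (n%:R : R[i]) = 0).
Proof.
by do 9 ?split=> //; do ?[case=> ? ?|move=> n]; do ?[case=> ? ?]; rewrite // -(rmorph_nat (real_complex R)).
Qed.

(** At the approximate root the value is at most 1/100, the derivative at least 26.6, and the degree
    at most 6; the radius follows from [6 / 100 < 26.6 / 400]. *)
Lemma sextic_root : exists2 y, root (sextic _) y & cn (approx_root - y) <= 1 / 400.
Proof.
have [e2 e3 e4 e5 e6] := Complex_powers (719 / 500) (71 / 125).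
have fr : - (4 / 1000) <= Re (sextic _).[approx_root] <= 4 / 1000.
  by rewrite sexticE e6 e5 e4 e3 e2 !ReImE; clear; apply/andP; split; lra.
have fi : 0 <= Im (sextic _).[approx_root] <= 91 / 10000.
  by rewrite sexticE e6 e5 e4 e3 e2 !ReImE; clear; apply/andP; split; lra.
have gr : Re (sextic _)^`().[approx_root] <= - 20.
  by rewrite dsexticE e5 e4 e3 e2 !ReImE; clear; lra.
have gi : 176 / 10 <= Im (sextic _)^`().[approx_root].
  by rewrite dsexticE e5 e4 e3 e2 !ReImE; clear; lra.
clear e2 e3 e4 e5 e6.
have hs : (size (sextic R[i])).-1%:R * cn (sextic _).[approx_root] <= 6 * cn (sextic _).[approx_root].
  by rewrite ler_wpM2r ?cn_ge0// ler_nat size_sextic.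
apply: near_root; apply: (le_lt_trans hs).
move: (cn_sqr (sextic _).[approx_root]) (cn_sqr (sextic _)^`().[approx_root])
  (cn_ge0 (sextic _).[approx_root]) (cn_ge0 (sextic _)^`().[approx_root]) fr fi gr gi {hs}.
move: (cn _) (cn _) (Re _) (Re _) (Im _) (Im _) => g f gr fr gi fi ef eg f0 g0
  /andP[a1 a2] /andP[b1 b2] c1 c2.
have f1 : f <= 1 / 100.
  by rewrite -ler_sqr ?nnegrE//; rewrite ef; nra.
have g1 : 266 / 10 <= g.
  by rewrite -ler_sqr ?nnegrE//; rewrite eg; nra.
by lra.
Qed.

(** The bounds at [approx_root] hold with a margin that covers a displacement of 1/400; the last
    modulus, that of z, is about 1.1. *)
Lemma near_approx_root y : cn (approx_root - y) <= 1 / 400 ->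
  [/\ cn (1 - y) < 1, 1 - y != 0, 3%:R - y ^+ 3 != 0 &
      1 < cn ((1 - y) * (3%:R + y ^+ 3) / (3%:R - y ^+ 3))].
Proof.
move=> hy.
have bnd (u : R[i]) (x : R) : 0 <= x -> cn u ^+ 2 <= x ^+ 2 -> cn u <= x.
  by move=> x0; rewrite ler_sqr ?nnegrE ?cn_ge0.
have bnd' (u : R[i]) (x : R) : 0 <= x -> x ^+ 2 <= cn u ^+ 2 -> x <= cn u.
  by move=> x0; rewrite ler_sqr ?nnegrE ?cn_ge0.
have k0_up : cn (1 - approx_root) <= 718 / 1000.
  by apply: bnd; [lra|rewrite cn_sqr -[1]/(1%:R) !ReImE; clear; lra].
have k0_lo : 717 / 1000 <= cn (1 - approx_root).
  by apply: bnd'; [lra|rewrite cn_sqr -[1]/(1%:R) !ReImE; clear; lra].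
have y0_up : cn approx_root <= 155 / 100.
  by apply: bnd; [lra|rewrite cn_sqr !ReImE; clear; lra].
have [_ e3 _ _ _] := Complex_powers (719 / 500) (71 / 125).
have p0 : 566 / 100 <= cn (3%:R + approx_root ^+ 3).
  by apply: bnd'; [lra|rewrite cn_sqr e3 !ReImE; clear; lra].
have m0 : cn (3%:R - approx_root ^+ 3) <= 364 / 100.
  by apply: bnd; [lra|rewrite cn_sqr e3 !ReImE; clear; lra].
have m0' : 3 <= cn (3%:R - approx_root ^+ 3).
  by apply: bnd'; [lra|rewrite cn_sqr e3 !ReImE; clear; lra].
clear bnd bnd' e3.
move: approx_root hy k0_up k0_lo y0_up p0 m0 m0' => v hy k0_up k0_lo y0_up p0 m0 m0'.
have yy : cn y <= 156 / 100.
  have -> : y = v - (v - y) by ring.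
  by rewrite (le_trans (cnB _ _))//; lra.
have cube : cn (v ^+ 3 - y ^+ 3) <= 3 / 100.
  have -> : v ^+ 3 - y ^+ 3 =
    (v - y) * (v * v + (v * y + y * y)) by ring.
  have h1 : cn (v * v + (v * y + y * y)) <= 8.
    rewrite (le_trans (cnD _ _))//; have := cnD (v * y) (y * y); rewrite !cnM.
    have a1 : cn v * cn v <= 155 / 100 * (155 / 100) by rewrite ler_pM ?cn_ge0.
    have a2 : cn v * cn y <= 155 / 100 * (156 / 100) by rewrite ler_pM ?cn_ge0.
    have a3 : cn y * cn y <= 156 / 100 * (156 / 100) by rewrite ler_pM ?cn_ge0.
    by lra.
  rewrite cnM; have : cn (v - y) *
      cn (v * v + (v * y + y * y)) <= 1 / 400 * 8.
    by rewrite ler_pM ?cn_ge0.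
  by lra.
have k_up : cn (1 - y) < 1.
  have -> : 1 - y = (1 - v) + (v - y) by ring.
  by rewrite (le_lt_trans (cnD _ _))//; lra.
have k_lo : 714 / 1000 <= cn (1 - y).
  have -> : 1 - y = (1 - v) + (v - y) by ring.
  by apply: le_trans (cn_le_sub _ _); lra.
have p_lo : 563 / 100 <= cn (3%:R + y ^+ 3).
  have -> : 3%:R + y ^+ 3 = (3%:R + v ^+ 3) + - (v ^+ 3 - y ^+ 3) by ring.
  by apply: le_trans (cn_le_sub _ _); rewrite cnN; lra.
have m_up : cn (3%:R - y ^+ 3) <= 367 / 100.
  have -> : 3%:R - y ^+ 3 = (3%:R - v ^+ 3) + (v ^+ 3 - y ^+ 3) by ring.
  by rewrite (le_trans (cnD _ _))//; lra.
have m_lo : 2 <= cn (3%:R - y ^+ 3).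
  have -> : 3%:R - y ^+ 3 = (3%:R - v ^+ 3) + (v ^+ 3 - y ^+ 3) by ring.
  by apply: le_trans (cn_le_sub _ _); lra.
have mn0 : 3%:R - y ^+ 3 != 0 by rewrite -cn_gt0; lra.
split=> //; first by rewrite -cn_gt0; lra.
rewrite !cnM cnV ltr_pdivlMr ?mul1r; last by lra.
have : 714 / 1000 * (563 / 100) <= cn (1 - y) * cn (3%:R + y ^+ 3) by apply: ler_pM; lra.
by lra.
Qed.

Lemma extreq3_outflow lam : 0 < lam -> lab_GR_L lam (- (1 / 2)) 2 (bc_extreq (- (1 / 2) : R) 3).
Proof.
move=> lam0; have [y /rootP ry /near_approx_root[k1 k0 mn0 z1]] := sextic_root.
rewrite sexticE in ry.
have [d c a p s1] := coef2 R.
apply: (@extreq3_elimination R lam (- (1 / 2)) 2 y ((3%:R + y ^+ 3) / 4%:R) ((3%:R - y ^+ 3) / 4%:R)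
  ((1 - y) * (3%:R + y ^+ 3) / (3%:R - y ^+ 3)) lam0 (adm2 R)) => //.
- by rewrite p !crat; field.
- by rewrite p a !crat; field.
- rewrite s1 d a !crat.
  (* The factors y and y - 1 stand for k = 1 and k = 0; the unstable mode is a root of the
     sextic. *)
  transitivity (3%:R / 32%:R * y * (y - 1) *
    (y ^+ 6 - y ^+ 5 - y ^+ 4 + 3%:R * y ^+ 3 - 5%:R * y ^+ 2 + 3%:R * y + 6%:R)); first by field.
  by rewrite ry mulr0.
- by rewrite mulf_neq0// invr_eq0 pnatr_eq0.
- by rewrite s1 rmorph1; field.
Qed.

End ComplexMode.

End D1Q2Boundary.

Theorem mainTheorem6 (R : realType) (lam : R) (hlam : 0 < lam) :
  (* (A) general parameters *)
  (forall C s : R,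
     ((0 < s < 2 /\ 0 < `|C| <= 1) \/ (s = 2 /\ 0 < `|C| < 1)) ->
     (C < 0 -> s < 2 ->
        lab_MU_L lam C s (bc_BB R) /\
        lab_MU_L lam C s (bc_ABB R) /\
        lab_SS lam C s (bc_ABB2 R) /\
        lab_SS lam C s (bc_extr R 1) /\
        (forall sigma : nat, (2 <= sigma <= 4)%N -> lab_SS lam C s (bc_extr R sigma)) /\
        lab_SS lam C s (bc_KD R)) /\
     (C < 0 -> s = 2 ->
        lab_MU_E lam C s (bc_BB R) /\
        lab_MU_E lam C s (bc_ABB R) /\
        lab_SSOO lam C s (bc_ABB2 R) /\
        lab_SSOO lam C s (bc_extr R 1) /\
        (forall sigma : nat, (2 <= sigma <= 4)%N -> lab_MU_E lam C s (bc_extr R sigma)) /\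
        lab_SS lam C s (bc_KD R)) /\
     (0 < C ->
        lab_SS lam C s (bc_BB R) /\
        lab_SS lam C s (bc_ABB R) /\
        lab_SS lam C s (bc_ABB2 R) /\
        lab_MU_E lam C s (bc_extr R 1) /\
        (forall sigma : nat, (2 <= sigma <= 4)%N -> lab_MU_E lam C s (bc_extr R sigma)) /\
        lab_SS lam C s (bc_KD R))) /\
  (* (B) specific parameters *)
  (let C := (- (1 / 2)) : R in let s := (3 / 2) : R in
     lab_SS lam C s (bc_extreq C 1) /\
     lab_SS lam C s (bc_extreq C 3) /\
     lab_SS lam C s (bc_future C) /\
     lab_GR_L lam C s (bc_invented R)) /\
  (let C := (- (1 / 2)) : R in let s := 2 : R in
     lab_SS lam C s (bc_extreq C 1) /\
     lab_GR_L lam C s (bc_extreq C 3) /\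
     lab_SS lam C s (bc_future C) /\
     lab_GR_L lam C s (bc_invented R)) /\
  (forall s : R, s = 3 / 2 \/ s = 2 ->
     let C := (1 / 2) : R in
     lab_MU_E lam C s (bc_extreq C 1) /\
     lab_GR_L lam C s (bc_extreq C 3) /\
     lab_MU_E lam C s (bc_future C) /\
     lab_GR_L lam C s (bc_invented R)).
Proof.
split; [|split; [|split]].
- move=> C s hCs; split; [|split].
  + move=> C0 s2; (split; [|split; [|split; [|split; [|split; last exact: KD_stable]]]]).
    * apply: (@reflect_MU_L R C s 1) => //; first exact: expr1n.
      by move=> w k; rewrite Nsym_BB rmorph1 mul1r.
    * apply: (@reflect_MU_L R C s (-1)) => //; first by rewrite sqrrN expr1n.
      by move=> w k; rewrite Nsym_ABB rmorphN1 mulN1r mulNr opprK.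
    * exact: ABB2_outflow.
    * exact: extr_outflow.
    * by move=> sigma _; exact: extr_outflow.
  + move=> C0 s2; rewrite s2 in hCs *; (split; [|split; [|split; [|split; [|split; last exact: KD_stable]]]]).
    * apply: (@reflect_MU_E R C 2 1) => //; first exact: expr1n.
      by move=> w k; rewrite Nsym_BB rmorph1 mul1r.
    * apply: (@reflect_MU_E R C 2 (-1)) => //; first by rewrite sqrrN expr1n.
      by move=> w k; rewrite Nsym_ABB rmorphN1 mulN1r mulNr opprK.
    * exact: ABB2_conservative.
    * exact: extr1_conservative.
    * by move=> sigma /andP[h _]; exact: extr_conservative.
  + move=> C0; (split; [|split; [|split; [|split; [|split; last exact: KD_stable]]]]).
    * exact: BB_inflow.
    * exact: ABB_inflow.
    * exact: ABB2_inflow.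
    * exact: extr_inflow.
    * by move=> sigma /andP[h _]; apply: extr_inflow => //; exact: ltnW.
- split; first exact: extreq1_32.
  split; first exact: extreq3_32.
  split; first exact: future_32.
  by apply: (invented_GR hlam (adm32 R)); lra.
- split; first exact: extreq1_2.
  split; first exact: extreq3_outflow.
  split; first exact: future_2.
  by apply: (invented_GR hlam (adm2 R)); lra.
- move=> s hs.
  split; first exact: extreq1_inflow.
  split; first exact: extreq3_inflow.
  split; first exact: future_inflow.
  by apply: (invented_GR hlam (adm_inflow hs)); lra.
Qed.
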